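(* Let $p>0$ range over prime integers. \begin{enumerate} \item[(a)] Let $X$ be an $n\times n$ matrix of indeterminates over $\mathbb{Z}$, with $n\geqslant 3$, and set $R=\mathbb{Z}[X]/(\det X)$. Then for each prime $p>0$, the Frobenius trace on $R/pR$ does not lift to a differential operator on $R/p^2R$, nor, a fortiori, to a differential operator on $R$. \item[(b)] Let $X$ be an $n\times n$ alternating matrix of indeterminates over $\mathbb{Z}$, with $n\geqslant 4$ even, and set $R=\mathbb{Z}[X]/(\operatorname{pf}X)$, where $\operatorname{pf}X$ is the Pfaffian. Then for each prime $p>0$, the Frobenius trace on $R/pR$ does not lift to a differential operator on $R/p^2R$, nor, a fortiori, to a differential operator on $R$. \item[(c)] Let $X$ be a $3\times 3$ symmetric matrix of indeterminates over $\mathbb{Z}$, and set $R=\mathbb{Z}[X]/(\det X)$. Then for primes $p>2$, each differential operator on $R/pR$ lifts to a differential operator on $R$. For $p=2$, the Frobenius trace on $R/2R$ does not lift to a differential operator on $R/4R$, nor, a fortiori, to a differential operator on $R$. \end{enumerate}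
   Context: For a commutative ring $R$, differential operators are defined inductively: for $r\in R$, multiplication by $r$ is a differential operator of order $0$; an additive map $\delta:R\to R$ is a differential operator of order $\le n$ if each commutator $[\tilde r,\delta]=\tilde r\circ\delta-\delta\circ\tilde r$ ($\tilde r$ = multiplication by $r$) is a differential operator of order $\le n-1$. They form a subring $D_R$ of $\operatorname{End}_{\mathbb{Z}}(R)$. A differential operator $\delta$ on $R/pR$ lifts to a differential operator on $R$ (resp. on $R/p^2R$) if there is a differential operator $\tilde\delta$ on $R$ (resp. on $R/p^2R$) such that $\tilde\delta(r)\equiv \delta(\bar r)$ modulo $p$ for all $r$, i.e. $\delta$ is induced by $\tilde\delta$ (note $\tilde\delta$ preserves $p$-multiples since it is additive). Frobenius trace: let $K$ be a field of characteristic $p>0$, $S=K[x_0,\dots,x_d]$, $f\in S$ a nonzero homogeneous polynomial, $R=S/(f)$. For nonnegative integers $a_i$ let $\partial_{a_0,\dots,a_d}$ be the $K$-linear map on $S$ with $\partial_{a_0,\dots,a_d}(x_0^{b_0}\cdots x_d^{b_d})=\prod_i\binom{b_i}{a_i}x_0^{b_0-a_0}\cdots x_d^{b_d-a_d}$. Set $\Phi_S=\partial_{p-1,\dots,p-1}$, which maps $S$ into $S^p$. The composite $S\xrightarrow{f^{p-1}}S\xrightarrow{\Phi_S}S^p\to R^p$ kills $fS$, hence induces $\Phi_R:R\to R^p\subseteq R$, the Frobenius trace of $R$; it is a differential operator on $R$. Here the hypersurfaces $R/pR$ are of this form over $K=\mathbb{Z}/p\mathbb{Z}$ with the standard grading.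 *)

(* Defs.v *)
From HB Require Import structures.
From mathcomp Require Import fingroup perm.
From mathcomp Require Import all_boot all_order all_algebra.
From mathcomp Require Import boolp.
From mathcomp Require Import mpoly.

Set Implicit Arguments.
Unset Strict Implicit.
Unset Printing Implicit Defensive.

Import Order.TTheory GRing.Theory.
Local Open Scope ring_scope.
Local Open Scope quotient_scope.

Section GenIdeal.
Variable S : comNzRingType.
Variable gs : seq S.

Definition in_gen_ideal (x : S) : Prop :=
  exists cs : seq S, x = \sum_(i < size gs) cs`_i * gs`_i.

Definition gen_ideal : {pred S} := fun x => `[< in_gen_ideal x >].

Lemma gen_ideal0 : 0 \in gen_ideal.
Proof.
apply/asboolP; exists [::]; rewrite big1 // => i _.
by rewrite nth_nil mul0r.
Qed.

Lemma gen_idealB : {in gen_ideal &, forall u v, u - v \in gen_ideal}.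
Proof.
move=> u v /asboolP [cu ->] /asboolP [cv ->]; apply/asboolP.
exists [seq cu`_i - cv`_i | i <- iota 0 (size gs)].
rewrite -sumrB; apply: eq_bigr => i _.
by rewrite (nth_map 0%N) ?size_iota // nth_iota // add0n mulrBl.
Qed.

Lemma gen_idealMl a u : u \in gen_ideal -> a * u \in gen_ideal.
Proof.
move=> /asboolP [cu ->]; apply/asboolP.
exists [seq a * cu`_i | i <- iota 0 (size gs)].
rewrite mulr_sumr; apply: eq_bigr => i _.
by rewrite (nth_map 0%N) ?size_iota // nth_iota // add0n mulrA.
Qed.

HB.instance Definition _ := GRing.isZmodClosed.Build S gen_ideal
  (conj gen_ideal0 gen_idealB).

Definition qequiv (x y : S) := (x - y) \in gen_ideal.

Lemma qequiv_is_equiv : equiv_class_of qequiv.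
Proof.
rewrite /qequiv; split=> [x|x y|y x z]; rewrite ?subrr ?rpred0 //.
  by rewrite -opprB rpredN.
by move=> *; rewrite -[x](addrNK y) -addrA rpredD.
Qed.

Canonical qequiv_equiv := EquivRelPack qequiv_is_equiv.
Canonical qequiv_encModRel := defaultEncModRel qequiv.

Definition rquot := {eq_quot qequiv}.

HB.instance Definition _ : EqQuotient S qequiv rquot := EqQuotient.on rquot.
HB.instance Definition _ := Choice.on rquot.

Lemma qBE x y : (x - y) \in gen_ideal = (x == y %[mod rquot]).
Proof. by rewrite piE. Qed.

Lemma qDE x y : (x + y) \in gen_ideal = (x == - y %[mod rquot]).
Proof. by rewrite -qBE opprK. Qed.

Definition qzero : rquot := lift_cst rquot 0.
Definition qadd := lift_op2 rquot +%R.
Definition qopp := lift_op1 rquot -%R.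
Definition qone : rquot := lift_cst rquot 1.
Definition qmul := lift_op2 rquot *%R.

Canonical pi_qzero_morph := PiConst qzero.
Canonical pi_qone_morph := PiConst qone.

Lemma pi_qopp : {morph \pi : x / - x >-> qopp x}.
Proof.
move=> x; unlock qopp; apply/eqP; rewrite piE /qequiv.
by rewrite -opprD rpredN qDE opprK reprK.
Qed.
Canonical pi_qopp_morph := PiMorph1 pi_qopp.

Lemma pi_qadd : {morph \pi : x y / x + y >-> qadd x y}.
Proof.
move=> x y /=; unlock qadd; apply/eqP; rewrite piE /qequiv.
rewrite opprD addrAC addrA -addrA.
by rewrite rpredD // (qBE, qDE) ?pi_qopp ?reprK.
Qed.
Canonical pi_qadd_morph := PiMorph2 pi_qadd.

Lemma pi_qmul : {morph \pi : x y / x * y >-> qmul x y}.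
Proof.
move=> x y; unlock qmul; apply/eqP; rewrite piE /qequiv.
rewrite -[_ * _](addrNK (x * repr (\pi_rquot y))) -mulrBr.
rewrite -addrA -mulrBl rpredD //.
  by rewrite gen_idealMl // qDE opprK reprK.
by rewrite mulrC gen_idealMl // qDE opprK reprK.
Qed.
Canonical pi_qmul_morph := PiMorph2 pi_qmul.

Lemma qaddA : associative qadd.
Proof. by move=> x y z; rewrite -[x]reprK -[y]reprK -[z]reprK !piE addrA. Qed.
Lemma qaddC : commutative qadd.
Proof. by move=> x y; rewrite -[x]reprK -[y]reprK !piE addrC. Qed.
Lemma qadd0 : left_id qzero qadd.
Proof. by move=> x; rewrite -[x]reprK !piE add0r. Qed.
Lemma qaddN : left_inverse qzero qopp qadd.
Proof. by move=> x; rewrite -[x]reprK !piE addNr. Qed.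

HB.instance Definition _ := GRing.isZmodule.Build rquot qaddA qaddC qadd0 qaddN.

Lemma qmulA : associative qmul.
Proof. by move=> x y z; rewrite -[x]reprK -[y]reprK -[z]reprK !piE mulrA. Qed.
Lemma qmulC : commutative qmul.
Proof. by move=> x y; rewrite -[x]reprK -[y]reprK !piE mulrC. Qed.
Lemma qmul1 : left_id qone qmul.
Proof. by move=> x; rewrite -[x]reprK !piE mul1r. Qed.
Lemma qmulDl : left_distributive qmul qadd.
Proof.
by move=> x y z; rewrite -[x]reprK -[y]reprK -[z]reprK !piE mulrDl.
Qed.

HB.instance Definition _ := GRing.Zmodule_isComPzRing.Build rquot
  qmulA qmulC qmul1 qmulDl.

Definition qproj (x : S) : rquot := \pi_rquot x.

End GenIdeal.

Arguments qproj {S} gs x.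

Fixpoint diffop_le (R : comPzRingType) (n : nat) (d : R -> R) : Prop :=
  match n with
  | 0%N => exists r : R, forall x, d x = r * x
  | n'.+1 => (forall x y, d (x + y) = d x + d y) /\
             forall r : R, diffop_le n' (fun x => r * d x - d (r * x))
  end.

Definition diffop (R : comPzRingType) (d : R -> R) : Prop :=
  exists n, diffop_le n d.

(* For ideals J' \subset J of S (given by generators gsJ' and gsJ), a map d
   on S/J is induced by a differential operator on S/J': there is a
   differential operator dt on S/J' with dt(r) = d(r) modulo J.          *)
Definition lifts_to (S : comNzRingType) (gsJ' gsJ : seq S)
    (d : rquot gsJ -> rquot gsJ) : Prop :=
  exists dt : rquot gsJ' -> rquot gsJ',
    diffop dt /\
    forall r : S, qproj gsJ (repr (dt (qproj gsJ' r))) = d (qproj gsJ r).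

(* The divided-power partial derivative d_{a,...,a} on Z[x_0..x_{k-1}] *)
Definition dpart (k a : nat) (s : {mpoly int[k]}) : {mpoly int[k]} :=
  \sum_(m <- msupp s)
     (s@_m * (\prod_(i < k) 'C(m i, a))%:R) *: 'X_[(m - [multinom a | i < k])%MM].

(* Frobenius trace of Z[x]/(f, p) = (R/pR for R = Z[x]/(f)),
   induced by s |-> Phi_S (f^(p-1) s),  Phi_S = d_{p-1,...,p-1}.       *)
Definition frob_trace (k : nat) (f : {mpoly int[k]}) (p : nat)
    (x : rquot [:: f; p%:R]) : rquot [:: f; p%:R] :=
  qproj [:: f; p%:R] (dpart p.-1 (f ^+ p.-1 * repr x)).

Definition generic_varmx (n : nat) : 'M[{mpoly int[#|{: 'I_n * 'I_n}|]}]_n :=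
  \matrix_(i, j) 'X_(enum_rank (i, j)).

Definition altidx (n : nat) := {pr : 'I_n * 'I_n | (pr.1 < pr.2)%N}.

Definition alternating_varmx (n : nat) : 'M[{mpoly int[#|{: altidx n}|]}]_n :=
  \matrix_(i, j)
    if @insub _ (fun pr : 'I_n * 'I_n => (pr.1 < pr.2)%N) (altidx n) (i, j)
      is Some t then 'X_(enum_rank t)
    else if @insub _ (fun pr : 'I_n * 'I_n => (pr.1 < pr.2)%N) (altidx n) (j, i)
      is Some t then - 'X_(enum_rank t)
    else 0.

Definition symidx (n : nat) := {pr : 'I_n * 'I_n | (pr.1 <= pr.2)%N}.

Definition symmetric_varmx (n : nat) : 'M[{mpoly int[#|{: symidx n}|]}]_n :=
  \matrix_(i, j)
    if @insub _ (fun pr : 'I_n * 'I_n => (pr.1 <= pr.2)%N) (symidx n) (i, j)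
      is Some t then 'X_(enum_rank t)
    else if @insub _ (fun pr : 'I_n * 'I_n => (pr.1 <= pr.2)%N) (symidx n) (j, i)
      is Some t then 'X_(enum_rank t)
    else 0.

(* Pfaffian of an n x n matrix (n even): sum over permutations s of
   {0..n-1} with s(2i) < s(2i+1) and s(0) < s(2) < ... < s(n-2) of
   sgn(s) * prod_i A_{s(2i), s(2i+1)}.  Indices are handled as naturals. *)
Definition permn (n : nat) (s : 'S_n) (k : nat) : nat :=
  if (insub k : option 'I_n) is Some k' then val (s k') else k.

Definition entn (R : nzRingType) (n : nat) (A : 'M[R]_n) (i j : nat) : R :=
  if (insub i : option 'I_n) is Some i' then
    if (insub j : option 'I_n) is Some j' then A i' j' else 0
  else 0.

Definition pf_perm (n : nat) (s : 'S_n) : bool :=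
  [forall i : 'I_(n./2), (permn s i.*2 < permn s i.*2.+1)%N] &&
  [forall i : 'I_(n./2), (i.+1 < n./2)%N ==> (permn s i.*2 < permn s i.*2.+2)%N].

Definition pfaffian (R : comNzRingType) (n : nat) (A : 'M[R]_n) : R :=
  \sum_(s : 'S_n | pf_perm s)
     (-1) ^+ s * \prod_(i < n./2) entn A (permn s i.*2) (permn s i.*2.+1).

Arguments generic_varmx n : clear implicits.
Arguments alternating_varmx n : clear implicits.
Arguments symmetric_varmx n : clear implicits.
Arguments lifts_to {S} gsJ' gsJ d.
Arguments frob_trace {k} f p x.

(* Main.v *)
(* An operator of order n commutes modulo p with p^n-th powers. Let I2 = (f, p^2), let
   Phi be the Frobenius trace, and suppose that sum_j (t_j w_j)^p + p Delta lies in I2.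
   Multiply this relation by c and by a monomial M in the p-th powers of the t_j that
   completes the (t_j w_j)^p to high powers of the t_j, apply a lift of Phi and divide
   by p: up to high powers of the t_j this gives M Phi(c) Delta = M Phi(c Delta) modulo
   (f, p). One can choose c with Phi(c) = 1. For a grading in which Delta has positive
   degree, Phi(c Delta) is a sum of p-th powers of positive degree, and these are killed
   by M. So M Delta lies in the ideal of f, p and high powers of the t_j, which is
   refuted by a coefficient computation in a monomial quotient. For the determinant the
   relation is the expansion of the 3 x 3 Schur complement of a complementary block, for
   the Pfaffian it is the expansion of f itself, and for symmetric matrices and p = 2
   it is the square of f, up to the term 2 bce.

   For symmetric 3 x 3 matrices and p > 2, put x_ij = u_i v_j + u_j v_i. This embeds R
   into E = Z[u, v], and up to powers of 2 the image is the ring of invariants of O_2.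
   An operator delta on R/pR is linear over q-th powers, q = p^n. It extends to a map on
   the degree-0 part of E/pE which is linear over q-th powers of degree-0 elements,
   hence is a combination of divided derivatives of order q - 1 and lifts to E. Averaging
   over O_2 returns to R at the cost of a bounded power of 2, which is harmless because
   2^(p-1) = 1 modulo p. *)
Require Import Defs.
From HB Require Import structures.
From mathcomp Require Import fingroup perm.
From mathcomp Require Import all_boot all_order all_algebra.
From mathcomp Require Import mpoly ssrcomplements.
From mathcomp Require Import boolp ring zify.
Set Implicit Arguments.
Unset Strict Implicit.
Unset Printing Implicit Defensive.
Import GRing.Theory Order.TTheory Num.Theory.
Local Open Scope ring_scope.

(** * Quotients and differential operators modulo N *)

(** Of an operator only three properties are kept: additivity, vanishing on the ideal, and
    commutation with all Q-th powers for one large Q. This treats lifts to R and to R/p^2R by one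
    argument, and in part (c) it turns an operator on R/pR into a Q-linear map. The values of a lift
    of Phi are known only modulo p, so every term carries an unknown multiple of p. For the p-th
    powers, completion to Q-th powers moves the unknown part into the ideal of the t_j^Q; for p
    Delta it is multiplied by p a second time. In part (c) the degree-0 part of E/pE is not a
    polynomial ring and has no evident basis over its q-th powers. E/pE has one, the monomials with
    exponents below q, but these have various degrees. The value at such a monomial is found from
    its degree-0 multiples by t^q, for two coprime elements t. A second obstacle is that the power
    of 2 lost in averaging depends on the argument; an operator of finite order admits a uniform
    bound, because the variables are finite in number. *)

Section QuotientRing.
Variables (S : comNzRingType) (gs : seq S).

Lemma qproj_eq x y : (qproj gs x = qproj gs y) <-> (x - y \in gen_ideal gs).
Proof.
by rewrite /qproj; split=> [/eqP|h]; [rewrite -qBE | apply/eqP; rewrite -qBE].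
Qed.

Lemma repr_qproj x : repr (qproj gs x) - x \in gen_ideal gs.
Proof. by apply/qproj_eq; rewrite /qproj reprK. Qed.

Lemma qproj_repr x : qproj gs (repr x) = x.
Proof. exact: reprK. Qed.

Fact qproj_is_zmod_morphism : zmod_morphism (qproj gs).
Proof. by move=> x y; rewrite /qproj !piE. Qed.

Fact qproj_is_monoid_morphism : monoid_morphism (qproj gs).
Proof. by split; [rewrite /qproj piE | move=> x y; rewrite /qproj piE]. Qed.

HB.instance Definition _ :=
  GRing.isZmodMorphism.Build S (rquot gs) (qproj gs) qproj_is_zmod_morphism.
HB.instance Definition _ :=
  GRing.isMonoidMorphism.Build S (rquot gs) (qproj gs) qproj_is_monoid_morphism.

Lemma qproj_surj x : exists s, x = qproj gs s.
Proof. by exists (repr x); rewrite qproj_repr. Qed.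

Lemma qprojD x y : qproj gs (x + y) = qproj gs x + qproj gs y.
Proof. exact: rmorphD. Qed.

Lemma qprojM x y : qproj gs (x * y) = qproj gs x * qproj gs y.
Proof. exact: rmorphM. Qed.

Lemma qprojXn x n : qproj gs (x ^+ n) = qproj gs x ^+ n.
Proof. exact: rmorphXn. Qed.

Lemma qproj_nat n : qproj gs n%:R = n%:R.
Proof. exact: rmorph_nat. Qed.

Lemma qproj_eq0 x : (qproj gs x = 0) <-> (x \in gen_ideal gs).
Proof. by rewrite -(rmorph0 (qproj gs)) qproj_eq subr0. Qed.

Lemma gen_idealMr a u : u \in gen_ideal gs -> u * a \in gen_ideal gs.
Proof. by rewrite mulrC; apply: gen_idealMl. Qed.

Lemma gen_ideal_sub gs' x :
  x \in gen_ideal gs' -> {subset gs' <= gen_ideal gs} -> x \in gen_ideal gs.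
Proof.
move=> /asboolP [c ->] h; apply: rpred_sum => i _.
by apply/gen_idealMl/h/mem_nth.
Qed.

Lemma mem_gen g : g \in gs -> g \in gen_ideal gs.
Proof.
move=> gP; apply/asboolP; exists (mkseq (fun i => (i == index g gs)%:R) (size gs)).
have i_lt : (index g gs < size gs)%N by rewrite index_mem.
rewrite (bigD1 (Ordinal i_lt)) //= nth_mkseq // eqxx mul1r nth_index //.
rewrite big1 ?addr0 // => i; rewrite -val_eqE /= => /negPf i_ne.
by rewrite nth_mkseq // i_ne mul0r.
Qed.

End QuotientRing.

(** The projection is expressed by [repr] because [lifts_to] compares values in that way. *)
Lemma rquot_map (S : comNzRingType) (gs gs' : seq S) :
  {subset gs <= gen_ideal gs'} ->
  exists c : rquot gs -> rquot gs', [/\ forall x, c x = qproj gs' (repr x),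
    forall s, c (qproj gs s) = qproj gs' s, {morph c : x y / x + y} &
    {morph c : x y / x * y}].
Proof.
move=> gs_sub; pose c (x : rquot gs) : rquot gs' := qproj gs' (repr x).
have cE s : c (qproj gs s) = qproj gs' s.
  by apply/qproj_eq/(gen_ideal_sub (repr_qproj _ _)).
exists c; split=> [x|s|x y|x y]; first reflexivity.
- exact: cE.
- have [[s ->] [t ->]] := (qproj_surj x, qproj_surj y).
  by rewrite -qprojD !cE qprojD.
have [[s ->] [t ->]] := (qproj_surj x, qproj_surj y).
by rewrite -qprojM !cE qprojM.
Qed.

Lemma mem_gen_ideal2 (S : comNzRingType) (f g x : S) :
  x \in gen_ideal [:: f; g] <-> exists u v, x = f * u + g * v.
Proof.
split=> [/asboolP [c ->]|[u [v ->]]].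
  exists c`_0, c`_1; rewrite !big_ord_recl big_ord0 /= addr0.
  by rewrite mulrC (mulrC g).
by rewrite rpredD // gen_idealMr // mem_gen // !inE eqxx ?orbT.
Qed.

(* Modulo N an operator of order n commutes with N^n-th powers: by induction
   [y, d] commutes with y = x^(N^(n-1)), hence [y^N, d] = N y^(N-1) [y, d]. *)
Lemma diffop_le_pow (A : comPzRingType) (N n : nat) (d : A -> A) :
  diffop_le n d -> forall x s, exists y,
    d (x ^+ (N ^ n) * s) = x ^+ (N ^ n) * d s + N%:R * y.
Proof.
elim: n d => [|n IHn] d /=.
  move=> [r dE] x s; exists 0; rewrite !dE expn0 expr1; ring.
move=> [dD dC] x s; pose y := x ^+ (N ^ n).
pose e s := y * d s - d (y * s).
have eC m t : exists z, e (y ^+ m * t) = y ^+ m * e t + N%:R * z.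
  elim: m => [|m [z IHm]]; first by exists 0; rewrite !expr0 !mul1r mulr0 addr0.
  have [z' h] : exists z', e (y * (y ^+ m * t)) = y * e (y ^+ m * t) + N%:R * z'.
    exact: IHn (dC y) x _.
  exists (y * z + z'); rewrite exprS -!mulrA h IHm; ring.
(* Moving one more y across d costs one e, and e commutes with y modulo N. For m = N the middle term
   is a multiple of N. *)
have dyC m t : exists z,
    d (y ^+ m * t) = y ^+ m * d t - m%:R * (y ^+ m.-1 * e t) + N%:R * z.
  elim: m => [|m [z IHm]]; first by exists 0; rewrite !expr0 !mul1r; ring.
  have [z' ez'] := eC m t; exists (y * z - z').
  have -> : d (y ^+ m.+1 * t) = y * d (y ^+ m * t) - e (y ^+ m * t).
    by rewrite /e exprS -mulrA; ring.
  rewrite IHm ez'; case: m {IHm ez'} => [|m] /=; first by rewrite expr1 expr0; ring.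
  by rewrite !exprS -(natr1 m.+1) ; ring.
have [z] := dyC N s; rewrite -exprM -expnSr => ->.
exists (z - y ^+ N.-1 * e s); ring.
Qed.

Lemma diffop_le_add (A : comPzRingType) n (d : A -> A) :
  diffop_le n d -> {morph d : x y / x + y}.
Proof. by case: n => [[r dE] x y|n [dD _]] //; rewrite !dE mulrDr. Qed.

Lemma morphD_natM (A : pzRingType) (B : pzRingType) (d : A -> B) n x :
  {morph d : x y / x + y} -> d (n%:R * x) = n%:R * d x.
Proof.
move=> dD; rewrite !mulr_natl; have d0 : d 0 = 0.
  by apply: (addrI (d 0)); rewrite -dD !addr0.
by elim: n => [|n IHn]; rewrite ?mulr0n ?d0 // !mulrS dD IHn.
Qed.

(** Values are read modulo (f, N), where the error terms of [diffop_le_pow] vanish. It is used with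
    N = p^2 for operators on R and on R/p^2R alike, and with N = p for operators on R/pR in part
    (c). *)
Lemma diffop_descent (S : comNzRingType) (gs : seq S) (f : S) (N n : nat)
    (dt : rquot gs -> rquot gs) :
  diffop_le n dt -> f \in gs -> {subset gs <= gen_ideal [:: f; N%:R]} ->
  exists (d : S -> rquot [:: f; N%:R]) (n : nat),
  [/\ forall s, d s = qproj _ (repr (dt (qproj gs s))), {morph d : x y / x + y},
      forall x, qproj [:: f; N%:R] x = 0 -> d x = 0 &
      forall x s, d (x ^+ (N ^ n) * s) = qproj _ x ^+ (N ^ n) * d s].
Proof.
move=> dtP f_gs gs_sub; have dtD := diffop_le_add dtP.
have [c [cr cE cD cM]] := rquot_map gs_sub.
have p2 : N%:R = 0 :> rquot [:: f; N%:R].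
  by rewrite -qproj_nat; apply/qproj_eq0/mem_gen; rewrite !inE eqxx orbT.
exists (fun s => c (dt (qproj gs s))), n; split.
- by move=> s; apply: cr.
- by move=> x y /=; rewrite qprojD dtD cD.
- move=> x /qproj_eq0/mem_gen_ideal2 [u [v ->]]; rewrite qprojD !qprojM.
  have -> : qproj gs f = 0 by apply/qproj_eq0/mem_gen.
  rewrite mul0r add0r qproj_nat (morphD_natM _ _ dtD).
  by rewrite (morphD_natM _ _ cD) p2 mul0r.
move=> x s; rewrite qprojM qprojXn.
have [y ->] := diffop_le_pow N dtP (qproj gs x) (qproj gs s).
rewrite cD (morphD_natM _ _ cD) p2 mul0r addr0 cM; congr (_ * _).
by rewrite -(qprojXn gs) cE qprojXn.
Qed.

Section LinearExtension.
Variables (n : nat) (R : comNzRingType) (V : lmodType R).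
Implicit Types (g : 'X_{1..n} -> V) (s : {mpoly R[n]}).

(** Linear maps prescribed on monomials: [dq], [hproj] and [pdiff] are defined in this way. *)
Definition mlin g s : V := \sum_(m <- msupp s) s@_m *: g m.

Lemma mlinwE g s k : (msize s <= k)%N ->
  mlin g s = \sum_(m : 'X_{1..n < k}) s@_m *: g m.
Proof.
move=> le_sk; rewrite /mlin (big_mksub ('X_{1..n < k} : subFinType _)) /=;
  last first.
- by move=> x /msize_mdeg_lt/leq_trans/(_ le_sk).
- by rewrite msupp_uniq.
by rewrite big_rmcond //= => j /memN_msupp_eq0 ->; rewrite scale0r.
Qed.

Fact mlin_is_linear g : linear (mlin g).
Proof.
move=> c s t; set k := maxn (msize s) (msize t).
have le_s : (msize s <= k)%N by rewrite leq_maxl.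
have le_t : (msize t <= k)%N by rewrite leq_maxr.
have le_st : (msize (c *: s + t) <= k)%N.
  apply: leq_trans (msizeD_le _ _) _; rewrite geq_max le_t andbT.
  exact: leq_trans (msizeZ_le _ _) le_s.
rewrite (mlinwE _ le_s) (mlinwE _ le_t) (mlinwE _ le_st) scaler_sumr -big_split.
by apply: eq_bigr => m _ /=; rewrite mcoeffD mcoeffZ scalerDl scalerA.
Qed.
HB.instance Definition _ g :=
  GRing.isLinear.Build R {mpoly R[n]} V *:%R (mlin g) (mlin_is_linear g).

Lemma mlinX g m : mlin g 'X_[m] = g m.
Proof. by rewrite /mlin msuppX big_seq1 mcoeffX eqxx scale1r. Qed.

Lemma mlinE (L : {linear {mpoly R[n]} -> V}) s : L s = mlin (fun m => L 'X_[m]) s.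
Proof.
rewrite {1}[s]mpolyE linear_sum; apply: eq_bigr => m _.
by rewrite linearZ.
Qed.

Lemma eq_mlin (L L' : {linear {mpoly R[n]} -> V}) :
  (forall m, L 'X_[m] = L' 'X_[m]) -> L =1 L'.
Proof.
by move=> h s; rewrite (mlinE L) (mlinE L'); apply: eq_bigr => m _; rewrite h.
Qed.
End LinearExtension.

(** * Reduction modulo p *)

Section ModP.
Variables (p : nat) (K : fieldType) (k : nat).
Hypothesis pK : p \in [pchar K].
Let p_pr : prime p := pcharf_prime pK.
Implicit Types (s : {mpoly int[k]}).

Definition red (s : {mpoly int[k]}) : {mpoly K[k]} := map_mpoly intr s.
HB.instance Definition _ := GRing.RMorphism.copy red (map_mpoly intr).

Lemma redX m : red 'X_[m] = 'X_[m].
Proof. exact: map_mpolyX. Qed.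

Lemma redD s t : red (s + t) = red s + red t.
Proof. exact: rmorphD. Qed.

Lemma redM s t : red (s * t) = red s * red t.
Proof. exact: rmorphM. Qed.

Lemma redXn s n : red (s ^+ n) = red s ^+ n.
Proof. exact: rmorphXn. Qed.

Lemma redZ c s : red (c *: s) = c%:~R *: red s.
Proof. exact: map_mpolyZ. Qed.

Lemma mcoeff_red s m : (red s)@_m = (s@_m)%:~R.
Proof. exact: mcoeff_map_mpoly. Qed.

Lemma intr_pchar_eq0 (c : int) : (c%:~R == 0 :> K) = (p %| c)%Z.
Proof.
rewrite dvdzE /=; case: c => c /=.
  by rewrite -pmulrn -(dvdn_pcharf pK).
by rewrite NegzE mulrNz oppr_eq0 -pmulrn -(dvdn_pcharf pK).
Qed.

Lemma red_p : red p%:R = 0.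
Proof. by rewrite rmorph_nat -mpolyC_nat (pcharf0 pK) mpolyC0. Qed.

Lemma red_eq0 s : red s = 0 <-> exists t, s = p%:R * t.
Proof.
split=> [s0|[t ->]]; last by rewrite rmorphM /= red_p mul0r.
exists (\sum_(m <- msupp s) (s@_m %/ p)%Z *: 'X_[m]).
rewrite mulr_sumr [LHS]mpolyE; apply: eq_bigr => m _.
rewrite -scalerAr mulr_natl -scaler_nat scalerA; congr (_ *: _).
have /eqP : (red s)@_m = 0 by rewrite s0 mcoeff0.
by rewrite mcoeff_red intr_pchar_eq0 natz => /divzK ->.
Qed.

Lemma red_eq s t : red s = red t <-> exists u, s = t + p%:R * u.
Proof.
split=> [/eqP|[u ->]]; last by rewrite rmorphD /= rmorphM /= red_p mul0r addr0.
rewrite -subr_eq0 -rmorphB => /eqP/red_eq0 [u e]; exists u.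
by rewrite -e addrC subrK.
Qed.

Section PrimePower.
Variable e : nat.
Let q := (p ^ e)%N.

Lemma q_gt0 : (0 < q)%N. Proof. by rewrite expn_gt0 prime_gt0. Qed.

Lemma exprDq (A : comNzRingType) (x y : A) : p \in [pchar A] ->
  (x + y) ^+ q = x ^+ q + y ^+ q.
Proof.
by move=> pA; rewrite exprDn_pchar // pnatX (pnatE _ p_pr) pA.
Qed.

(** Compare the coefficients of X^a in (1 + X)^(b + q) = (1 + X)^b (1 + X^q). *)
Lemma bin_addq b a : (a < q)%N -> 'C(b + q, a)%:R = 'C(b, a)%:R :> K.
Proof.
have coefE n i : ((1 + 'X) ^+ n : {poly K})`_i = 'C(n, i)%:R.
  rewrite exprDn coef_sum; have [le_in|lt_ni] := leqP i n; last first.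
    rewrite bin_small // big1 // => j _; rewrite expr1n mul1r coefMn coefXn.
    by rewrite gtn_eqF ?mul0rn // (leq_ltn_trans _ lt_ni) // -ltnS.
  rewrite (bigD1 (Ordinal (le_in : (i < n.+1)%N))) //= expr1n mul1r coefMn coefXn.
  rewrite eqxx big1 ?addr0 // => j; rewrite -val_eqE /= => /negPf ne.
  by rewrite expr1n mul1r coefMn coefXn eq_sym ne mul0rn.
move=> lt_aq; rewrite -!coefE exprD exprDq ?expr1n; last first.
  by rewrite pchar_poly.
by rewrite mulrDr mulr1 coefD coefMXn lt_aq addr0.
Qed.

Lemma bin_predq m : 'C(m, q.-1)%:R = ((m %% q)%N == q.-1)%:R :> K.
Proof.
have q1 : (q.-1 < q)%N by rewrite prednK ?q_gt0.
rewrite {1}(divn_eq m q); elim: (m %/ q)%N => [|j IHj].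
  rewrite mul0n add0n; have := ltn_pmod m q_gt0.
  rewrite -{2}(prednK q_gt0) ltnS leq_eqVlt => /orP[/eqP ->|lt_m].
    by rewrite binn eqxx.
  by rewrite bin_small // ltn_eqF.
by rewrite mulSn -addnA addnC bin_addq.
Qed.

(* The reduction modulo p of d_{q-1,...,q-1}: by Lucas' theorem 'C(m, q-1) is
   1 modulo p if m = -1 mod q and 0 otherwise. *)
Definition dq : {mpoly K[k]} -> {mpoly K[k]} :=
  mlin (fun m => [forall i : 'I_k, (m i %% q)%N == q.-1]%:R *:
                 'X_[(m - [multinom q.-1 | i < k])%MM]).
HB.instance Definition _ := GRing.Linear.on dq.

Lemma dqX m : dq 'X_[m] = [forall i : 'I_k, (m i %% q)%N == q.-1]%:R *:
                 'X_[(m - [multinom q.-1 | i < k])%MM].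
Proof. exact: mlinX. Qed.

Lemma dqD x y : dq (x + y) = dq x + dq y.
Proof. exact: linearD. Qed.

Lemma dqZ c x : dq (c *: x) = c *: dq x.
Proof. exact: linearZ. Qed.

Lemma dpart_mlin a s : dpart a s =
  mlin (fun m => (\prod_(i < k) 'C(m i, a))%:R *:
                 'X_[(m - [multinom a | i < k])%MM]) s.
Proof. by apply: eq_bigr => m _; rewrite scalerA. Qed.

Lemma dpartD a s t : dpart a (s + t) = dpart a s + dpart a t.
Proof. by rewrite !dpart_mlin linearD. Qed.

Lemma red_dpart s : red (dpart q.-1 s) = dq (red s).
Proof.
elim/mpolyind: s => [|c m s _ _ IHs].
  by rewrite dpart_mlin linear0 rmorph0 linear0.
rewrite dpartD !rmorphD /= linearD IHs; congr (_ + _).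
rewrite dpart_mlin linearZ !redZ linearZ; congr (_ *: _) => /=.
rewrite mlinX redX dqX redZ redX; congr (_ *: _).
rewrite rmorph_nat natr_prod.
case: (boolP [forall i : 'I_k, (m i %% q)%N == q.-1]) => [/forallP mP|].
  by rewrite big1 // => i _; rewrite bin_predq mP.
rewrite negb_forall => /existsP[i /negPf mi].
by rewrite (bigD1 i) //= bin_predq mi mul0r.
Qed.

Lemma dqMXq m (s : {mpoly K[k]}) :
  dq ('X_[m *+ q] * s) = 'X_[m *+ q] * dq s.
Proof.
elim/mpolyind: s => [|c m' s _ _ IHs]; first by rewrite mulr0 linear0 mulr0.
rewrite mulrDr !linearD /= mulrDr IHs; congr (_ + _).
rewrite -scalerAr !linearZ /= -scalerAr; congr (_ *: _).
rewrite -mpolyXD !dqX -scalerAr -mpolyXD.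
have -> : [forall i : 'I_k, ((m *+ q + m')%MM i %% q)%N == q.-1] =
          [forall i : 'I_k, (m' i %% q)%N == q.-1].
  by apply: eq_forallb => i; rewrite mnmDE mulmnE modnMDl.
case: (boolP [forall i : 'I_k, (m' i %% q)%N == q.-1]) => [/forallP mP|]; last by rewrite
  !scale0r.
(* Where the coefficient is nonzero, each exponent of m' is at least q - 1, so the truncated
   subtraction is exact. *)
congr (_ *: 'X_[_]); apply/mnmP => i; rewrite !(mnmBE, mnmDE) mnmE addnBA //.
by rewrite -(eqP (mP i)) leq_mod.
Qed.

Lemma dqMq (g' s : {mpoly K[k]}) : dq (g' ^+ q * s) = g' ^+ q * dq s.
Proof.
elim/mpolyind: g' => [|c m g' _ _ IHg].
  by rewrite expr0n -leqn0 leqNgt q_gt0 !mul0r linear0.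
rewrite exprDq; last first.
  by rewrite inE p_pr -mpolyC_nat (pcharf0 pK) mpolyC0 eqxx.
have h : dq ((c *: 'X_[m]) ^+ q * s) = (c *: 'X_[m]) ^+ q * dq s.
  by rewrite exprZn -!scalerAl mpolyXn dqZ dqMXq.
apply: etrans (congr1 dq (mulrDl _ _ _)) _.
apply: etrans (dqD _ _) _.
apply: etrans (congr2 +%R h IHg) _.
exact/esym/mulrDl.
Qed.

End PrimePower.
End ModP.

Lemma natr_mpoly_neq0 k n : (0 < n)%N -> n%:R != 0 :> {mpoly int[k]}.
Proof.
move=> n_gt0; rewrite -mpolyC_nat mpolyC_eq0 natz.
by case: n n_gt0.
Qed.

Section FrobeniusTrace.
Variables (k p : nat) (K : fieldType) (f : {mpoly int[k]}).
Hypotheses (pK : p \in [pchar K]) (f_neq0 : red K f != 0).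
Let p_pr : prime p := pcharf_prime pK.
Local Notation S := {mpoly int[k]}.
Local Notation I1 := [:: f; p%:R].
Local Notation I2 := [:: f; (p ^ 2)%N%:R].

Definition ftr (s : S) : S := dpart p.-1 (f ^+ p.-1 * s).

(** In p x = f u + p^2 v the product f u is divisible by p, hence so is u, since f is nonzero modulo
    p. This justifies the division by p in the obstruction. *)
Lemma p_torsion (x : S) : p%:R * x \in gen_ideal I2 -> x \in gen_ideal I1.
Proof.
move=> /mem_gen_ideal2 [u [v e]].
have /eqP : red K f * red K u = 0.
  rewrite -redM; apply/(red_eq0 pK); exists (x - p%:R * v).
  by rewrite mulrBr e natrX; ring.
rewrite mulf_eq0 (negPf f_neq0) orFb => /eqP/(red_eq0 pK) [u' eu].
apply/mem_gen_ideal2; exists u', v.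
apply: (mulfI (natr_mpoly_neq0 k (prime_gt0 p_pr))).
by rewrite e eu natrX; ring.
Qed.

Lemma red_ftr s : red K (ftr s) = dq p 1 (red K f ^+ p.-1 * red K s).
Proof.
have := red_dpart pK 1 (f ^+ p.-1 * s).
by rewrite expn1 redM redXn.
Qed.

Lemma ftrMp g s : exists u, ftr (g ^+ p * s) = g ^+ p * ftr s + p%:R * u.
Proof.
apply/(red_eq pK); rewrite red_ftr !redM red_ftr redXn mulrCA.
by have := dqMq pK 1 (red K g) (red K f ^+ p.-1 * red K s); rewrite expn1.
Qed.

(** The factor f^(p-1) f is a p-th power, which passes through Phi_S modulo p; so Phi descends to
    R/pR. *)
Lemma ftr_ideal s u v :
  exists a b, ftr (s + f * u + p%:R * v) = ftr s + f * a + p%:R * b.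
Proof.
have [b eb] : exists b, ftr (s + f * u + p%:R * v) =
    ftr s + f * (f ^+ p.-1 * dpart p.-1 u) + p%:R * b.
  apply/(red_eq pK).
  rewrite red_ftr !redD red_ftr !redM (red_p _ pK) mul0r addr0.
  rewrite mulrDr dqD; congr (_ + _); rewrite mulrA -exprSr mulrA redXn -exprS.
  rewrite prednK ?prime_gt0 //.
  have := dqMq pK 1 (red K f) (red K u).
  have := red_dpart pK 1 u.
  by rewrite expn1 => ->.
by exists (f ^+ p.-1 * dpart p.-1 u), b.
Qed.

(** The lift agrees with the trace modulo (f, p). The multiple of f dies in the quotient by [I2];
    the unknown multiple of p survives and is recorded as u. *)
Lemma frob_trace_lift (gs : seq S) : f \in gs -> {subset gs <= gen_ideal I2} ->
  lifts_to gs I1 (frob_trace f p) ->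
  exists (d : S -> rquot I2) (n : nat),
  [/\ {morph d : x y / x + y}, forall x, qproj I2 x = 0 -> d x = 0,
      forall x s, d (x ^+ ((p ^ 2) ^ n) * s) = qproj I2 x ^+ ((p ^ 2) ^ n) * d s &
      forall s, exists u, d s = qproj I2 (ftr s + p%:R * u)].
Proof.
move=> f_gs gs_sub [dt [[n dtP] dtE]].
have [d [n' [dE dD d0 dM]]] := diffop_descent dtP f_gs gs_sub.
exists d, n'; split=> // s.
have /qproj_eq/mem_gen_ideal2 [u [v e]] := dtE s.
have /mem_gen_ideal2 [u' [v' e']] := repr_qproj I1 s.
have er : repr (qproj I1 s) = s + f * u' + p%:R * v' by rewrite -addrA -e' addrC subrK.
have [a [b h]] := ftr_ideal s u' v'.
exists (v + b); rewrite dE; apply/qproj_eq/mem_gen_ideal2; exists (u + a), 0.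
move: h; rewrite /ftr -er => h.
by move/eqP: e; rewrite subr_eq => /eqP ->; rewrite h; ring.
Qed.
End FrobeniusTrace.

(** * The obstruction to lifting *)

(* Apply d to c M (sum_j (t_j w_j)^p + p Delta) = 0 with M = prod_i t_i^(Q-p):
   the p-th powers complete to Q-th powers t_j^Q, which d respects, so all the
   unknown correction terms end up in the ideal of the t_j^Q. *)
Lemma pth_power_relation (S : comNzRingType) (f : S) (p q : nat)
    (d : S -> rquot [:: f; (p ^ 2)%N%:R]) (F : S -> S)
    (I J : finType) (t : I -> S) (l : J -> I) (w : J -> S) (c D : S) :
  let pr := qproj [:: f; (p ^ 2)%N%:R] in
  {morph d : x y / x + y} -> (forall x, pr x = 0 -> d x = 0) ->
  (forall x s, d (x ^+ (p * q.+1) * s) = pr x ^+ (p * q.+1) * d s) ->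
  (forall s, exists u, d s = pr (F s + p%:R * u)) ->
  (forall g s, exists u, F (g ^+ p * s) = g ^+ p * F s + p%:R * u) ->
  \sum_j (t (l j) * w j) ^+ p + p%:R * D \in gen_ideal [:: f; (p ^ 2)%N%:R] ->
  exists g : J -> S,
    p%:R * ((\prod_i t i ^+ q) ^+ p * (F c * D - F (c * D))
            - \sum_j t (l j) ^+ (p * q.+1) * g j)
      \in gen_ideal [:: f; (p ^ 2)%N%:R].
Proof.
move=> pr dD d0 dM dF FM rel.
(* Completion of the p-th powers: M^p (t w)^p = t^(p (q+1)) (N w)^p, and d commutes with p (q+1)-th
   powers. *)
pose M := \prod_i t i ^+ q; pose N j := \prod_(i | i != l j) t i ^+ q.
have ME j : M = t (l j) ^+ q * N j by rewrite /M (bigD1 (l j)).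
have dFM g s : exists u, d (g ^+ p * s) = pr (g ^+ p * F s + p%:R * u).
  have [[u ->] [v eF]] := (dF (g ^+ p * s), FM g s).
  by exists (v + u); rewrite eF; congr pr; ring.
have [u du] := fin_all_exists (fun j => dFM (N j * w j) c).
have [v dv] := dFM M (c * D).
have d00 : d 0 = 0 by rewrite d0 // /pr rmorph0.
(* This is d applied to c M^p times the relation. In the last summand the outer factor p turns the
   unknown p v into p^2 v. *)
have rel' : pr (\sum_j t (l j) ^+ (p * q.+1) * ((N j * w j) ^+ p * F c + p%:R * u j)
    + p%:R * (M ^+ p * F (c * D) + p%:R * v)) = 0.
  rewrite /pr qprojD rmorph_sum /=.
  under eq_bigr => j _ do rewrite qprojM qprojXn -/pr -du -dM.
  rewrite qprojM qproj_nat -/pr -dv -(morphD_natM _ _ dD).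
  rewrite -(big_morph d dD d00) -dD; apply: d0; apply/qproj_eq0.
  have := gen_idealMl (c * M ^+ p) rel.
  suff -> : c * M ^+ p * (\sum_j (t (l j) * w j) ^+ p + p%:R * D) =
    \sum_j t (l j) ^+ (p * q.+1) * ((N j * w j) ^+ p * c) + p%:R * (M ^+ p * (c * D)).
    by [].
  rewrite mulrDr mulr_sumr; congr (_ + _); last by ring.
  apply: eq_bigr => j _; rewrite (ME j) !exprMn [(p * _)%N]mulnS exprD -exprM.
  rewrite [(q * p)%N]mulnC; ring.
exists u.
(* Subtracting from M^p F(c) times the given relation removes the p-th powers and leaves, up to p^2,
   a multiple of p. *)
have e : p%:R * (M ^+ p * (F c * D - F (c * D)) -
       \sum_j t (l j) ^+ (p * q.+1) * u j) =
  M ^+ p * F c * (\sum_j (t (l j) * w j) ^+ p + p%:R * D) -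
  (\sum_j t (l j) ^+ (p * q.+1) * ((N j * w j) ^+ p * F c + p%:R * u j)
    + p%:R * (M ^+ p * F (c * D) + p%:R * v)) + (p ^ 2)%N%:R * v.
  have -> : \sum_j t (l j) ^+ (p * q.+1) * ((N j * w j) ^+ p * F c + p%:R * u j) =
     M ^+ p * F c * \sum_j (t (l j) * w j) ^+ p
      + p%:R * \sum_j t (l j) ^+ (p * q.+1) * u j.
    rewrite !mulr_sumr -big_split; apply: eq_bigr => j _ /=.
    rewrite (ME j) !exprMn [(p * _)%N]mulnS exprD -exprM.
    rewrite [(q * p)%N]mulnC; ring.
  by rewrite natrX; ring.
rewrite e rpredD //; last by rewrite gen_idealMr // mem_gen // !inE eqxx orbT.
by rewrite rpredB ?gen_idealMl //; apply/qproj_eq0.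
Qed.

Section Obstruction.
Variables (k p : nat) (K : fieldType) (f : {mpoly int[k]}).
Hypotheses (pK : p \in [pchar K]) (f_neq0 : red K f != 0).
Local Notation S := {mpoly int[k]}.
Local Notation I1 := [:: f; p%:R].
Local Notation I2 := [:: f; (p ^ 2)%N%:R].

Lemma obstruction (gs : seq S) (I J : finType) (t : I -> S) (l : J -> I)
    (w : J -> S) (c D : S) :
  f \in gs -> {subset gs <= gen_ideal I2} -> lifts_to gs I1 (frob_trace f p) ->
  \sum_j (t (l j) * w j) ^+ p + p%:R * D \in gen_ideal I2 ->
  exists q (g : J -> S) (u v : S),
    (\prod_i t i ^+ q) ^+ p * (ftr p f c * D - ftr p f (c * D)) =
    f * u + p%:R * v + \sum_j t (l j) ^+ (p * q.+1) * g j.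
Proof.
have p_pr := pcharf_prime pK.
move=> f_gs gs_sub lift rel.
have [d [n [dD d0 dM dF]]] := frob_trace_lift pK f_gs gs_sub lift.
(* The exponent p (q + 1) = p^2 (p^2)^n is a multiple of (p^2)^n, as commutation with d requires. *)
pose q := (p * (p ^ 2) ^ n).-1.
have qE : (p * q.+1 = p ^ 2 * (p ^ 2) ^ n)%N.
  by rewrite prednK ?muln_gt0 ?expn_gt0 ?prime_gt0 // mulnA.
have dM' x s : d (x ^+ (p * q.+1) * s) = qproj I2 x ^+ (p * q.+1) * d s.
  by rewrite qE (exprM x) dM qprojXn -exprM.
have [g gP] := pth_power_relation c dD d0 dM' dF (ftrMp f pK) rel.
have /mem_gen_ideal2 [u [v e]] := p_torsion pK f_neq0 gP.
exists q, g, u, v; rewrite -e; ring.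
Qed.
End Obstruction.

(** * Weights and monomial quotients *)

Section Weights.
Variables (k : nat) (R : comNzRingType) (w : 'I_k -> int).
Implicit Types (s t : {mpoly R[k]}) (d : int).

Definition wt (m : 'X_{1..k}) : int := \sum_i (m i)%:Z * w i.

Lemma wtD m1 m2 : wt (m1 + m2)%MM = wt m1 + wt m2.
Proof.
rewrite /wt -big_split; apply: eq_bigr => i _ /=.
by rewrite mnmDE PoszD mulrDl.
Qed.

Definition whomog d s := forall m, m \in msupp s -> wt m = d.

Lemma whomog0 d : whomog d 0.
Proof. by move=> m; rewrite msupp0. Qed.

Lemma whomogX m : whomog (wt m) 'X_[m].
Proof. by move=> m'; rewrite msuppX inE => /eqP ->. Qed.

Lemma whomogXU i : whomog (w i) 'X_i.
Proof.
move=> m; rewrite msuppX inE => /eqP ->.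
rewrite /wt (bigD1 i) //= mnm1E eqxx mul1r big1 ?addr0 // => j /negPf ne.
by rewrite mnm1E eq_sym ne mul0r.
Qed.

Lemma whomogC c : whomog 0 c%:MP.
Proof.
move=> m; rewrite msuppC; case: eqP => // _; rewrite inE => /eqP ->.
by rewrite /wt big1 // => i _; rewrite mnm0E mul0r.
Qed.

Lemma whomogD d s t : whomog d s -> whomog d t -> whomog d (s + t).
Proof.
move=> hs ht m /msuppD_le; rewrite mem_cat.
by case/orP; [apply: hs | apply: ht].
Qed.

Lemma whomogN d s : whomog d s -> whomog d (- s).
Proof. by move=> hs m; rewrite (perm_mem (msuppN _)); apply: hs. Qed.

Lemma whomogM d e s t : whomog d s -> whomog e t -> whomog (d + e) (s * t).
Proof.
move=> hs ht m /msuppM_le /allpairsP [[m1 m2] [h1 h2 ->]].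
by rewrite wtD (hs _ h1) (ht _ h2).
Qed.

Lemma whomog1 : whomog 0 1.
Proof. by rewrite -mpolyC1; apply: whomogC. Qed.

Lemma whomogXn d s n : whomog d s -> whomog (d *+ n) (s ^+ n).
Proof.
move=> hs; elim: n => [|n IHn]; first by rewrite expr0 mulr0n; apply: whomog1.
by rewrite exprS mulrS; apply: whomogM.
Qed.

Lemma whomog_nat n : whomog 0 n%:R.
Proof. by rewrite -mpolyC_nat; apply: whomogC. Qed.

Lemma whomog_sum (I : Type) (r : seq I) (P : pred I) (F : I -> {mpoly R[k]}) d :
  (forall i, P i -> whomog d (F i)) -> whomog d (\sum_(i <- r | P i) F i).
Proof.
by move=> hF; elim/big_ind: _ => //; [apply: whomog0 | move=> x y; apply: whomogD].
Qed.

Lemma whomog_prod (I : Type) (r : seq I) (P : pred I) (F : I -> {mpoly R[k]})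
    (d : I -> int) :
  (forall i, P i -> whomog (d i) (F i)) ->
  whomog (\sum_(i <- r | P i) d i) (\prod_(i <- r | P i) F i).
Proof.
move=> hF; elim/big_rec2: _ => [|i y1 y2 Pi hy]; first exact: whomog1.
by apply: whomogM => //; apply: hF.
Qed.

(** Each term takes every row and every column once, so weights of the form a_i + b_j have the same
    total in all terms. *)
Lemma whomog_det n (A : 'M[{mpoly R[k]}]_n) (a b : 'I_n -> int) :
  (forall i j, whomog (a i + b j) (A i j)) ->
  whomog (\sum_i a i + \sum_j b j) (\det A).
Proof.
move=> hA; rewrite /determinant; apply: whomog_sum => s _.
rewrite -[_ + _]add0r; apply: whomogM.
  by case: (odd_perm s); rewrite ?expr1 ?expr0; [apply/whomogN/whomog1 | apply: whomog1].
rewrite [X in _ + X](reindex_inj (@perm_inj _ s)) -big_split.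
by apply: whomog_prod => i _; apply: hA.
Qed.

Lemma whomog_adj0 n (A : 'M[{mpoly R[k]}]_n) :
  (forall i j, whomog 0 (A i j)) -> forall i j, whomog 0 (\adj A i j).
Proof.
move=> hA i j; rewrite mxE /cofactor -[0]add0r; apply: whomogM.
  elim: (j + i)%N => [|m IHm]; first by rewrite expr0; apply: whomog1.
  rewrite exprS -[0]add0r; apply: whomogM => //; apply/whomogN/whomog1.
have := @whomog_det _ (row' j (col' i A)) (fun=> 0) (fun=> 0).
by rewrite !big1 // addr0; apply=> i' j'; rewrite !mxE ?addr0.
Qed.
End Weights.

Section FrobeniusTraceMonomials.
Variables (k p : nat).
Hypothesis p_pr : prime p.
Local Notation S := {mpoly int[k]}.

(** Modulo p only monomials with all exponents -1 modulo p survive, and they become p-th powers of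
    monomials. Lowering every exponent by p - 1 lowers the weight by (p-1) times the sum of w, which
    fixes the weight of these p-th powers. The conclusion has the form of an induction principle, so
    that P can be [killed by a given element]. *)
Lemma dpart_pth_powers (w : 'I_k -> int) (D : int) (s : S) (P : S -> Prop) :
  whomog w (D + (\sum_i w i) *+ p.-1) s ->
  P 0 -> (forall x y, P x -> P y -> P (x + y)) -> (forall x, P (p%:R * x)) ->
  (forall c m, wt w m *+ p = D -> P (c *: 'X_[m *+ p])) -> P (dpart p.-1 s).
Proof.
move=> hs P0 PD Pp PX; rewrite /dpart big_seq; elim/big_ind: _ => // m /hs wm.
have pK : p \in [pchar 'F_p] by rewrite pchar_Fp.
case: (boolP [forall i : 'I_k, (m i %% p)%N == p.-1]) => [/forallP mP|].
  have mE : m = ([multinom (m i %/ p)%N | i < k] *+ p + [multinom p.-1 | i < k])%MM.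
    apply/mnmP => i; rewrite mnmDE mulmnE !mnmE.
    by rewrite {1}(divn_eq (m i) p) (eqP (mP i)).
  rewrite {3}mE addmK; apply: PX; move: wm; rewrite {1}mE wtD.
  have -> : wt w [multinom p.-1 | i < k] = (\sum_i w i) *+ p.-1.
    by rewrite /wt -sumrMnl; apply: eq_bigr => i _; rewrite mnmE -mulr_natl natz.
  move=> /addIr <-; rewrite /wt -sumrMnl; apply: eq_bigr => i _.
  by rewrite mulmnE PoszM -mulr_natr natz mulrAC.
rewrite negb_forall => /existsP[i mi].
have : (p %| 'C(m i, p.-1))%N.
  have := bin_predq pK 1 (m i); rewrite expn1 (negPf mi) => /eqP.
  by rewrite (dvdn_pcharf pK).
case/dvdnP => b eb; rewrite (bigD1 i) //= eb mulnAC natrM mulrA mulrC.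
by rewrite -scalerA scaler_nat -[_ *+ p]mulr_natl; apply: (Pp (_ *: _)).
Qed.

Section UnitTrace.
Variables (A : {set 'I_k}) (f : S).
Hypothesis f_homog : whomog (fun=> 1) #|A|%:Z f.
Let eta (s : S) : S := mmap (@mpolyC _ _) (fun i => if i \in A then 'X_i else 0) s.
Hypothesis f_diag :
  mmap (@mpolyC k int) (fun i => if i \in A then 'X_i else 0) f = \prod_(i in A) 'X_i.

Definition mnmset (B : {set 'I_k}) (n : nat) : 'X_{1..k} :=
  [multinom (if i \in B then n else 0)%N | i < k].

Lemma mpolyX_mnmset B n : 'X_[mnmset B n] = \prod_(i in B) 'X_i ^+ n :> S.
Proof.
rewrite mpolyXE_id [RHS]big_mkcond /=; apply: eq_bigr => i _.
by rewrite mnmE; case: ifP.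
Qed.

Lemma mcoeff_eta (s : S) (m : 'X_{1..k}) : (forall i, i \notin A -> m i = 0%N) -> (eta s)@_m =
  s@_m.
Proof.
move=> mA; rewrite /eta; elim/mpolyind: s => [|c m' s _ _ IHs].
  by rewrite raddf0.
rewrite raddfD /= !mcoeffD IHs; congr (_ + _).
rewrite mmapZ mmapX mcoeffCM mcoeffZ mcoeffX; congr (_ * _).
have [m'A|] := boolP [forall i : 'I_k, (i \notin A) ==> (m' i == 0%N)].
  rewrite /mmap1 -mcoeffX mpolyXE_id; congr (_@_m); apply: eq_bigr => i _.
  case: ifP => // /negbT iA; move/forallP/(_ i): m'A.
  by rewrite iA => /eqP ->; rewrite !expr0.
rewrite negb_forall => /existsP[i]; rewrite negb_imply => /andP[iA m'i].
rewrite /mmap1 (bigD1 i) //= (negPf iA) expr0n (negPf m'i) mul0r mcoeff0.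
by case: eqP => // e; rewrite -e in mA; rewrite mA ?eqxx in m'i.
Qed.

(** Setting the variables outside A to 0 does not affect coefficients of monomials in the variables
    of A, and it turns f into a single monomial. *)
Lemma mcoeff_powA n : (f ^+ n)@_(mnmset A n) = 1.
Proof.
rewrite -mcoeff_eta; last by move=> i /negPf iA; rewrite mnmE iA.
have -> : eta (f ^+ n) = 'X_[mnmset A n].
  by rewrite /eta rmorphXn /= f_diag mpolyX_mnmset prodrXl.
by rewrite mcoeffX eqxx.
Qed.

Lemma red_neq0 (K : fieldType) : red K f != 0.
Proof.
apply/eqP => e; have := mcoeff_powA 1; rewrite expr1 => h.
by have := mcoeff_red K f (mnmset A 1); rewrite e mcoeff0 h => /esym/eqP; rewrite oner_eq0.
Qed.

(** In f^(p-1) c the monomial with all exponents p - 1 has coefficient 1. By homogeneity of degree k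
    (p-1), any other monomial has an exponent below p - 1 and is killed by a zero binomial
    coefficient. So the equality holds over the integers and not only modulo p. *)
Lemma ftr_unit : ftr p f 'X_[mnmset (~: A) p.-1] = 1.
Proof.
set c := 'X_[_]; have cE : (f ^+ p.-1 * c)@_[multinom p.-1 | i < k] = 1.
  rewrite -(mcoeff_powA p.-1).
  rewrite -(mcoeffMX (f ^+ p.-1) (mnmset (~: A) p.-1) (mnmset A p.-1)).
  congr (_@_ _); apply/mnmP => i; rewrite mnmDE !mnmE inE.
  by case: (i \in A); rewrite ?addn0.
have hs : whomog (fun=> 1) (k * p.-1)%:Z (f ^+ p.-1 * c).
  have := whomogM (whomogXn (n := p.-1) f_homog) (@whomogX _ int (fun=> 1) (mnmset (~: A) p.-1)).
  suff -> : #|A|%:Z *+ p.-1 + wt (fun=> 1) (mnmset (~: A) p.-1) = (k * p.-1)%:Z by [].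
  rewrite /wt (eq_bigr (fun i => if i \in ~: A then p.-1%:Z else 0)); last first.
    by move=> i _; rewrite mulr1 mnmE; case: ifP.
  rewrite -big_mkcond sumr_const -[_ *+ p.-1]mulr_natr -[_ *+ #|_|]mulr_natr !natz.
  by rewrite -!PoszM -PoszD [(#|A| * _)%N]mulnC -mulnDr cardsC card_ord mulnC.
rewrite /ftr /dpart (bigD1_seq [multinom p.-1 | i < k]) ?msupp_uniq //=; last first.
  by rewrite mcoeff_msupp cE.
rewrite cE big1; last by move=> i _; rewrite mnmE binn.
rewrite mulr1 scale1r.
have -> : ([multinom p.-1 | i < k] - [multinom p.-1 | i < k])%MM = 0%MM :> 'X_{1..k}.
  by apply/mnmP => i; rewrite mnmBE subnn mnm0E.
rewrite mpolyX0 big_seq_cond big1 ?addr0 // => m /andP[/hs wm m_ne].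
have [mP|] := boolP [forall i : 'I_k, (p.-1 <= m i)%N]; last first.
  rewrite negb_forall => /existsP[i]; rewrite -ltnNge => lt_mi.
  by rewrite (bigD1 i) //= bin_small // mul0n mulr0 scale0r.
case/eqP: m_ne; apply/mnmP => i; rewrite mnmE; apply/eqP.
have /eqP : (\sum_i (m i - p.-1) = 0)%N.
  rewrite sumnB; last by move=> j _; apply: (forallP mP).
  rewrite sum_nat_const card_ord; apply/eqP; rewrite subn_eq0.
  have : (\sum_i m i)%N%:Z = (k * p.-1)%:Z.
    by rewrite -wm /wt (big_morph Posz PoszD (erefl 0%:Z)); apply: eq_bigr => j _; rewrite mulr1.
  by case=> ->.
by rewrite sum_nat_eq0 => /forallP/(_ i) /=; rewrite subn_eq0 eqn_leq (forallP mP i) andbT.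
Qed.
End UnitTrace.
End FrobeniusTraceMonomials.

Section ObstructionMonomial.
Variables (k p : nat) (A : {set 'I_k}) (f : {mpoly int[k]}).
Hypotheses (p_pr : prime p) (f_homog : whomog (fun=> 1) #|A|%:Z f).
Hypothesis f_diag :
  mmap (@mpolyC k int) (fun i => if i \in A then 'X_i else 0) f = \prod_(i in A) 'X_i.
Local Notation S := {mpoly int[k]}.
Local Notation I1 := [:: f; p%:R].
Local Notation I2 := [:: f; (p ^ 2)%N%:R].

(** Here e stands for Phi(c Delta), known only through the weight of the p-th powers that compose it
    modulo p. This weight is that of Delta: by the choice of c, f^(p-1) c has the weight of the
    product of all variables to the power p - 1, which Phi_S removes. *)
Lemma no_lift_by_weight (w : 'I_k -> int) (df dD : int) (I J : finType)
    (t : I -> S) (l : J -> I) (v : J -> S) (D : S) :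
  whomog w df f -> whomog w dD D ->
  \sum_j (t (l j) * v j) ^+ p + p%:R * D \in gen_ideal I2 ->
  ~ (exists q (g : J -> S) (a b e : S),
    [/\ (\prod_i t i ^+ q) ^+ p * (D - e) =
           f * a + p%:R * b + \sum_j t (l j) ^+ (p * q.+1) * g j &
        forall P : S -> Prop, P 0 -> (forall x y, P x -> P y -> P (x + y)) ->
          (forall x, P (p%:R * x)) ->
          (forall c m, wt w m *+ p = dD -> P (c *: 'X_[m *+ p])) -> P e]) ->
  ~ lifts_to I2 I1 (frob_trace f p) /\ ~ lifts_to [:: f] I1 (frob_trace f p).
Proof.
move=> wf wD rel no.
have pK : p \in [pchar 'F_p] by rewrite pchar_Fp.
suff H gs : f \in gs -> {subset gs <= gen_ideal I2} -> ~ lifts_to gs I1 (frob_trace f p).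
  split; apply: H; rewrite ?inE ?eqxx // => x.
    by apply: mem_gen.
  by rewrite inE => /eqP ->; rewrite mem_gen // inE eqxx.
move=> f_gs gs_sub lift; apply: no.
pose c : S := 'X_[mnmset (~: A) p.-1].
have [q [g [u [b e]]]] :=
  obstruction pK (red_neq0 f_diag 'F_p) c f_gs gs_sub lift rel.
exists q, g, u, b, (ftr p f (c * D)); split.
  by rewrite -e (ftr_unit p f_homog f_diag) mul1r.
move=> P P0 PD Pp PX; apply: (dpart_pth_powers p_pr (w := w) (D := dD)) => //.
(* The product of the variables in A occurs in f with coefficient 1, hence has the weight of f. *)
have wA : wt w (mnmset A 1) = df.
  apply: wf; rewrite mcoeff_msupp; have := mcoeff_powA f_diag 1.
  by rewrite expr1 => ->; rewrite oner_eq0.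
have e1 : df *+ p.-1 + (wt w (mnmset (~: A) p.-1) + dD) = dD + (\sum_i w i) *+ p.-1.
  have <- : wt w (mnmset (~: A) p.-1) + df *+ p.-1 = (\sum_i w i) *+ p.-1.
    rewrite -wA /wt -!sumrMnl -big_split; apply: eq_bigr => i _ /=.
    rewrite !mnmE !inE; case: (i \in A) => /=.
      by rewrite mul1r mul0r add0r.
    by rewrite mul0r mul0rn addr0 -[RHS]mulr_natl natz.
  by rewrite addrA addrC; congr (_ + _); rewrite addrC.
rewrite -e1; apply: whomogM; first exact: whomogXn.
by apply: whomogM => //; apply: whomogX.
Qed.
End ObstructionMonomial.

Section MonomialQuotient.
Variables (k p : nat) (m : 'X_{1..k}).
Hypothesis p_pr : prime p.
Local Notation S := {mpoly int[k]}.

(** X^m is the highest monomial that survives modulo these generators. The quotient is the test ring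
    in which membership in the ideals is refuted. *)
Definition mono_gens : seq S :=
  p%:R :: [seq 'X_i ^+ (m i).+1 | i <- enum 'I_k].

Lemma mono_quot_p : p%:R = 0 :> rquot mono_gens.
Proof. by rewrite -qproj_nat; apply/qproj_eq0/mem_gen; rewrite inE eqxx. Qed.

Lemma mono_quot_X i : qproj mono_gens 'X_i ^+ (m i).+1 = 0.
Proof.
rewrite -qprojXn; apply/qproj_eq0/mem_gen; rewrite inE; apply/orP; right.
by apply/mapP; exists i; rewrite ?mem_enum.
Qed.

(** At X^m every multiple of a generator has a coefficient divisible by p. *)
Lemma mono_quot_neq0 : qproj mono_gens 'X_[m] <> 0.
Proof.
have h g c : g \in mono_gens -> (c * g)@_m \in dvdz p.
  rewrite inE => /orP[/eqP ->|/mapP [j _ ->]].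
    by rewrite mulr_natr mcoeffMn -mulr_natr natz; apply: dvdz_mull.
  rewrite mpolyXn; have [/eqP ->|] := boolP ((c * 'X_[U_(j) *+ (m j).+1])@_m == 0).
    exact: dvdz0.
  rewrite -mcoeff_msupp (perm_mem (msuppMX _ _)) => /mapP [m' _] /mnmP /(_ j).
  by rewrite mnmDE mulmnE mnm1E eqxx mul1n => e; move: (ltnn (m j)); rewrite {2}e leq_addr.
move=> /qproj_eq0/asboolP [c e].
have : (p %| ('X_[m] : S)@_m)%Z.
  rewrite e raddf_sum; apply: rpred_sum => i _; apply: h; exact: mem_nth.
by rewrite mcoeffX eqxx dvdz1; case: (p) p_pr => [|[|]].
Qed.

Lemma mono_top_neq0 : \prod_i qproj mono_gens 'X_i ^+ m i <> 0.
Proof.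
move=> e; apply: mono_quot_neq0; rewrite -[RHS]e mpolyXE_id rmorph_prod.
by apply: eq_bigr => i _; apply: rmorphXn.
Qed.
End MonomialQuotient.

(** The integral polynomial ((x + y)^p - x^p - y^p) / p, up to sign the correction term in the
    addition of Witt vectors of length two. *)
Definition frobW (p : nat) (R : pzRingType) (x y : R) : R :=
  \sum_(i < p.-1) ('C(p, i.+1) %/ p)%:R * (x ^+ i.+1 * y ^+ (p - i.+1)).

Section FrobeniusDefect.
Variable p : nat.
Hypothesis p_pr : prime p.

Lemma frobWE (R : comPzRingType) (x y : R) :
  (x + y) ^+ p = x ^+ p + y ^+ p + p%:R * frobW p x y.
Proof.
case: p p_pr => // n n_pr.
rewrite addrC exprDn big_ord_recl big_ord_recr /= subn0 subnn bin0 binn !expr0.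
rewrite !mulr1n mulr1 mul1r [bump 0 n]/bump leq0n add1n.
rewrite addrA addrAC [y ^+ _ + _]addrC; congr (_ + _).
rewrite mulr_sumr; apply: eq_bigr => i _; rewrite /bump leq0n add1n.
have : (n.+1 %| 'C(n.+1, i.+1))%N by apply: prime_dvd_bin; rewrite //= ltnS ltn_ord.
move/divnK => {1}<-; rewrite -mulr_natl natrM; ring.
Qed.

Lemma frobW_scale (R : comPzRingType) (z x y : R) :
  frobW p (z * x) (z * y) = z ^+ p * frobW p x y.
Proof.
rewrite mulr_sumr; apply: eq_bigr => i _; have lt_i : (i.+1 <= p)%N.
  by rewrite (leq_trans (ltn_ord i)) // leq_pred.
have -> : z ^+ p = z ^+ i.+1 * z ^+ (p - i.+1) by rewrite -exprD subnKC.
by rewrite !exprMn; ring.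
Qed.

Lemma frobW_mul (R : comPzRingType) (x y : R) :
  exists z, frobW p x y = x * y * z.
Proof.
exists (\sum_(i < p.-1) ('C(p, i.+1) %/ p)%:R * (x ^+ i * y ^+ (p - i.+1).-1)).
rewrite mulr_sumr; apply: eq_bigr => i _.
have : (0 < p - i.+1)%N by have := ltn_ord i; lia.
by case: (p - i.+1)%N => // j _; rewrite !exprS; ring.
Qed.

(** Where o kills x + y, y acts as -x, and [frobW] is homogeneous of degree p. *)
Lemma frobW_opp (R : comPzRingType) (o x y : R) :
  o * y = - (o * x) -> o * frobW p x y = o * x ^+ p * frobW p 1 (-1).
Proof.
move=> oxy; rewrite -mulrA -frobW_scale mulr1 mulrN1.
rewrite !mulr_sumr; apply: eq_bigr => i _.
have h n : o * y ^+ n = o * (- x) ^+ n.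
  elim: n => [|n IHn]; first by rewrite !expr0.
  rewrite !exprS mulrA oxy; transitivity (- x * (o * y ^+ n)); first by ring.
  by rewrite IHn; ring.
have e (a b c : R) : o * (a * (b * c)) = a * b * (o * c) by ring.
by rewrite !e h.
Qed.

(** The coefficient C(p, p-1) / p is 1. This linear term in y is the source of the surviving
    monomials below. *)
Lemma frobW_lin (R : comPzRingType) (x y : R) :
  exists z, frobW p x y = x ^+ p.-1 * y + y ^+ 2 * z.
Proof.
case: p p_pr => [|[|n]] // n_pr; rewrite /frobW /= big_ord_recr /=.
rewrite subSS subSn // subnn binSn divnn /= mul1r expr1.
exists (\sum_(i < n) ('C(n.+2, i.+1) %/ n.+2)%:R * (x ^+ i.+1 * y ^+ (n - i.+1))).
rewrite addrC mulr_sumr; congr (_ + _); apply: eq_bigr => i _ /=.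
have -> : (n.+2 - i.+1 = (n - i.+1).+2)%N by have := ltn_ord i; lia.
by rewrite !exprS; ring.
Qed.

Lemma frobWC (R : comPzRingType) (x y : R) : frobW p x y = frobW p y x.
Proof.
rewrite /frobW (reindex_inj rev_ord_inj); apply: eq_bigr => i _ /=.
have lt_i := ltn_ord i.
have -> : (p.-1 - i.+1).+1 = (p - i.+1)%N by lia.
rewrite bin_sub; last by lia.
have -> : (p - (p - i.+1))%N = i.+1 by lia.
ring.
Qed.

Lemma frobW0 (R : comPzRingType) (x : R) : frobW p x 0 = 0.
Proof. by have [z ->] := frobW_mul x 0; rewrite mulr0 mul0r. Qed.

Lemma rmorph_frobW (R R' : comPzRingType) (h : {rmorphism R -> R'}) (x y : R) :
  h (frobW p x y) = frobW p (h x) (h y).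
Proof.
rewrite rmorph_sum; apply: eq_bigr => i _.
by rewrite !rmorphM !rmorphXn rmorph_nat.
Qed.

Lemma exprDp (R : comPzRingType) (x y : R) :
  p%:R = 0 :> R -> (x + y) ^+ p = x ^+ p + y ^+ p.
Proof. by move=> p0; rewrite frobWE p0 mul0r addr0. Qed.

End FrobeniusDefect.

(** * Surviving top monomials in quotients by powers of variables *)

Lemma mulr_absorb (B : comPzRingType) (y x z : B) n :
  y * x = 0 -> y * (z + x) ^+ n = y * z ^+ n.
Proof.
move=> yx; elim: n => [|n IHn]; first by rewrite !expr0.
rewrite !exprS; transitivity (z * (y * (z + x) ^+ n) + y * x * (z + x) ^+ n).
  by ring.
by rewrite IHn yx; ring.
Qed.

Lemma mulr_exp_nil (B : comPzRingType) (s x y : B) n :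
  s ^+ n.+1 = 0 -> s * x * (s * y) ^+ n = 0.
Proof. by move=> s0; rewrite exprMn mulrACA -exprS s0 mul0r. Qed.

Lemma mulr_frobW_nil (B : comPzRingType) p (s x y z : B) :
  s ^+ p.+1 = 0 -> s * x * frobW p (s * y) (s * z) = 0.
Proof. by move=> s0; rewrite frobW_scale mulrACA -exprS s0 mul0r. Qed.

(* Omega = al f0^(p-1) - de^p kills f0 because f0^p is the sum of the p-th
   powers modulo p; this only works in characteristic p, which is what makes
   the functional "coefficient of the top monomial in Omega x" detect Delta. *)
Lemma block_top_monomial (B : comPzRingType) (p q : nat)
    (s1 s2 u1 u2 a b c d h : B)
    (al := - (s1 * u1 * a)) (be := s1 * u2 * b)
    (ga := s2 * u1 * c) (de := - (s2 * u2 * d)) :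
  prime p -> p%:R = 0 :> B ->
  s1 ^+ p.+1 = 0 -> s2 ^+ p.+1 = 0 -> u1 ^+ p.+1 = 0 -> u2 ^+ p.+1 = 0 ->
  a ^+ (p * q.+1) = 0 -> d ^+ (p * q.+1) = 0 ->
  (a * b * c * d) ^+ (p * q) *
    (frobW p al be + frobW p ga de + frobW p (al + be) (ga + de)) =
    (al + be + (ga + de)) * h ->
  (s1 * s2 * u1 * u2) ^+ p * (a * b * c * d) ^+ (p * q.+1).-1 = 0.
Proof.
move=> p_pr p0 s1p s2p u1p u2p ap dp rel.
have [alS alU] : al = s1 * (- (u1 * a)) /\ al = u1 * (- (s1 * a)) by rewrite /al; split; ring.
have [beS beU] : be = s1 * (u2 * b) /\ be = u2 * (s1 * b) by rewrite /be; split; ring.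
have [gaS gaU] : ga = s2 * (u1 * c) /\ ga = u1 * (s2 * c) by rewrite /ga; split; ring.
have [deS deU] : de = s2 * (- (u2 * d)) /\ de = u2 * (- (s2 * d)) by rewrite /de; split; ring.
(* Two terms that share one of s1, s2, u1, u2 produce its power p + 1, which is 0. *)
have alal : al * al ^+ p = 0 by rewrite alS mulr_exp_nil.
have albe : al * be ^+ p = 0 by rewrite alS beS mulr_exp_nil.
have alga : al * ga ^+ p = 0 by rewrite alU gaU mulr_exp_nil.
have bede : be * de ^+ p = 0 by rewrite beU deU mulr_exp_nil.
have gade : ga * de ^+ p = 0 by rewrite gaS deS mulr_exp_nil.
have dede : de * de ^+ p = 0 by rewrite deS mulr_exp_nil.
have alW : al * frobW p al be = 0 by rewrite alS beS mulr_frobW_nil.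
pose P := al + be; pose Q := ga + de; pose f0 := P + Q.
pose Om := al * f0 ^+ p.-1 - de ^+ p.
(* In Z the exponents of a and d are p q + p - 2, two below the vanishing exponent; only one further
   factor of each can survive. *)
pose Z := (a * b * c * d) ^+ (p * q) * (a * d) ^+ (p - 2).
have Om0 : Om * f0 = 0.
  rewrite mulrBl -mulrA -exprSr prednK ?prime_gt0 // /f0 /P /Q !exprDp //.
  transitivity (al * al ^+ p + al * be ^+ p + al * ga ^+ p -
                be * de ^+ p - ga * de ^+ p - de * de ^+ p); first by ring.
  by rewrite alal albe alga bede gade dede; ring.
have key : Z * Om * (frobW p al be + frobW p ga de + frobW p P Q) = 0.
  transitivity ((a * d) ^+ (p - 2) * Om * (f0 * h)); last by rewrite mulrA -[_ * Om * f0]mulrA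
    Om0; ring.
  by rewrite -rel /Z; ring.
have pq : (p * q.+1 = p * q + p)%N by rewrite mulnS addnC.
have Za n : (2 <= n)%N -> Z * a ^+ n = 0.
  move=> n2; rewrite /Z -(subnKC n2) exprD !exprMn.
  have : a ^+ (p * q) * a ^+ (p - 2) * a ^+ 2 = 0.
    by rewrite -!exprD -addnA subnK ?prime_gt1 // -pq.
  move=> e; transitivity (a ^+ (p * q) * a ^+ (p - 2) * a ^+ 2 *
    (b ^+ (p * q) * c ^+ (p * q) * d ^+ (p * q) * d ^+ (p - 2) * a ^+ (n - 2))).
    by ring.
  by rewrite e mul0r.
have Zd : Z * d ^+ 2 = 0.
  rewrite /Z !exprMn.
  have : d ^+ (p * q) * d ^+ (p - 2) * d ^+ 2 = 0.
    by rewrite -!exprD -addnA subnK ?prime_gt1 // -pq.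
  move=> e; transitivity (d ^+ (p * q) * d ^+ (p - 2) * d ^+ 2 *
    (b ^+ (p * q) * c ^+ (p * q) * a ^+ (p * q) * a ^+ (p - 2))).
    by ring.
  by rewrite e mul0r.
have t1 : Om * frobW p al be = 0.
  rewrite mulrBl mulrAC alW mul0r sub0r.
  have [z ->] := frobW_mul p_pr al be.
  transitivity (- (be * de ^+ p * (al * z))); first by ring.
  by rewrite bede mul0r oppr0.
(* Since Om kills P + Q, [frobW_opp] reduces the claim to the vanishing of Z Om P^p. *)
have t3 : Z * Om * frobW p P Q = 0.
  have oPQ : Z * Om * Q = - (Z * Om * P).
    by apply/eqP; rewrite -addr_eq0 -mulrDr addrC -mulrA Om0 mulr0.
  rewrite frobW_opp //.
  suff -> : Z * Om * P ^+ p = 0 by rewrite mul0r.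
  rewrite exprDp // mulrDr.
  have -> : Z * Om * al ^+ p = 0.
    transitivity (Z * (al * al ^+ p) * f0 ^+ p.-1 - Z * de ^+ p * al ^+ p).
      by rewrite /Om; ring.
    have alp : al ^+ p = a ^+ p * ((-1) ^+ p * (s1 ^+ p * u1 ^+ p)).
      by rewrite /al [LHS]exprNn !exprMn; ring.
    rewrite alal mulr0 mul0r sub0r alp.
    transitivity (- (Z * a ^+ p * (de ^+ p * ((-1) ^+ p * (s1 ^+ p * u1 ^+ p))))).
      by ring.
    by rewrite Za ?prime_gt1 // mul0r oppr0.
  rewrite add0r.
  transitivity (Z * (al * be ^+ p) * f0 ^+ p.-1 - Z * de ^+ p * be ^+ p).
    by rewrite /Om; ring.
  rewrite albe mulr0 mul0r sub0r.
  rewrite -{2}(prednK (prime_gt0 p_pr)) exprS.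
  transitivity (- (Z * (be * de ^+ p) * be ^+ p.-1)); first by ring.
  by rewrite bede mulr0 mul0r oppr0.
(* The only contribution that survives: it comes from the linear term of [frobW p ga de] in de. *)
have t2 : Z * Om * frobW p ga de = Z * al * be ^+ p.-1 * (ga ^+ p.-1 * de).
  rewrite -mulrA mulrBl.
  have -> : de ^+ p * frobW p ga de = 0.
    have [z ->] := frobW_mul p_pr ga de.
    transitivity (ga * de ^+ p * (de * z)); first by ring.
    by rewrite gade mul0r.
  rewrite subr0.
  have e1 : frobW p ga de * f0 ^+ p.-1 = frobW p ga de * P ^+ p.-1.
    apply: mulr_absorb; rewrite gaS deS frobW_scale // /Q gaS deS -mulrDr.
    transitivity (s2 ^+ p.+1 * (frobW p (u1 * c) (- (u2 * d)) * (u1 * c + - (u2 * d)))).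
      by rewrite exprS; ring.
    by rewrite s2p mul0r.
  have e2 : Z * al * P ^+ p.-1 = Z * al * be ^+ p.-1.
    rewrite /P addrC; apply: mulr_absorb; have := Za 2 isT => e.
    transitivity (Z * a ^+ 2 * (s1 * u1) ^+ 2); first by rewrite /al; ring.
    by rewrite e mul0r.
  transitivity (Z * al * (frobW p ga de * f0 ^+ p.-1)); first by ring.
  rewrite e1; transitivity (Z * al * P ^+ p.-1 * frobW p ga de); first by ring.
  rewrite e2.
  have [z ->] := frobW_lin p_pr ga de; rewrite mulrDr.
  have -> : Z * al * be ^+ p.-1 * (de ^+ 2 * z) =
      Z * d ^+ 2 * (al * be ^+ p.-1 * (s2 * u2) ^+ 2 * z) by rewrite /de; ring.
  by rewrite Zd mul0r addr0.
move: key; rewrite 2!(mulrDr (Z * Om)) t3 t2.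
have -> : Z * Om * frobW p al be = 0 by rewrite -mulrA t1 mulr0.
rewrite add0r addr0.
rewrite /Z /al /be /ga /de pq; case: p p_pr {p0 s1p s2p u1p u2p ap dp rel alal albe alga bede
  gade dede alW P Q f0 Om Z Om0 pq Za Zd t1 t3 t2} => [|[|n]] // _ <-.
rewrite addnS subSS subn1 /= exprD.
move: (n.+2 * q)%N => m; rewrite !exprMn !exprS; ring.
Qed.

(** Modulo p the p-th power of f0 = u x + v y + w z is 0, so Omega = f0^(p-1) kills f0. The second
    defect then vanishes by [frobW_opp]. In the first one, (u x)^(p-2) isolates the linear term, and
    (u x)^(p-1) (v y)^(p-1) reduces Omega to (w z)^(p-1). *)
Lemma pfaffian_top_monomial (B : comPzRingType) (p : nat) (T u v w x y z h : B) :
  prime p -> p%:R = 0 :> B -> u ^+ p = 0 -> v ^+ p = 0 -> w ^+ p = 0 ->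
  T * (frobW p (u * x) (v * y) + frobW p (u * x + v * y) (w * z)) =
    (u * x + v * y + w * z) * h ->
  T * (u * v * w * x * y * z) ^+ p.-1 = 0.
Proof.
move=> p_pr p0 up vp wp rel; have p_gt0 := prime_gt0 p_pr.
have ap : (u * x) ^+ p = 0 by rewrite exprMn up mul0r.
have bp : (v * y) ^+ p = 0 by rewrite exprMn vp mul0r.
have cp : (w * z) ^+ p = 0 by rewrite exprMn wp mul0r.
pose f0 := u * x + v * y + w * z; pose Om := f0 ^+ p.-1.
have Om0 : Om * f0 = 0.
  by rewrite -exprSr prednK // !exprDp // ap bp cp !addr0.
pose Z := T * (u * x) ^+ (p - 2).
have key : Z * Om * (frobW p (u * x) (v * y) + frobW p (u * x + v * y) (w * z)) = 0.
  transitivity ((u * x) ^+ (p - 2) * (Om * f0) * h); last by rewrite Om0; ring.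
  have rel' : f0 * h = (u * x + v * y + w * z) * h by [].
  transitivity ((u * x) ^+ (p - 2) * Om * (f0 * h)); last by ring.
  by rewrite rel' -rel /Z; ring.
have t2 : Z * Om * frobW p (u * x + v * y) (w * z) = 0.
  have o : Z * Om * (w * z) = - (Z * Om * (u * x + v * y)).
    by apply/eqP; rewrite -addr_eq0 -mulrDr addrC -mulrA Om0 mulr0.
  by rewrite frobW_opp // exprDp // ap bp addr0 mulr0 mul0r.
move: key; rewrite mulrDr t2 addr0 frobWC //.
have [r ->] := frobW_lin p_pr (v * y) (u * x).
have -> : Z * Om * ((v * y) ^+ p.-1 * (u * x) + (u * x) ^+ 2 * r) =
  T * ((u * x) ^+ (p - 2) * (u * x) * (v * y) ^+ p.-1 * Om)
  + T * Om * r * ((u * x) ^+ (p - 2) * (u * x) ^+ 2).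
  by rewrite /Z; ring.
rewrite -exprD subnK ?prime_gt1 // ap mulr0 addr0 -exprSr.
have -> : (p - 2).+1 = p.-1 by have := prime_gt1 p_pr; lia.
rewrite /Om /f0 addrC mulr_absorb; last first.
  have -> : (u * x) ^+ p.-1 * (v * y) ^+ p.-1 * (u * x + v * y) =
    (u * x) ^+ p.-1 * (u * x) * (v * y) ^+ p.-1 +
    (v * y) ^+ p.-1 * (v * y) * (u * x) ^+ p.-1 by ring.
  by rewrite -!exprSr prednK // ap bp !mul0r addr0.
by rewrite !exprMn => <-; ring.
Qed.

Section Symmetric2.
Variables (B : comPzRingType) (a b c d e g : B).
Hypotheses (B2 : 2%:R = 0 :> B) (c5 : c ^+ 5 = 0) (e5 : e ^+ 5 = 0) (g2 : g ^+ 2 = 0).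

(* Multiplication by Omega kills f and leaves a single monomial of Delta; the next two
   identities are certificates of membership in (2, c^5, e^5, g^2). *)
Definition sym2_omega :=
  b * (c ^+ 2 * e ^+ 2 * (a * e ^+ 2 + d * c ^+ 2 + g * b ^+ 2) +
       g * (a * e ^+ 2 + d * c ^+ 2) ^+ 2).

Lemma sym2_omega_det :
  sym2_omega * (a * d * g + a * e ^+ 2 + d * c ^+ 2 + g * b ^+ 2) = 0.
Proof.
transitivity (c ^+ 5 * (b * c * d ^+ 2 * e ^+ 2 + b * c * d ^+ 3 * g) +
 e ^+ 5 * (a ^+ 2 * b * c ^+ 2 * e + a ^+ 3 * b * e * g) +
 g ^+ 2 * (3%:R * a * b ^+ 3 * c ^+ 2 * d * e ^+ 2 + b ^+ 5 * c ^+ 2 * e ^+ 2 + a ^+ 3 * b * d *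
   e ^+ 4 + a ^+ 2 * b ^+ 3 * e ^+ 4 + 2%:R * a ^+ 2 * b * c ^+ 2 * d ^+ 2 * e ^+ 2 + a * b * c
     ^+ 4 * d ^+ 3 + b ^+ 3 * c ^+ 4 * d ^+ 2) +
 2%:R * (2%:R * a ^+ 2 * b * c ^+ 2 * d * e ^+ 4 * g + a * b * c ^+ 4 * d * e ^+ 4 + a * b ^+ 3
   * c ^+ 2 * e ^+ 4 * g + 2%:R * a * b * c ^+ 4 * d ^+ 2 * e ^+ 2 * g + b ^+ 3 * c ^+ 4 * d * e
     ^+ 2 * g)).
  by rewrite /sym2_omega; ring.
by rewrite c5 e5 g2 B2 !mul0r !addr0.
Qed.

Lemma sym2_omega_defect (T : B) : T * a ^+ 2 = 0 ->
  T * sym2_omega *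
    (a * d * g * (a * e ^+ 2 + d * c ^+ 2 + g * b ^+ 2)
     + a * e ^+ 2 * (d * c ^+ 2 + g * b ^+ 2) + d * c ^+ 2 * (g * b ^+ 2)) =
  T * (a * b ^+ 3 * c ^+ 4 * d * e ^+ 4 * g).
Proof.
move=> Ta; transitivity (T * (c ^+ 5 * (2%:R * a * b * c * d ^+ 3 * e ^+ 2 * g + a * b * c * d
  ^+ 2 * e ^+ 4 + b ^+ 3 * c * d ^+ 2 * e ^+ 2 * g + a * b * c * d ^+ 4 * g ^+ 2 + b ^+ 3 * c *
    d ^+ 3 * g ^+ 2)) +
 T * (e ^+ 5 * (2%:R * a ^+ 3 * b * c ^+ 2 * d * e * g + a ^+ 2 * b * c ^+ 4 * d * e + a ^+ 2 *
   b ^+ 3 * c ^+ 2 * e * g + a ^+ 4 * b * d * e * g ^+ 2 + a ^+ 3 * b ^+ 3 * e * g ^+ 2)) +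
 T * (g ^+ 2 * (5%:R * a ^+ 2 * b ^+ 3 * c ^+ 2 * d * e ^+ 4 + 5%:R * a * b ^+ 3 * c ^+ 4 * d ^+
   2 * e ^+ 2 + a * b ^+ 5 * c ^+ 2 * d * e ^+ 2 * g + a * b ^+ 5 * c ^+ 2 * e ^+ 4 + b ^+ 5 * c
     ^+ 4 * d * e ^+ 2 + 3%:R * a ^+ 3 * b * c ^+ 2 * d ^+ 2 * e ^+ 4 + a ^+ 3 * b ^+ 3 * d * e
       ^+ 4 * g + 3%:R * a ^+ 2 * b * c ^+ 4 * d ^+ 3 * e ^+ 2 + 2%:R * a ^+ 2 * b ^+ 3 * c ^+ 2
         * d ^+ 2 * e ^+ 2 * g + a * b ^+ 3 * c ^+ 4 * d ^+ 3 * g)) +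
 T * a ^+ 2 * (4%:R * b * c ^+ 4 * d ^+ 2 * e ^+ 4 * g) +
 2%:R * (T * (a * b ^+ 3 * c ^+ 4 * d * e ^+ 4 * g)) +
 T * (a * b ^+ 3 * c ^+ 4 * d * e ^+ 4 * g)).
  by rewrite /sym2_omega; ring.
by rewrite c5 e5 g2 B2 Ta !mul0r !mulr0 !add0r.
Qed.
End Symmetric2.

(** * Generic determinants *)

Lemma whomog_frobW k (w : 'I_k -> int) (R : comNzRingType) p d (x y : {mpoly R[k]}) :
  whomog w d x -> whomog w d y -> whomog w (d *+ p) (frobW p x y).
Proof.
move=> hx hy; apply: whomog_sum => i _; rewrite -[_ *+ p]add0r.
apply: whomogM; first exact: whomog_nat.
have le_ip : (i.+1 <= p)%N by have := ltn_ord i; lia.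
have -> : d *+ p = d *+ i.+1 + d *+ (p - i.+1) by rewrite -mulrnDr subnKC.
by apply: whomogM; apply: whomogXn.
Qed.

Lemma wt_gt0 k (w : 'I_k -> int) (m : 'X_{1..k}) :
  0 < wt w m -> exists2 i, (0 < m i)%N & 0 < w i.
Proof.
move=> wm; case: (boolP [exists i, (0 < m i)%N && (0 < w i)]) => [/existsP[i /andP[]]|no].
  by exists i.
suff le0 : wt w m <= 0 by have := lt_le_trans wm le0; rewrite ltxx.
apply: sumr_le0 => i _; move: no; rewrite negb_exists => /forallP/(_ i).
case: (m i) => [|n]; first by rewrite mul0r.
by rewrite /= -leNgt => wi; rewrite mulr_ge0_le0.
Qed.

(** A monomial of positive weight contains a variable of positive weight, and T kills the p-th power
    of that variable. *)
Lemma pth_power_killed k (w : 'I_k -> int) (B : comPzRingType)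
    (h : {rmorphism {mpoly int[k]} -> B}) p (T : B) c (m : 'X_{1..k}) :
  0 < wt w m -> (forall i, 0 < w i -> T * h 'X_i ^+ p = 0) ->
  T * h (c *: 'X_[m *+ p]) = 0.
Proof.
move=> /wt_gt0[i mi wi] /(_ i wi) Ti.
have -> : (m *+ p)%MM = ((m - U_(i)) *+ p + U_(i) *+ p)%MM.
  apply/mnmP => j; rewrite mnmDE !mulmnE mnmBE mnm1E -mulnDl subnK //.
  by case: eqP => [<-|].
rewrite mpolyXD -mul_mpolyC !rmorphM -[X in _ * (_ * h X)]mpolyXn rmorphXn.
transitivity (h c%:MP * h 'X_[(m - U_(i)) *+ p] * (T * h 'X_i ^+ p)); first by ring.
by rewrite Ti mulr0.
Qed.

(** The bracketing puts e + f last: with e = f = 0, as in the specialization, the expression of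
    [block_top_monomial] remains. *)
Definition frobW6 p (R : pzRingType) (a b c d e f : R) :=
  frobW p a b + frobW p c d + frobW p (a + b) (c + d)
  + (frobW p e f + frobW p (a + b + (c + d)) (e + f)).

Lemma frobW6E (R : comPzRingType) p (a b c d e f : R) : prime p ->
  (a + b + (c + d) + (e + f)) ^+ p =
  a ^+ p + b ^+ p + (c ^+ p + d ^+ p) + (e ^+ p + f ^+ p) + p%:R * frobW6 p a b c d e f.
Proof. by move=> p_pr; rewrite !(frobWE p_pr) /frobW6; ring. Qed.

Lemma rmorph_frobW6 (R R' : comPzRingType) (h : {rmorphism R -> R'}) p (a b c d e f : R) :
  h (frobW6 p a b c d e f) = frobW6 p (h a) (h b) (h c) (h d) (h e) (h f).
Proof. by rewrite /frobW6 !rmorphD !rmorph_frobW !rmorphD. Qed.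

Lemma frobW6_00 (R : comPzRingType) p (a b c d : R) : prime p ->
  frobW6 p a b c d 0 0 = frobW p a b + frobW p c d + frobW p (a + b) (c + d).
Proof. by move=> p_pr; rewrite /frobW6 addr0 !(frobW0 p_pr) !addr0. Qed.

Section SchurComplement.
Variables (R : comNzRingType) (k m : nat) (X : 'M[R]_(k + m)).

Definition schur : 'M[R]_k :=
  \det (drsubmx X) *: ulsubmx X - ursubmx X *m \adj (drsubmx X) *m dlsubmx X.

(** Column operations by L make X block upper triangular with diagonal blocks [schur] and B, and L
    has determinant g^k. Clearing denominators with the adjugate avoids inverting B. *)
Lemma det_schur : \det schur * \det (drsubmx X) = \det X * \det (drsubmx X) ^+ k.
Proof.
set B := drsubmx X; set g := \det B.
pose L := block_mx g%:M 0 (- (\adj B *m dlsubmx X)) 1%:M : 'M_(k + m).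
have -> : g ^+ k = \det L.
  by rewrite det_lblock det_scalar det1 mulr1.
rewrite -det_mulmx -{1}(submxK X) mulmx_block !mulmx1 !mulmx0 !add0r.
by rewrite !mulmxN !mulmxA mul_mx_adj -/g !mul_mx_scalar mul_scalar_mx subrr det_ublock.
Qed.
End SchurComplement.

Lemma map_schur (R R' : comNzRingType) (h : {rmorphism R -> R'}) k m
    (X : 'M[R]_(k + m)) : map_mx h (schur X) = schur (map_mx h X).
Proof.
rewrite /schur map_mxB map_mxZ !map_mxM map_mx_adj -det_map_mx.
by rewrite !map_ulsubmx !map_ursubmx !map_dlsubmx !map_drsubmx.
Qed.

Lemma det_mx33 (R : comNzRingType) (M : 'M[R]_3) :
  let e i j := M (inord i) (inord j) in
  \det M = e 0%N 0%N * e 1%N 1%N * e 2%N 2%N - e 0%N 0%N * e 1%N 2%N * e 2%N 1%N - e 0%N 1%N * e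
    1%N 0%N * e 2%N 2%N
         + e 0%N 1%N * e 1%N 2%N * e 2%N 0%N + e 0%N 2%N * e 1%N 0%N * e 2%N 1%N - e 0%N 2%N * e
           1%N 1%N * e 2%N 0%N.
Proof.
move=> e; pose E (i j : nat) := M (inord i) (inord j).
have eE (i j : 'I_3) : M i j = E i j by rewrite /E !inord_val.
rewrite (expand_det_row _ ord0) !big_ord_recl big_ord0 /cofactor.
rewrite !(expand_det_row _ ord0) !big_ord_recl !big_ord0 /cofactor !det_mx11.
rewrite !mxE !eE /= /bump /= -/E; rewrite /e -!/(E _ _); ring.
Qed.

Section GenericMatrix.
Variables (n : nat).
Local Notation S := {mpoly int[#|{: 'I_n * 'I_n}|]}.
Local Notation X := (generic_varmx n).

Definition mxsubst (R : comNzRingType) (Y : 'M[R]_n) : S -> R :=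
  mmap intr (fun k => Y (enum_val k).1 (enum_val k).2).
HB.instance Definition _ R Y := GRing.RMorphism.on (@mxsubst R Y).

Lemma mxsubstXU (R : comNzRingType) (Y : 'M[R]_n) k :
  mxsubst Y 'X_k = Y (enum_val k).1 (enum_val k).2.
Proof. by rewrite /mxsubst mmapX mmap1U. Qed.

Lemma map_mxsubst (R : comNzRingType) (Y : 'M[R]_n) : map_mx (mxsubst Y) X = Y.
Proof. by apply/matrixP => i j; rewrite !mxE mxsubstXU enum_rankK. Qed.

Definition diag_vars : {set 'I_#|{: 'I_n * 'I_n}|} := [set enum_rank (i, i) | i : 'I_n].

Lemma card_diag_vars : #|diag_vars| = n.
Proof. by rewrite card_imset ?card_ord // => i j /enum_rank_inj []. Qed.

Lemma generic_entry_homog (a b : 'I_n -> int) i j :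
  whomog (fun k => a (enum_val k).1 + b (enum_val k).2) (a i + b j) (X i j).
Proof.
rewrite mxE; have := @whomogXU _ int (fun k => a (enum_val k).1 + b (enum_val k).2) (enum_rank
  (i, j)).
by rewrite enum_rankK.
Qed.

Lemma generic_det_homog1 : whomog (fun=> 1) #|diag_vars|%:Z (\det X).
Proof.
have h i j : whomog (fun=> 1) (1 + 0) (X i j).
  by rewrite addr0 mxE; apply: (@whomogXU _ int (fun=> 1)).
have := whomog_det h.
by rewrite !sumr_const card_diag_vars card_ord mul0rn addr0 natz.
Qed.

Lemma generic_det_diag :
  mmap (@mpolyC _ int) (fun k => if k \in diag_vars then 'X_k else 0) (\det X) =
  \prod_(k in diag_vars) 'X_k.
Proof.
rewrite -det_map_mx; set Y := map_mx _ _.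
have -> : Y = diag_mx (\row_i 'X_(enum_rank (i, i))).
  apply/matrixP => i j; rewrite !mxE /= mmapX mmap1U.
  have -> : (enum_rank (i, j) \in diag_vars) = (i == j).
    apply/imsetP/eqP => [[k _ /enum_rank_inj [-> ->]]|<-] //.
    by exists i.
  by case: eqP => [<-|_]; rewrite ?mulr1n ?mulr0n.
rewrite det_diag big_imset /=; last by move=> i j _ _ /enum_rank_inj [].
by apply: eq_bigr => i _; rewrite mxE.
Qed.
End GenericMatrix.

Section GenericDeterminant.
Variables (m p : nat).
Hypothesis p_pr : prime p.
Local Notation n := (3 + m)%N.
Local Notation S := {mpoly int[#|{: 'I_n * 'I_n}|]}.
Let X : 'M[S]_(3 + m) := generic_varmx n.
Let f : S := \det X.
Let g : S := \det (drsubmx X).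
Let M (i j : nat) : S := schur X (inord i) (inord j).

(** Rows 0 and 1 have weight 1 and column 2 has weight -1, so f has weight 1 and Delta weight p. The
    entries of positive weight are those in rows 0 and 1 outside column 2; the specialization sends
    them to the truncated a, b, c, d or to 0. *)
Let rowwt (i : 'I_n) : int := (i < 2)%N%:Z.
Let colwt (j : 'I_n) : int := - (j == 2 :> nat)%N%:Z.
Let w (k : 'I_#|{: 'I_n * 'I_n}|) : int :=
  rowwt (enum_val k).1 + colwt (enum_val k).2.

Lemma corner_det_homog : whomog w 0 g.
Proof.
have := @whomog_det _ _ w _ (drsubmx X) (fun=> 0) (fun=> 0).
rewrite !big1 // addr0; apply=> k l.
have : whomog w (rowwt (rshift 3 k) + colwt (rshift 3 l)) (X (rshift 3 k) (rshift 3 l)).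
  exact: generic_entry_homog.
by congr (whomog _ _ _); rewrite !mxE.
Qed.

Lemma generic_det_weight : whomog w 1 f.
Proof.
have := @whomog_det _ _ w _ X rowwt colwt.
rewrite !big_split_ord /= !big_ord_recl !big_ord0 !addr0.
rewrite !big1 ?addr0 //; try by move=> i _; rewrite /rowwt /colwt.
by apply=> i j; apply: generic_entry_homog.
Qed.

Lemma schur_entry_homog (i j : 'I_3) :
  whomog w (rowwt (lshift m i) + colwt (lshift m j)) (schur X i j).
Proof.
have hX k l : whomog w (rowwt k + colwt l) (X k l) by apply: generic_entry_homog.
have r0 k : rowwt (rshift 3 k) = 0 by [].
have c0 k : colwt (rshift 3 k) = 0 by [].
have hB k l : whomog w 0 (drsubmx X k l).
  have := hX (rshift 3 k) (rshift 3 l); rewrite r0 c0 addr0.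
  by congr (whomog _ _ _); rewrite !mxE.
have hg := corner_det_homog.
have hP : whomog w (rowwt (lshift m i) + colwt (lshift m j)) (ulsubmx X i j).
  by have := hX (lshift m i) (lshift m j); congr (whomog _ _ _); rewrite !mxE.
have hQ k : whomog w (rowwt (lshift m i)) (ursubmx X i k).
  have := hX (lshift m i) (rshift 3 k); rewrite c0 addr0.
  by congr (whomog _ _ _); rewrite !mxE.
have hU k : whomog w (colwt (lshift m j)) (dlsubmx X k j).
  have := hX (rshift 3 k) (lshift m j); rewrite r0 add0r.
  by congr (whomog _ _ _); rewrite !mxE.
rewrite /schur mxE; apply: whomogD.
  by rewrite mxE -[X in whomog _ X]add0r; apply: whomogM.
rewrite mxE; apply: whomogN; rewrite mxE; apply: whomog_sum => k _; apply: whomogM => //.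
rewrite mxE; apply: whomog_sum => l _; rewrite -[rowwt _]addr0; apply: whomogM => //.
exact: whomog_adj0.
Qed.

(** X becomes block diagonal with blocks the identity and the 3 x 3 matrix with rows (d, b, u1), (c,
    a, u2), (s1, s2, 0). This block is then the Schur complement, g becomes 1, and the corner 0
    leaves four of the six terms of the determinant. *)
Lemma det_specialization (Q : nat) : (0 < Q)%N ->
  exists (B : comPzRingType) (h : {rmorphism S -> B}) (s1 s2 u1 u2 a b c d : B),
  [/\ p%:R = 0 :> B, [/\ s1 ^+ p.+1 = 0, s2 ^+ p.+1 = 0, u1 ^+ p.+1 = 0 & u2 ^+ p.+1 = 0],
      [/\ a ^+ Q = 0, b ^+ Q = 0, c ^+ Q = 0 & d ^+ Q = 0],
      (s1 * s2 * u1 * u2) ^+ p * (a * b * c * d) ^+ Q.-1 <> 0 &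
  [/\ [/\ h (M 0%N 0%N) = d, h (M 0%N 1%N) = b, h (M 1%N 0%N) = c & h (M 1%N 1%N) = a],
      [/\ h (M 0%N 2%N) = u1, h (M 1%N 2%N) = u2, h (M 2%N 0%N) = s1, h (M 2%N 1%N) = s2 & h (M
        2%N 2%N) = 0],
      h g = 1, h f = - (s1 * u1 * a) + s1 * u2 * b + (s2 * u1 * c - s2 * u2 * d) &
      forall k, (0 < w k)%R -> h 'X_k \in [:: a; b; c; d; 0]]].
Proof.
move=> Q_gt0; pose E (i : nat) : nat := if (i < 4)%N then p else Q.-1.
pose mm : 'X_{1..8} := [multinom E i | i < 8].
pose x (i : nat) : {mpoly int[8]} := 'X_(inord i).
pose L : seq (seq {mpoly int[8]}) :=
  [:: [:: x 7%N; x 5%N; x 2%N]; [:: x 6%N; x 4%N; x 3%N]; [:: x 0%N; x 1%N; 0]].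
pose X3 : 'M[{mpoly int[8]}]_3 := \matrix_(i, j) ((nth [::] L i)`_j).
pose Y : 'M[{mpoly int[8]}]_(3 + m) := block_mx X3 0 0 1%:M.
pose G := mono_gens p mm.
pose y (i : nat) := qproj G (x i).
have yE i : (i < 8)%N -> y i ^+ (E i).+1 = 0.
  move=> lt_i; have := mono_quot_X p mm (inord i).
  by rewrite mnmE inordK.
pose h : {rmorphism S -> rquot G} := qproj G \o mxsubst Y.
have hM i j : h (schur X i j) = qproj G (X3 i j).
  have : map_mx (mxsubst Y) (schur X) = X3.
    rewrite map_schur map_mxsubst /schur block_mxKdr block_mxKul block_mxKur.
    by rewrite !mul0mx subr0 det1 scale1r.
  by move/matrixP/(_ i j); rewrite mxE => <-.
have hM' i j : (i < 3)%N -> (j < 3)%N -> h (M i j) = qproj G (nth [::] L i)`_j.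
  by move=> lt_i lt_j; rewrite hM mxE !inordK.
exists (rquot G), h, (y 0%N), (y 1%N), (y 2%N), (y 3%N), (y 4%N), (y 5%N), (y 6%N), (y 7%N);
  split.
- exact: mono_quot_p.
- by split; [exact: (yE 0%N) | exact: (yE 1%N) | exact: (yE 2) | exact: (yE 3)].
- have yQ i : (4 <= i < 8)%N -> y i ^+ Q = 0.
    by case/andP=> i4 i8; have := yE i i8; rewrite /E ltnNge i4 /= prednK.
  by split; [exact: (yQ 4) | exact: (yQ 5) | exact: (yQ 6) | exact: (yQ 7)].
- move=> e; apply: (@mono_top_neq0 _ p mm p_pr).
  transitivity (\prod_(i < 8) y i ^+ E i).
    by apply: eq_bigr => i _; rewrite mnmE /y /x inord_val.
  rewrite -[RHS]e; move: (y) => z; rewrite !big_ord_recl big_ord0 /E /bump !exprMn.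
  by rewrite /= /bump /= !addn0 mulr1; ring.
split.
- by split; apply: hM'.
- by split; rewrite hM' ?rmorph0.
- have : map_mx (mxsubst Y) (drsubmx X) = 1%:M.
    by rewrite map_drsubmx map_mxsubst block_mxKdr.
  by rewrite /h /= /g => e; rewrite -det_map_mx e det1 rmorph1.
- rewrite /h /= /f -det_map_mx map_mxsubst det_ublock det1 mulr1 det_mx33.
  rewrite !mxE !inordK //= !(rmorphD, rmorphB, rmorphM, rmorph0); ring.
move=> k; rewrite /w /h /= mxsubstXU.
case: (enum_val k) => i j /=; rewrite /rowwt /colwt /Y => w_gt0.
have [i2 j2] : (i < 2)%N /\ j != 2 :> nat.
  by case: (ltnP i 2) w_gt0 => //; case: eqP.
have lt_i3 : (i < 3)%N by rewrite (leq_trans i2).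
have -> : i = lshift m (Ordinal lt_i3) by apply: val_inj.
have mem5 (T : eqType) (z1 z2 z3 z4 z5 : T) : let s := [:: z1; z2; z3; z4; z5] in
    [/\ z1 \in s, z2 \in s, z3 \in s & z4 \in s] /\ z5 \in s.
  by move=> s; rewrite /s !inE !eqxx !orbT.
have [[m4 m5 m6 m7] m0] := mem5 _ (y 4%N) (y 5%N) (y 6%N) (y 7%N) 0.
have := ltn_ord j; case: (ltnP j 3) => [lt_j3|le_3j] lt_j.
  have -> : j = lshift m (Ordinal lt_j3) by apply: val_inj.
  rewrite block_mxEul mxE /=; move: i2 j2 lt_j3.
  move: (nat_of_ord i) (nat_of_ord j) => i' j'.
  move=> i2 j2 j3; have : [|| (i' == 0) && (j' == 0), (i' == 0) && (j' == 1),
      (i' == 1) && (j' == 0) | (i' == 1) && (j' == 1)]%N by move: i2 j2 j3; clear; lia.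
  by case/or4P => /andP[/eqP -> /eqP ->]; [exact: m7|exact: m5|exact: m6|exact: m4].
have lt_j' : (j - 3 < m)%N by rewrite ltn_subLR.
have -> : j = rshift 3 (Ordinal lt_j') by apply: val_inj => /=; rewrite subnKC.
have e0 : block_mx X3 0 0 1%:M (lshift m (Ordinal lt_i3)) (rshift 3 (Ordinal lt_j')) = 0.
  by rewrite block_mxEur mxE.
by rewrite e0 (rmorph0 (qproj G)).
Qed.

Lemma generic_det_no_lift :
  let I1 := [:: f; p%:R] in let I2 := [:: f; (p ^ 2)%N%:R] in
  ~ lifts_to I2 I1 (frob_trace f p) /\ ~ lifts_to [:: f] I1 (frob_trace f p).
Proof.
move=> I1 I2; pose t (i : 'I_4) : S := [:: M 0%N 0%N; M 0%N 1%N; M 1%N 0%N; M 1%N 1%N]`_i.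
(* Each of the six terms of the 3 x 3 determinant contains an entry of the leading 2 x 2 block; [l]
   records which one, and [v] is g times the signed product of the other two. *)
pose l (j : 'I_6) : 'I_4 := inord (nth 0%N [:: 3; 1; 2; 0; 0; 1]%N j).
pose v (j : 'I_6) : S := [:: - (g * M 0%N 2 * M 2 0%N); g * M 1%N 2 * M 2 0%N;
  g * M 0%N 2 * M 2 1%N; - (g * M 1%N 2 * M 2 1%N); g * M 1%N 1%N * M 2 2;
  - (g * M 1%N 0%N * M 2 2)]`_j.
pose T (j : 'I_6) := t (l j) * v j.
pose al := T (inord 0); pose be := T (inord 1); pose ga := T (inord 2).
pose de := T (inord 3); pose ep := T (inord 4); pose ze := T (inord 5).
pose D := frobW6 p al be ga de ep ze.
have [alE beE gaE] : [/\ al = M 1%N 1%N * - (g * M 0%N 2 * M 2 0%N),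
    be = M 0%N 1%N * (g * M 1%N 2 * M 2 0%N) & ga = M 1%N 0%N * (g * M 0%N 2 * M 2 1%N)].
  by rewrite /al /be /ga /T /t /v /l !inordK.
have [deE epE zeE] : [/\ de = M 0%N 0%N * - (g * M 1%N 2 * M 2 1%N),
    ep = M 0%N 0%N * (g * M 1%N 1%N * M 2 2) & ze = M 0%N 1%N * - (g * M 1%N 0%N * M 2 2)].
  by rewrite /de /ep /ze /T /t /v /l !inordK.
have wM i j : (i < 3)%N -> (j < 3)%N ->
    whomog w ((i < 2)%N%:Z - (j == 2)%N%:Z) (M i j).
  move=> lt_i lt_j; have := @schur_entry_homog (inord i) (inord j).
  by rewrite /rowwt /colwt /= !inordK.
have wg := corner_det_homog.
have w3 (d1 d2 d3 : int) x y z : whomog w d1 x -> whomog w d2 y -> whomog w d3 z ->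
    d1 + (0 + d2 + d3) = 1 -> whomog w 1 (x * (g * y * z)).
  by move=> hx hy hz <-; apply: whomogM => //; apply: whomogM => //; apply: whomogM.
have [wal wbe wga] : [/\ whomog w 1 al, whomog w 1 be & whomog w 1 ga].
  rewrite alE beE gaE mulrN; split; [apply: whomogN|..].
  - exact: w3 (wM 1 1 _ _) (wM 0 2 _ _) (wM 2 0 _ _) _.
  - exact: w3 (wM 0 1 _ _) (wM 1 2 _ _) (wM 2 0 _ _) _.
  - exact: w3 (wM 1 0 _ _) (wM 0 2 _ _) (wM 2 1 _ _) _.
have [wde wep wze] : [/\ whomog w 1 de, whomog w 1 ep & whomog w 1 ze].
  rewrite deE epE zeE !mulrN; split; [apply: whomogN|..|apply: whomogN].
  - exact: w3 (wM 0 0 _ _) (wM 1 2 _ _) (wM 2 1 _ _) _.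
  - exact: w3 (wM 0 0 _ _) (wM 1 1 _ _) (wM 2 2 _ _) _.
  - exact: w3 (wM 0 1 _ _) (wM 1 0 _ _) (wM 2 2 _ _) _.
have sum6 (V : nmodType) (F : 'I_6 -> V) : \sum_j F j = F (inord 0) + F (inord 1)
    + (F (inord 2) + F (inord 3)) + (F (inord 4) + F (inord 5)).
  rewrite !big_ord_recl big_ord0 addr0 !addrA.
  by do !congr (_ + _); congr F; apply: val_inj; rewrite /= inordK.
refine (@no_lift_by_weight _ p (diag_vars n) f p_pr (@generic_det_homog1 n) (@generic_det_diag n)
          w 1 (1 *+ p) _ _ t l v D _ _ _ _).
- exact: generic_det_weight.
- by rewrite /D /frobW6; do !apply: whomogD; apply: whomog_frobW => //; do ?apply: whomogD.
(* The six terms add up to det(schur) g = f g^3, so the relation is a p-th power of a multiple of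
   f. *)
- have -> : \sum_j (t (l j) * v j) ^+ p + p%:R * D = (f * g ^+ 3) ^+ p.
    rewrite -det_schur -/g sum6 -/(T _) -/al -/be -/ga -/de -/ep -/ze.
    have -> : \det (schur X) * g = al + be + (ga + de) + (ep + ze).
      by rewrite det_mx33 alE beE gaE deE epE zeE /M; ring.
    by rewrite (frobW6E _ _ _ _ _ _ p_pr).
  rewrite exprMn -(prednK (prime_gt0 p_pr)) exprS -mulrA.
  by rewrite gen_idealMr // mem_gen // inE eqxx.
case=> q [g' [a0 [b0 [e [E Pe]]]]].
have [] := @det_specialization (p * q.+1); first by rewrite muln_gt0 prime_gt0.
move=> B [h [s1 [s2 [u1 [u2 [a [b [c [d]]]]]]]]].
case=> p0 [s1p s2p u1p u2p] [aQ bQ cQ dQ] top_neq0 [[h00 h01 h10 h11] [h02 h12 h20 h21 h22] hg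
  hf hX].
apply: top_neq0; set T0 := (a * b * c * d) ^+ (p * q).
(* T0 raises each of a, b, c, d to the power p q, so one more p-th power reaches the vanishing
   exponent p (q + 1). *)
have he : T0 * h e = 0.
  apply: (Pe (fun x => T0 * h x = 0)).
  - by rewrite rmorph0 mulr0.
  - by move=> x y hx hy; rewrite rmorphD mulrDr hx hy addr0.
  - by move=> x; rewrite rmorphM rmorph_nat p0 mul0r mulr0.
  move=> z m' wm; apply: (@pth_power_killed _ w).
    suff -> : wt w m' = 1 by [].
    by apply/eqP; rewrite -(eqr_pMn2r (prime_gt0 p_pr)) wm.
  move=> k0 /hX; rewrite !inE => hk.
  have T0E : T0 = (a ^+ (p * q)) * b ^+ (p * q) * c ^+ (p * q) * d ^+ (p * q).
    by rewrite -!exprMn.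
  have eQ x : x ^+ (p * q.+1) = x ^+ (p * q) * x ^+ p by rewrite mulnS addnC exprD.
  rewrite !eQ in aQ bQ cQ dQ; rewrite T0E; move: hk.
  set A := a ^+ _; set A2 := b ^+ _; set A3 := c ^+ _; set A4 := d ^+ _.
  case/orP => [/eqP ->|].
    by transitivity (A * a ^+ p * (A2 * A3 * A4)); [ring|rewrite aQ mul0r].
  case/orP => [/eqP ->|].
    by transitivity (A2 * b ^+ p * (A * A3 * A4)); [ring|rewrite bQ mul0r].
  case/orP => [/eqP ->|].
    by transitivity (A3 * c ^+ p * (A * A2 * A4)); [ring|rewrite cQ mul0r].
  case/orP => [/eqP ->|/eqP ->].
    by transitivity (A4 * d ^+ p * (A * A2 * A3)); [ring|rewrite dQ mul0r].
  by rewrite expr0n eqn0Ngt prime_gt0 // mulr0.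
have ht j : h (t (l j)) ^+ (p * q.+1) = 0.
  rewrite /t; move: (l j) => {}j.
  case: j => -[|[|[|[|//]]]] /= _; [rewrite h00; exact: dQ|rewrite h01; exact: bQ|rewrite h10;
    exact: cQ|rewrite h11; exact: aQ].
apply: (@block_top_monomial _ p q s1 s2 u1 u2 a b c d (h a0)) => //.
rewrite -/T0.
have := congr1 h E; rewrite !rmorphD !rmorphM rmorph_nat p0 mul0r addr0 rmorphXn.
have -> : h (\sum_j t (l j) ^+ (p * q.+1) * g' j) = 0.
  by rewrite rmorph_sum big1 // => j _; rewrite rmorphM rmorphXn ht mul0r.
have -> : h (\prod_i t i ^+ q) ^+ p = T0.
  rewrite rmorph_prod !big_ord_recl big_ord0 !rmorphXn /t /= h00 h01 h10 h11.
  have -> : T0 = ((a * b * c * d) ^+ q) ^+ p by rewrite /T0 mulnC exprM.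
  by congr (_ ^+ _); rewrite !exprMn; ring.
rewrite addr0 hf rmorphB mulrBr he subr0 => <-; congr (_ * _).
rewrite /D rmorph_frobW6.
have h3 x y z x' y' z' : h x = x' -> h y = y' -> h z = z' -> h (x * (g * y * z)) = x' * (y' * z').
  by move=> hx hy hz; rewrite !rmorphM hx hy hz hg mul1r.
have -> : h al = - (s1 * u1 * a).
  by rewrite alE mulrN rmorphN (h3 _ _ _ _ _ _ h11 h02 h20); congr (- _); ring.
have -> : h be = s1 * u2 * b by rewrite beE (h3 _ _ _ _ _ _ h01 h12 h20); ring.
have -> : h ga = s2 * u1 * c by rewrite gaE (h3 _ _ _ _ _ _ h10 h02 h21); ring.
have -> : h de = - (s2 * u2 * d).
  by rewrite deE mulrN rmorphN (h3 _ _ _ _ _ _ h00 h12 h21); congr (- _); ring.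
have -> : h ep = 0 by rewrite epE (h3 _ _ _ _ _ _ h00 h11 h22) !mulr0.
have -> : h ze = 0 by rewrite zeE mulrN rmorphN (h3 _ _ _ _ _ _ h01 h10 h22) !mulr0 oppr0.
by rewrite frobW6_00.
Qed.
End GenericDeterminant.

(** * Pfaffians *)

Section FrobeniusDefectOfSums.
Variable p : nat.

(** Recursion on a list lets the order of the summands be chosen: vanishing terms at the end
    contribute nothing. *)
Fixpoint fdefect (R : pzRingType) (s : seq R) : R :=
  if s is x :: s' then frobW p x (\sum_(y <- s') y) + fdefect s' else 0.

Lemma fdefectE (R : comPzRingType) (s : seq R) : prime p ->
  (\sum_(x <- s) x) ^+ p = \sum_(x <- s) x ^+ p + p%:R * fdefect s.
Proof.
move=> p_pr; elim: s => [|x s IHs] /=.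
  by rewrite !big_nil expr0n eqn0Ngt prime_gt0 // mulr0 addr0.
by rewrite !big_cons frobWE // IHs; ring.
Qed.

Lemma rmorph_fdefect (R R' : comPzRingType) (h : {rmorphism R -> R'}) (s : seq R) :
  h (fdefect s) = fdefect (map h s).
Proof.
elim: s => [|x s IHs] /=; first exact: rmorph0.
by rewrite rmorphD rmorph_frobW IHs rmorph_sum big_map.
Qed.

Lemma fdefect0 (R : comPzRingType) (s : seq R) : prime p ->
  {in s, forall x, x = 0} -> fdefect s = 0.
Proof.
move=> p_pr; elim: s => [|x s IHs] //= s0.
rewrite IHs; last by move=> y ys; apply: s0; rewrite inE ys orbT.
rewrite big_seq big1 ?frobW0 ?addr0 // => y ys.
by apply: s0; rewrite inE ys orbT.
Qed.

Lemma whomog_fdefect k (w : 'I_k -> int) (R : comNzRingType) d (s : seq {mpoly R[k]}) :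
  {in s, forall x, whomog w d x} -> whomog w (d *+ p) (fdefect s).
Proof.
elim: s => [|x s IHs] /= hs; first exact: whomog0.
have hs' : {in s, forall x, whomog w d x} by move=> y ys; apply: hs; rewrite inE ys orbT.
apply: whomogD (IHs hs'); apply: whomog_frobW; first by apply: hs; rewrite inE eqxx.
by rewrite big_seq; apply: whomog_sum.
Qed.
End FrobeniusDefectOfSums.

Section PfaffianPermutations.
Variable m : nat.
Hypothesis m_even : ~~ odd m.
Local Notation n := m.+4.

Lemma permnE (s : 'S_n) k : (k < n)%N -> permn s k = s (inord k).
Proof.
by move=> lt_k; rewrite /permn insubT /=; congr (val (s _)); apply: val_inj; rewrite /= inordK.
Qed.

Lemma permn_lt (s : 'S_n) k : (k < n)%N -> (permn s k < n)%N.
Proof. by move=> lt_k; rewrite permnE. Qed.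

Lemma permn_inj (s : 'S_n) a b :
  (a < n)%N -> (b < n)%N -> permn s a = permn s b -> a = b.
Proof.
move=> la lb; rewrite !permnE // => /val_inj/perm_inj/(congr1 val).
by rewrite /= !inordK.
Qed.

Lemma pf_permP (s : 'S_n) : reflect
  ((forall i, (i.*2 < n)%N -> (permn s i.*2 < permn s i.*2.+1)%N) /\
   (forall i, (i.*2.+2 < n)%N -> (permn s i.*2 < permn s i.*2.+2)%N)) (pf_perm s).
Proof.
apply: (iffP andP) => [[/forallP h1 /forallP h2]|[h1 h2]]; split.
- move=> i lt_i; have lt_i' : (i < n./2)%N by move: m_even lt_i; clear; lia.
  exact: (h1 (Ordinal lt_i')).
- move=> i lt_i; have lt_i' : (i < n./2)%N by move: m_even lt_i; clear; lia.
  have := h2 (Ordinal lt_i'); move/implyP; apply.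
  by move: m_even lt_i; clear => /=; lia.
- apply/forallP => i; apply: h1; move: (ltn_ord i) m_even; clear; lia.
apply/forallP => i; apply/implyP => lt_i; apply: h2; move: lt_i m_even; clear; lia.
Qed.

(** At an odd place the value 0 would be preceded by a smaller one in its pair; at an even place
    monotonicity puts it above the value at 0. *)
Lemma pf_perm0 (s : 'S_n) : pf_perm s -> permn s 0 = 0%N.
Proof.
case/pf_permP => h1 h2.
have le0 i : (i.*2 < n)%N -> (permn s 0 <= permn s i.*2)%N.
  elim: i => [|i IHi] lt_i //; rewrite doubleS in lt_i *.
  apply: leq_trans (IHi _) (ltnW (h2 i lt_i)); by move: lt_i; clear; lia.
have [k lt_k e] : exists2 k, (k < n)%N & permn s k = 0%N.
  exists (s^-1%g ord0); first exact: ltn_ord.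
  by rewrite permnE // inord_val permKV.
have [ek|ek] : k = k./2.*2 \/ k = k./2.*2.+1 by clear; lia.
  by apply/eqP; rewrite -leqn0 -[X in (_ <= X)%N]e ek le0 // -ek.
have := h1 k./2; rewrite -ek e => /(_ _)/wrap[|//].
by move: lt_k; rewrite {1}ek; clear; lia.
Qed.

(** The entries above the diagonal that the specialization keeps: row 0, the leading 4 x 4 block and
    the pairs (4, 5), (6, 7), and so on. They reduce the Pfaffian to one of size 4. *)
Definition pf_pair (a b : nat) :=
  [|| a == 0, (a == 1) && (b == 2), (a == 1) && (b == 3), (a == 2) && (b == 3)
    | [&& 4 <= a, ~~ odd a & b == a.+1]]%N.

(** With the identity, which is the matching 01|23, these two permutations give the matchings 02|13
    and 03|12 of the leading four indices. *)
Definition perm02 : 'S_n := tperm (inord 1) (inord 2).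
Definition perm03 : 'S_n := (tperm (inord 2) (inord 3) * tperm (inord 1) (inord 3))%g.

Lemma perm02E k : (k < n)%N ->
  permn perm02 k = (if k == 1 then 2 else if k == 2 then 1 else k)%N.
Proof.
move=> lt_k; rewrite permnE // permE /= -!val_eqE /= !inordK //.
by case: (k == 1)%N; [|case: (k == 2)%N]; rewrite /= inordK.
Qed.

Lemma perm03E k : (k < n)%N ->
  permn perm03 k = (if k == 1 then 3 else if k == 2 then 1 else if k == 3 then 2 else k)%N.
Proof.
move=> lt_k; rewrite permnE // permM !permE /= -!val_eqE /= !inordK //.
by case: k lt_k => [|[|[|[|k]]]] lt_k; rewrite /= ?inordK // -!val_eqE /= ?inordK.
Qed.

Lemma perm_eq_permn (s t : 'S_n) : (forall k, (k < n)%N -> permn s k = permn t k) -> s = t.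
Proof.
move=> st; apply/perm.permP => k; apply: val_inj.
by have := st k (ltn_ord k); rewrite !permnE // inord_val.
Qed.

(** Apart from the partner of 0, which is free, a pair is inside {1, 2, 3} or of the form (2j, 2j+1)
    with 2j >= 4. Since first entries increase, the pairs from the third on are forced to be (4, 5),
    (6, 7), ..., and the first four indices are matched among themselves. *)
Lemma pf_perm_pairs (s : 'S_n) : pf_perm s ->
  (forall i, (i.*2 < n)%N -> pf_pair (permn s i.*2) (permn s i.*2.+1)) ->
  s \in [:: 1%g; perm02; perm03].
Proof.
move=> pfs good; have s0 := pf_perm0 pfs; case/pf_permP: pfs => h1 h2.
pose u := permn s.
have inj a b : (a < n)%N -> (b < n)%N -> u a = u b -> a = b := @permn_inj s a b.
have lt_u a : (a < n)%N -> (u a < n)%N := @permn_lt s a.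
have h2' i : ((i.+1).*2 < n)%N -> (u i.*2 < u (i.+1).*2)%N by apply: h2.
have pos i : (i.+1.*2 < n)%N -> (0 < u i.+1.*2)%N.
  by move=> /h2'; apply: leq_ltn_trans.
(* Base case: if the third pair started below 4 it would be (2, 3), the second would start at 1, and
   its partner 2 or 3 would be repeated. *)
have ge4 i : (i.+2.*2 < n)%N -> (4 <= u i.+2.*2)%N.
  elim: i => [|i IHi] lt_i; last first.
    apply: leq_trans (ltnW (h2' _ lt_i)); apply: IHi; move: lt_i; clear; lia.
  have := good 2 lt_i; have := good 1%N isT; have := h2' 1%N lt_i; have := pos 0%N isT.
  have := inj 3 4 isT lt_i; have := inj 3 5 isT; have := h1 2 lt_i.
  have := inj 2 5 isT; rewrite -/u /pf_pair /= -!/(u _).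
  have : (5 < n)%N by move: m_even lt_i; clear; lia.
  move=> ->; rewrite /double /=.
  move: (u 2) (u 3) (u 4) (u 5); clear; lia.
have even4 i : (i.+2.*2 < n)%N -> ~~ odd (u i.+2.*2) /\ u i.+2.*2.+1 = (u i.+2.*2).+1.
  move=> lt_i; have := good i.+2 lt_i; have := ge4 i lt_i.
  rewrite /pf_pair -!/(u _); move: (u i.+2.*2) (u i.+2.*2.+1); clear; lia.
have ge2 i : (i.+2.*2 < n)%N -> (i.+2.*2 <= u i.+2.*2)%N.
  elim: i => [|i IHi] lt_i; first exact: ge4.
  have lt_i' : (i.+2.*2 < n)%N by move: lt_i; clear; lia.
  have := IHi lt_i'; have := even4 _ lt_i; have := even4 _ lt_i'.
  have := h2' _ lt_i; move: (u i.+2.*2) (u i.+3.*2); clear; lia.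
(* Induction on the distance j to the last pair: the last first entry is at most n - 2, and even
   increasing entries drop by at least 2 at each step back. *)
have gap i j : (i.+2 + j).*2.+2 = n -> (u i.+2.*2 <= i.+2.*2)%N.
  elim: j i => [|j IHj] i e.
    have lt_i : (i.+2.*2 < n)%N by move: e; clear; lia.
    have [_ e1] := even4 _ lt_i.
    have : (u i.+2.*2.+1 < n)%N by apply: lt_u; move: e; clear; lia.
    rewrite e1; move: e; clear; lia.
  have lt_i : (i.+3.*2 < n)%N by move: e; clear; lia.
  have := IHj i.+1; have := h2' _ lt_i; have := even4 _ lt_i.
  have lt_i' : (i.+2.*2 < n)%N by move: lt_i; clear; lia.
  have := even4 _ lt_i'; move: (u i.+2.*2) (u i.+3.*2) e; clear; lia.
have u4 k : (4 <= k < n)%N -> u k = k.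
  move=> lt_k; pose i := (k./2 - 2)%N.
  have lt_i : (i.+2.*2 < n)%N by move: lt_k; rewrite /i; clear; lia.
  have ei : u i.+2.*2 = i.+2.*2.
    apply/eqP; rewrite eqn_leq ge2 // andbT; apply: (gap i (n./2 - i.+3)%N).
    by move: lt_i m_even; clear; lia.
  have [_ e1] := even4 _ lt_i; rewrite ei in e1.
  have : k = i.+2.*2 \/ k = i.+2.*2.+1 by move: lt_k; rewrite /i; clear; lia.
  by case=> ->.
have lt4 k : (k < 4)%N -> (u k < 4)%N.
  move=> lt_k; case: ltnP => // le_u.
  have lt_kn : (k < n)%N by move: lt_k; clear; lia.
  have /inj : u (u k) = u k by apply: u4; rewrite le_u lt_u.
  by move=> /(_ (lt_u _ lt_kn) lt_kn); lia.
have := h1 1%N isT; rewrite -/u /double /= => h23.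
have n12 := inj 1%N 2 isT isT; have n13 := inj 1%N 3 isT isT; have n23 := inj 2 3 isT isT.
have n01 := inj 0%N 1%N isT isT; have n02 := inj 0%N 2 isT isT; have n03 := inj 0%N 3 isT isT.
have l1 := lt4 1%N isT; have l2 := lt4 2 isT; have l3 := lt4 3 isT.
have : [\/ [/\ u 1%N = 1%N, u 2 = 2 & u 3 = 3], [/\ u 1%N = 2, u 2 = 1%N & u 3 = 3]
    | [/\ u 1%N = 3, u 2 = 1%N & u 3 = 2]].
  have := s0; rewrite -/u in n01 n02 n03 *.
  move: (u 0%N) (u 1%N) (u 2) (u 3) h23 n12 n13 n23 n01 n02 n03 l1 l2 l3; clear.
  move=> a b c d h23 n12 n13 n23 n01 n02 n03 l1 l2 l3 a0.
  have : [|| [&& b == 1, c == 2 & d == 3], [&& b == 2, c == 1 & d == 3]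
     | [&& b == 3, c == 1 & d == 2]]%N by lia.
  case/or3P => /and3P[/eqP -> /eqP -> /eqP ->]; [apply: Or31|apply: Or32|apply: Or33] => //.
case=> -[e1 e2 e3]; rewrite !inE; apply/or3P; [apply: Or31|apply: Or32|apply: Or33];
  apply/eqP/perm_eq_permn => k lt_k; rewrite ?perm02E ?perm03E //; try (rewrite (permnE 1%g) //
    perm1 inordK //);
  case: k lt_k => [|[|[|[|k]]]] lt_k //=; exact: u4.
Qed.

Lemma permn1 k : permn (1%g : 'S_n) k = k.
Proof. by rewrite /permn; case: insubP => // u _ <-; rewrite perm1. Qed.

Lemma pf_perm1 : pf_perm (1%g : 'S_n).
Proof. by apply/pf_permP; split=> i lt_i; rewrite !permn1. Qed.

Lemma pf_perm02 : pf_perm perm02.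
Proof.
apply/pf_permP; split=> i lt_i; rewrite !perm02E; try by move: m_even lt_i; clear; lia.
  by case: i lt_i => [|[|i]].
by case: i lt_i => [|[|i]].
Qed.

Lemma pf_perm03 : pf_perm perm03.
Proof.
apply/pf_permP; split=> i lt_i; rewrite !perm03E; try by move: m_even lt_i; clear; lia.
  by case: i lt_i => [|[|i]].
by case: i lt_i => [|[|i]].
Qed.

Lemma uniq_pf_perms : uniq [:: 1%g; perm02; perm03].
Proof.
have e (s t : 'S_n) : permn s 1 != permn t 1 -> s != t by apply: contraNneq => ->.
rewrite /= !inE !negb_or !e //; by rewrite ?permn1 ?perm02E ?perm03E.
Qed.

Definition pfterm (R : comNzRingType) (Y : 'M[R]_n) (s : 'S_n) : R :=
  (-1) ^+ s * \prod_(i < n./2) entn Y (permn s i.*2) (permn s i.*2.+1).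

Lemma half_bound (i : 'I_(m./2)) : (i.+2.*2.+1 < n)%N.
Proof. by move: (ltn_ord i); lia. Qed.

Lemma prod_half (R : comNzRingType) (F : nat -> R) :
  \prod_(i < n./2) F i = F 0%N * F 1%N * \prod_(i < m./2) F i.+2.
Proof.
have -> : n./2 = (m./2).+2 by [].
by rewrite 2!big_ord_recl mulrA.
Qed.

Section SparseMatrix.
Variables (R : comNzRingType) (Y : 'M[R]_n).

Lemma pfterm_sparse (s : 'S_n) :
  (forall a b, (a < b < n)%N -> ~~ pf_pair a b -> entn Y a b = 0) ->
  pf_perm s -> s \notin [:: 1%g; perm02; perm03] -> pfterm Y s = 0.
Proof.
move=> Y0 pfs; apply: contraNeq => nz; apply: pf_perm_pairs => // i lt_i.
apply: contraNT nz => bad; apply/eqP.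
have lt_i' : (i < n./2)%N by move: lt_i m_even; clear; lia.
rewrite /pfterm (bigD1 (Ordinal lt_i')) //= Y0 ?mul0r ?mulr0 //.
have [h1 _] := pf_permP _ pfs; rewrite h1 //=; apply: permn_lt.
by move: lt_i m_even; clear; lia.
Qed.

Let rest := \prod_(i < m./2) entn Y i.+2.*2 i.+2.*2.+1.

Lemma pfterm1 : pfterm Y 1%g = entn Y 0 1 * entn Y 2 3 * rest.
Proof.
rewrite /pfterm odd_perm1 mul1r (prod_half (fun i => entn Y (permn 1 i.*2) (permn 1 i.*2.+1)))
  !permn1; congr (_ * _ * _).
by apply: eq_bigr => i _; rewrite !permn1.
Qed.

Lemma pfterm02 : pfterm Y perm02 = - (entn Y 0 2 * entn Y 1 3 * rest).
Proof.
rewrite /pfterm odd_tperm.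
have -> : inord 1 != inord 2 :> 'I_n by rewrite -val_eqE /= !inordK.
rewrite expr1 mulN1r (prod_half (fun i => entn Y (permn perm02 i.*2) (permn perm02 i.*2.+1)))
  !perm02E //; congr (- (_ * _ * _)).
by apply: eq_bigr => i _; have lt_i := half_bound i; rewrite (perm02E lt_i) (perm02E (ltnW lt_i)).
Qed.

Lemma pfterm03 : pfterm Y perm03 = entn Y 0 3 * entn Y 1 2 * rest.
Proof.
rewrite /pfterm odd_permM !odd_tperm.
have -> : inord 2 != inord 3 :> 'I_n by rewrite -val_eqE /= !inordK.
have -> : inord 1 != inord 3 :> 'I_n by rewrite -val_eqE /= !inordK.
rewrite mul1r (prod_half (fun i => entn Y (permn perm03 i.*2) (permn perm03 i.*2.+1))) !perm03E
  //; congr (_ * _ * _).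
by apply: eq_bigr => i _; have lt_i := half_bound i; rewrite (perm03E lt_i) (perm03E (ltnW lt_i)).
Qed.
End SparseMatrix.

Local Notation K := #|{: altidx n}|.
Local Notation S := {mpoly int[K]}.
Let X := alternating_varmx n.
Let f : S := pfaffian X.

Fact lt01 : ((ord0 : 'I_n, inord 1 : 'I_n).1 < (ord0 : 'I_n, inord 1 : 'I_n).2)%N.
Proof. by rewrite /= inordK. Qed.
Let t0 : altidx n := Sub (ord0, inord 1) lt01.
Definition altk (a b : nat) : 'I_K := enum_rank (insubd t0 (inord a, inord b)).

Lemma altkK a b : (a < b < n)%N -> val (enum_val (altk a b)) = (inord a, inord b).
Proof.
case/andP=> lab lb; rewrite /altk enum_rankK val_insubd /= !inordK ?lab //.
exact: ltn_trans lab lb.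
Qed.

Lemma alt_entry a b : (a < b < n)%N -> entn X a b = 'X_(altk a b).
Proof.
case/andP=> lab lb; have la := ltn_trans lab lb.
rewrite /entn !insubT mxE.
have e : (inord a, inord b) = (Ordinal la, Ordinal lb) :> 'I_n * 'I_n.
  by congr (_, _); apply: val_inj; rewrite /= inordK.
case: insubP => [u _ /= eu|]; last by rewrite /= lab.
congr 'X_(enum_rank _); apply: val_inj; rewrite val_insubd e /= lab; exact: eu.
Qed.

Lemma altk_inj a b a' b' : (a < b < n)%N -> (a' < b' < n)%N ->
  altk a b = altk a' b' -> a = a' /\ b = b'.
Proof.
move=> h h' /(congr1 (fun k => val (enum_val k))); rewrite !altkK //.
case=> /(congr1 val) + /(congr1 val); move: h h'; clear => h h'.
by rewrite /= !inordK //; lia.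
Qed.

(** The default index [t0] is (0, 1), so this also holds for b = 0; hence [l s] in
    [pfaffian_no_lift] lies in row 0 for every permutation s. *)
Lemma altk_first b : (val (enum_val (altk 0 b))).1 = ord0 :> 'I_n.
Proof.
rewrite /altk enum_rankK val_insubd; case: ifP => // _ /=.
by apply: val_inj; rewrite /= inordK.
Qed.

Lemma entn_map (R R' : comNzRingType) (h : {rmorphism R -> R'}) (A : 'M[R]_n) a b :
  entn (map_mx h A) a b = h (entn A a b).
Proof.
rewrite /entn; case: insubP => [u _ _|_]; last by rewrite rmorph0.
by case: insubP => [v _ _|_]; rewrite ?mxE ?rmorph0.
Qed.

Lemma rmorph_pfterm (R R' : comNzRingType) (h : {rmorphism R -> R'}) (A : 'M[R]_n) s :
  h (pfterm A s) = pfterm (map_mx h A) s.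
Proof.
rewrite /pfterm rmorphM rmorphXn rmorphN1 rmorph_prod; congr (_ * _).
by apply: eq_bigr => i _; rewrite entn_map.
Qed.

Lemma pfaffian_map (R R' : comNzRingType) (h : {rmorphism R -> R'}) (A : 'M[R]_n) :
  h (pfaffian A) = pfaffian (map_mx h A).
Proof. by rewrite rmorph_sum; apply: eq_bigr => s _; apply: rmorph_pfterm. Qed.

Lemma sum_pf_perms (V : nmodType) (F : 'S_n -> V) :
  (forall s, s \notin [:: 1%g; perm02; perm03] -> F s = 0) ->
  \sum_s F s = F 1%g + (F perm02 + F perm03).
Proof.
move=> F0; rewrite (bigID (mem [:: 1%g; perm02; perm03])) /=.
rewrite [X in _ + X]big1 ?addr0; last by move=> s; apply: F0.
rewrite -big_uniq /=; last exact: uniq_pf_perms.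
by rewrite !big_cons big_nil addr0.
Qed.

Lemma pfaffian_sparse (R : comNzRingType) (Y : 'M[R]_n) :
  (forall a b, (a < b < n)%N -> ~~ pf_pair a b -> entn Y a b = 0) ->
  pfaffian Y = pfterm Y 1%g + (pfterm Y perm02 + pfterm Y perm03).
Proof.
move=> Y0; rewrite /pfaffian big_mkcond sum_pf_perms.
  by rewrite pf_perm1 pf_perm02 pf_perm03.
by move=> s hs; case: ifP => // pfs; apply: pfterm_sparse.
Qed.

Lemma whomog_pfterm (w : 'I_K -> int) s : pf_perm s ->
  whomog w (\sum_(i < n./2) w (altk (permn s i.*2) (permn s i.*2.+1))) (pfterm X s).
Proof.
move=> /pf_permP[h1 _]; rewrite -[X in whomog _ X]add0r; apply: whomogM.
  by case: (odd_perm s); rewrite ?expr1 ?expr0; [apply/whomogN/whomog1|apply: whomog1].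
apply: whomog_prod => i _; rewrite alt_entry; first exact: whomogXU.
have lt_i : (i.*2.+1 < n)%N by move: (ltn_ord i); lia.
by rewrite h1 ?permn_lt // ltnW.
Qed.

Definition pf_vars : {set 'I_K} := [set altk i.*2 i.*2.+1 | i : 'I_(n./2)].

Lemma pf_vars_inj : injective (fun i : 'I_(n./2) => altk i.*2 i.*2.+1).
Proof.
move=> i j /altk_inj [].
- by rewrite ltnSn; move: (ltn_ord i); lia.
- by rewrite ltnSn; move: (ltn_ord j); lia.
by move=> e _; apply: val_inj; move: e => /=; lia.
Qed.

Lemma pf_homog1 : whomog (fun=> 1) #|pf_vars|%:Z f.
Proof.
rewrite card_imset ?card_ord; last exact: pf_vars_inj.
apply: whomog_sum => s /(@whomog_pfterm (fun=> 1)).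
by rewrite sumr_const card_ord natz.
Qed.

Lemma pf_varsE a b : (a < b < n)%N -> altk a b \in pf_vars -> ~~ odd a /\ b = a.+1.
Proof.
move=> hab /imsetP[i _ /altk_inj []] //.
  by rewrite ltnSn; move: (ltn_ord i); lia.
by move=> -> ->; rewrite odd_double.
Qed.

Lemma pf_diag :
  mmap (@mpolyC K int) (fun k => if k \in pf_vars then 'X_k else 0) f =
  \prod_(k in pf_vars) 'X_k.
Proof.
rewrite /f pfaffian_map; set Y := map_mx _ _.
have eY a b : (a < b < n)%N -> entn Y a b = if altk a b \in pf_vars then 'X_(altk a b) else 0.
  by move=> hab; rewrite entn_map alt_entry //= mmapX mmap1U.
have Y0 a b : (a < b < n)%N -> ~~ (~~ odd a && (b == a.+1)) -> entn Y a b = 0.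
  by move=> hab; rewrite eY //; case: ifP => // /(pf_varsE hab) [-> ->]; rewrite eqxx.
rewrite pfaffian_sparse; last first.
  move=> a b hab bad; apply: Y0 => //; apply: contra bad => /andP[ea /eqP ->].
  by rewrite /pf_pair; move: ea; clear; lia.
rewrite pfterm02 pfterm03 (Y0 0%N 2) // (Y0 0%N 3) // !mul0r oppr0 !addr0.
rewrite pfterm1 -(prod_half (fun i => entn Y i.*2 i.*2.+1)) big_imset /=; last first.
  by move=> i j _ _; apply: pf_vars_inj.
apply: eq_bigr => i _; rewrite eY; last by rewrite ltnSn; move: (ltn_ord i); lia.
by have -> : altk i.*2 i.*2.+1 \in pf_vars by apply/imsetP; exists i.
Qed.

(** A perfect matching uses the index 0 exactly once, so with weight 1 on row 0 every term of the
    Pfaffian has weight 1. *)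
Let iszero (k : 'I_K) := (val (enum_val k)).1 == ord0 :> 'I_n.
Let w (k : 'I_K) : int := (iszero k : nat)%:Z.

Lemma iszero_altk a b : (a < b < n)%N -> iszero (altk a b) = (a == 0)%N.
Proof.
move=> hab; rewrite /iszero altkK // -val_eqE /= inordK //.
by case/andP: hab => /ltn_trans; apply.
Qed.

Lemma pfterm_weight s : pf_perm s -> whomog w 1 (pfterm X s).
Proof.
move=> pfs; have /pf_permP[h1 _] := pfs; have s0 := pf_perm0 pfs.
have lt_i (i : 'I_(n./2)) : (i.*2.+1 < n)%N by move: (ltn_ord i); lia.
have := @whomog_pfterm w s pfs; congr (whomog _ _ _).
have wE (i : 'I_(n./2)) : w (altk (permn s i.*2) (permn s i.*2.+1)) = (permn s i.*2 == 0)%N%:Z.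
  by rewrite /w iszero_altk // h1 ?permn_lt // ltnW.
rewrite (eq_bigr _ (fun i _ => wE i)) (bigD1 (Ordinal (isT : 0 < n./2)%N)) //= s0 eqxx.
rewrite big1 // => i; rewrite -val_eqE /= => i0; case: eqP => // e.
have := @permn_inj s _ 0%N (ltnW (lt_i i)) isT (etrans e (esym s0)).
by move/eqP; rewrite double_eq0 (negPf i0).
Qed.

Lemma altk_surj k : exists a b, (a < b < n)%N /\ k = altk a b.
Proof.
have := valP (enum_val k); case e : (val (enum_val k)) => [a b] /= lab.
exists a, b; split; first by rewrite lab ltn_ord.
by rewrite /altk !inord_val -e valKd enum_valK.
Qed.

(** Row 0 is kept as a whole, truncated at Q, so that the high powers of the [t k] vanish and low
    powers do not. The other variables kept are truncated at p, and the entries (4, 5), (6, 7), ...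
    become 1. *)
Lemma pf_specialization p Q : prime p -> (0 < Q)%N ->
  exists (B : comPzRingType) (h : {rmorphism S -> B}) (g : {rmorphism S -> S})
    (y : 'I_K -> B),
  [/\ p%:R = 0 :> B, forall k, h 'X_k = y k,
      forall k, y k ^+ (if iszero k then Q else p) = 0,
      \prod_k y k ^+ (if iszero k then Q.-1 else p.-1) <> 0 &
      forall a b, (a < b < n)%N ->
        g (entn X a b) = if pf_pair a b then (if (4 <= a)%N then 1 else 'X_(altk a b)) else 0].
Proof.
move=> p_pr Q_gt0; pose mm : 'X_{1..K} := [multinom if iszero k then Q.-1 else p.-1 | k < K].
pose s (k : 'I_K) : S := let: (a, b) := val (enum_val k) in
  if pf_pair a b then (if (4 <= a)%N then 1 else 'X_k) else 0.
exists (rquot (mono_gens p mm)), (qproj (mono_gens p mm)), (mmap intr s).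
exists (fun k => qproj (mono_gens p mm) 'X_k); split.
- exact: mono_quot_p.
- by [].
- move=> k; have := mono_quot_X p mm k; rewrite mnmE.
  by case: (iszero k); rewrite prednK // prime_gt0.
- move=> e; apply: (@mono_top_neq0 _ p mm p_pr); rewrite -[RHS]e.
  by apply: eq_bigr => k _; rewrite mnmE.
move=> a b hab; rewrite alt_entry //= mmapX mmap1U /s altkK //.
have [lab lb] := andP hab; have la := ltn_trans lab lb.
by rewrite !inordK.
Qed.

Lemma pfaffian_no_lift p : prime p ->
  let I1 := [:: f; p%:R] in let I2 := [:: f; (p ^ 2)%N%:R] in
  ~ lifts_to I2 I1 (frob_trace f p) /\ ~ lifts_to [:: f] I1 (frob_trace f p).
Proof.
move=> p_pr I1 I2; pose t (k : 'I_K) : S := if iszero k then 'X_k else 1.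
pose l (s : 'S_n) : 'I_K := altk 0 (permn s 1).
pose v (s : 'S_n) : S := if pf_perm s then
  (-1) ^+ s * \prod_(i < (m./2).+1) entn X (permn s i.+1.*2) (permn s i.+1.*2.+1) else 0.
pose T s := t (l s) * v s.
have iszl s : iszero (l s) by apply/eqP/altk_first.
have TE s : T s = if pf_perm s then pfterm X s else 0.
  rewrite /T /t iszl /v; case: ifP => pfs; last by rewrite mulr0.
  have s0 := pf_perm0 pfs; have /pf_permP[/(_ 0%N isT) h1 _] := pfs.
  rewrite /pfterm [in RHS]big_ord_recl /= mulrCA; congr (_ * _).
  by rewrite s0 in h1 *; rewrite alt_entry //= h1 permn_lt.
(* The three terms that survive the specialization come first, so that the nested defect collapses
   to two [frobW]. *)
pose r := [:: 1%g; perm02; perm03] ++ [seq s <- enum 'S_n | s \notin [:: 1%g; perm02; perm03]].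
have sumr (V : nmodType) (F : 'S_n -> V) : \sum_s F s = \sum_(s <- r) F s.
  rewrite -big_enum; apply: perm_big; apply: uniq_perm; first exact: enum_uniq.
    rewrite cat_uniq uniq_pf_perms filter_uniq ?enum_uniq // andbT.
    by apply/hasPn => s; rewrite mem_filter => /andP[].
  have en (s : 'S_n) : s \in enum 'S_n by rewrite mem_enum.
  by move=> s; transitivity true; [exact: en|rewrite mem_cat mem_filter en andbT orbN].
pose D := fdefect p [seq T s | s <- r].
refine (@no_lift_by_weight _ p pf_vars f p_pr pf_homog1 pf_diag
          w 1 (1 *+ p) _ _ t l v D _ _ _ _).
- by apply: whomog_sum => s; apply: pfterm_weight.
- apply: whomog_fdefect => x /mapP[s _ ->]; rewrite TE; case: ifP => [|_].
    exact: pfterm_weight.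
  exact: whomog0.
- have fE : f = \sum_(s <- r) T s.
    by rewrite -sumr (eq_bigr _ (fun s _ => TE s)) -big_mkcond.
  have -> : \sum_s (t (l s) * v s) ^+ p + p%:R * D = f ^+ p.
    by rewrite fE sumr /D -(big_map T xpredT id) fdefectE // big_map.
  rewrite -(prednK (prime_gt0 p_pr)) exprS.
  by rewrite gen_idealMr // mem_gen // inE eqxx.
case=> q [g [a0 [b0 [e [E Pe]]]]].
pose Q := (p * q.+1)%N; have Q_gt0 : (0 < Q)%N by rewrite muln_gt0 prime_gt0.
have [B [h0 [g0 [y [p0 h0X y0 top gX]]]]] := pf_specialization p_pr Q_gt0.
apply: top.
pose h : {rmorphism S -> B} := h0 \o g0.
have hX a b : (a < b < n)%N ->
    h (entn X a b) = if pf_pair a b then (if (4 <= a)%N then 1 else y (altk a b)) else 0.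
  move=> hab; rewrite /h /= gX //; case: ifP => _; last exact: rmorph0.
  by case: ifP => _; [apply: rmorph1|rewrite h0X].
set T0 := h (\prod_k t k ^+ q) ^+ p.
have ht k : h (t k) = if iszero k then y k else 1.
  rewrite /t; case: ifP => zk; last exact: rmorph1.
  have [a [b [hab ek]]] := altk_surj k; have := zk.
  rewrite {1}ek iszero_altk // => /eqP a0'; move: hab ek; rewrite a0' => hab ->.
  by rewrite -alt_entry // hX.
have T0E : T0 = \prod_k (if iszero k then y k else 1) ^+ (p * q).
  rewrite /T0 rmorph_prod -prodrXl; apply: eq_bigr => k _.
  by rewrite rmorphXn -exprM mulnC ht.
have he : T0 * h e = 0.
  apply: (Pe (fun x => T0 * h x = 0)).
  - by rewrite rmorph0 mulr0.
  - by move=> x z hx hz; rewrite rmorphD mulrDr hx hz addr0.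
  - by move=> x; rewrite rmorphM rmorph_nat p0 mul0r mulr0.
  move=> z m' wm; apply: (@pth_power_killed _ w).
    suff -> : wt w m' = 1 by [].
    by apply/eqP; rewrite -(eqr_pMn2r (prime_gt0 p_pr)) wm.
  move=> k; rewrite /w; case zk: (iszero k) => // _.
  have hk : h 'X_k = y k by have := ht k; rewrite /t zk.
  rewrite T0E hk (bigD1 k) //= zk mulrAC -exprD.
  have := y0 k; rewrite zk /Q mulnS addnC => ->; exact: mul0r.
have := congr1 h E; rewrite !rmorphD !rmorphM rmorph_nat p0 mul0r addr0 rmorphXn -/T0.
have -> : h (\sum_j t (l j) ^+ (p * q.+1) * g j) = 0.
  rewrite rmorph_sum big1 // => j _; rewrite rmorphM rmorphXn ht iszl.
  by have := y0 (l j); rewrite iszl => ->; rewrite mul0r.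
rewrite addr0 rmorphB mulrBr he subr0.
pose Y := map_mx g0 X; have eY a b : (a < b < n)%N -> entn Y a b =
    if pf_pair a b then (if (4 <= a)%N then 1 else 'X_(altk a b)) else 0.
  by move=> hab; rewrite entn_map gX.
have Y0 a b : (a < b < n)%N -> ~~ pf_pair a b -> entn Y a b = 0.
  by move=> hab /negPf bad; rewrite eY // bad.
have rest1 : \prod_(i < m./2) entn Y i.+2.*2 i.+2.*2.+1 = 1.
  rewrite big1 // => i _; rewrite eY; last by rewrite ltnSn half_bound.
  have -> : pf_pair i.+2.*2 i.+2.*2.+1 by rewrite /pf_pair; clear; lia.
  by have -> : (4 <= i.+2.*2)%N by clear; lia.
have Y1 : h0 (pfterm Y 1%g) = y (altk 2 3) * y (altk 0 1).
  by rewrite pfterm1 rest1 mulr1 !eY //= rmorphM !h0X mulrC.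
have Y2 : h0 (pfterm Y perm02) = - y (altk 1 3) * y (altk 0 2).
  by rewrite pfterm02 rest1 mulr1 !eY //= rmorphN rmorphM !h0X mulrC mulNr.
have Y3 : h0 (pfterm Y perm03) = y (altk 1 2) * y (altk 0 3).
  by rewrite pfterm03 rest1 mulr1 !eY //= rmorphM !h0X mulrC.
have hT s : h (T s) = if pf_perm s then h0 (pfterm Y s) else 0.
  by rewrite TE; case: ifP => _; [rewrite /h /= rmorph_pfterm|exact: rmorph0].
have hf : h f = - y (altk 1 3) * y (altk 0 2) + y (altk 1 2) * y (altk 0 3)
    + y (altk 2 3) * y (altk 0 1).
  have -> : h f = h0 (pfaffian Y) by rewrite /h /= /f pfaffian_map.
  have rD (a b c : S) : h0 (a + (b + c)) = h0 a + (h0 b + h0 c) by rewrite !rmorphD.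
  transitivity (h0 (pfterm Y 1%g) + (h0 (pfterm Y perm02) + h0 (pfterm Y perm03))).
    by rewrite -rD; congr (h0 _); apply: pfaffian_sparse.
  apply: etrans (addrC _ _).
  apply: (congr2 (fun a b : B => a + b) Y1).
  exact: (congr2 (fun a b : B => a + b) Y2 Y3).
have hD : h D = frobW p (- y (altk 1 3) * y (altk 0 2)) (y (altk 1 2) * y (altk 0 3)) +
    frobW p (- y (altk 1 3) * y (altk 0 2) + y (altk 1 2) * y (altk 0 3))
      (y (altk 2 3) * y (altk 0 1)).
  pose z := [seq h (T s) | s <- enum 'S_n & s \notin [:: 1%g; perm02; perm03]].
  have z0 : {in z, forall x, x = 0}.
    move=> x /mapP[s]; rewrite mem_filter => /andP[ns _] ->; rewrite hT.
    by case: ifP => // pfs; rewrite pfterm_sparse // rmorph0.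
  have gen a b c : fdefect p [:: a, b, c & z] = frobW p b c + frobW p (b + c) a.
    rewrite /= (fdefect0 p_pr z0) !big_cons [\sum_(y <- z) y]big_seq big1 //.
    by rewrite !addr0 frobW0 // addr0 frobWC // addrC.
  have hT1 := hT 1%g; have hT2 := hT perm02; have hT3 := hT perm03.
  rewrite pf_perm1 in hT1; rewrite pf_perm02 in hT2; rewrite pf_perm03 in hT3.
  transitivity (fdefect p [:: h (T 1%g), h (T perm02), h (T perm03) & z]).
    by rewrite /D rmorph_fdefect -map_comp map_cat.
  have eqc a b c a' b' c' : a = a' -> b = b' -> c = c' ->
      fdefect p [:: a, b, c & z] = frobW p b' c' + frobW p (b' + c') a'.
    by move=> -> -> ->; apply: gen.
  exact: eqc (etrans hT1 Y1) (etrans hT2 Y2) (etrans hT3 Y3).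
have yp a b : (0 < a < b)%N -> (b < n)%N -> y (altk a b) ^+ p = 0.
  move=> /andP[a0' lab] lb; have := y0 (altk a b).
  by rewrite iszero_altk ?lab //; case: a a0' lab.
rewrite hD hf => rel.
have := pfaffian_top_monomial p_pr p0 _ _ _ rel; rewrite exprNn !yp // mulr0.
move=> /(_ erefl erefl erefl) top0.
(* In row 0, Q - 1 = p q + p - 1, and T0 supplies p q; every variable is left with exponent p -
   1. *)
have -> : \prod_k y k ^+ (if iszero k then Q.-1 else p.-1) = T0 * (\prod_k y k) ^+ p.-1.
  rewrite T0E -prodrXl -big_split; apply: eq_bigr => k _ /=; case: ifP => _.
    by rewrite -exprD; congr (_ ^+ _); rewrite /Q mulnS; have := prime_gt0 p_pr; clear; lia.
  by rewrite expr1n mul1r.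
(* Only six variables occur in the surviving monomial; multiplying by the others, and by a sign,
   reaches the top monomial of the quotient. *)
have [z ->] : exists z, \prod_k y k = - y (altk 1 3) * y (altk 1 2) * y (altk 2 3)
    * y (altk 0 2) * y (altk 0 3) * y (altk 0 1) * z.
  pose L := [:: altk 1 3; altk 1 2; altk 2 3; altk 0 2; altk 0 3; altk 0 1].
  have uL : uniq L.
    have ne a b a' b' : (a < b < n)%N -> (a' < b' < n)%N -> (a, b) != (a', b') ->
        altk a b != altk a' b'.
      by move=> h1 h2; apply: contraNneq => /(altk_inj h1 h2) [-> ->].
    by rewrite /= !inE !negb_or !ne.
  exists (- \prod_(k | k \notin L) y k); rewrite (bigID (mem L)) /= -big_uniq //=.
  by rewrite !big_cons big_nil; ring.
by rewrite exprMn mulrA top0 mul0r.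
Qed.

End PfaffianPermutations.

(** * Symmetric determinants in characteristic two *)

Local Notation K := #|{: symidx 3}|.
Local Notation S := {mpoly int[K]}.

Fact symidx00 : ((ord0 : 'I_3, ord0 : 'I_3).1 <= (ord0 : 'I_3, ord0 : 'I_3).2)%N.
Proof. by []. Qed.

Definition symk (a b : nat) : 'I_K :=
  enum_rank (insubd (Sub (ord0, ord0) symidx00 : symidx 3) (inord a, inord b)).

Lemma symkK a b : (a <= b < 3)%N -> val (enum_val (symk a b)) = (inord a, inord b).
Proof.
case/andP=> lab lb; have la := leq_ltn_trans lab lb.
by rewrite /symk enum_rankK val_insubd /= !inordK ?lab.
Qed.

Lemma sym_entry a b : (a <= b < 3)%N ->
  symmetric_varmx 3 (inord a) (inord b) = 'X_(symk a b) /\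
  symmetric_varmx 3 (inord b) (inord a) = 'X_(symk a b).
Proof.
case/andP=> lab lb; have la := leq_ltn_trans lab lb; rewrite !mxE.
case: insubP => [u _ /= eu|]; last by rewrite /= !inordK // lab.
have e1 : u = insubd (Sub (ord0, ord0) symidx00 : symidx 3) (inord a, inord b).
  by apply: val_inj; rewrite val_insubd /= !inordK // lab.
split; first by rewrite e1.
case: insubP => [u' /= lba eu'|_]; last by rewrite e1.
congr 'X_(enum_rank _); apply: val_inj; rewrite val_insubd /= !inordK // lab eu'.
by move: lba; rewrite /= !inordK // => lba; have -> : a = b by lia.
Qed.

Lemma symk_inj a b a' b' : (a <= b < 3)%N -> (a' <= b' < 3)%N ->
  symk a b = symk a' b' -> (a, b) = (a', b').
Proof.
move=> h h' /(congr1 (fun k => val (enum_val k))); rewrite !symkK //.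
case=> /(congr1 val) + /(congr1 val); rewrite /= !inordK; try by move: h h'; lia.
by move=> -> ->.
Qed.

Lemma symk_surj k : exists a b, (a <= b < 3)%N /\ k = symk a b.
Proof.
have := valP (enum_val k); case e : (val (enum_val k)) => [a b] /= lab.
exists a, b; split; first by rewrite lab ltn_ord.
by rewrite /symk !inord_val -e valKd enum_valK.
Qed.

Definition symks : seq 'I_K := [:: symk 0 0; symk 0 1; symk 0 2; symk 1 1; symk 1 2; symk 2 2].

Lemma uniq_symks : uniq symks.
Proof.
have ne a b a' b' : (a <= b < 3)%N -> (a' <= b' < 3)%N -> (a, b) != (a', b') ->
    symk a b != symk a' b'.
  by move=> h1 h2; apply: contraNneq => /(symk_inj h1 h2) [-> ->].
by rewrite /symks /= !inE !negb_or !ne.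
Qed.

Lemma mem_symks k : k \in symks.
Proof.
have [a [b [hab ->]]] := symk_surj k.
have : [|| [|| (a == 0) && (b == 0), (a == 0) && (b == 1) | (a == 0) && (b == 2)],
  (a == 1) && (b == 1), (a == 1) && (b == 2) | (a == 2) && (b == 2)]%N by lia.
by case/orP => [/or3P[]|/or3P[]] /andP[/eqP -> /eqP ->]; rewrite !inE eqxx ?orbT.
Qed.

Lemma big_symks (V : Type) (idx : V) (op : Monoid.com_law idx) (F : 'I_K -> V) :
  \big[op/idx]_k F k = \big[op/idx]_(k <- symks) F k.
Proof.
apply: perm_big; apply: uniq_perm; rewrite ?uniq_symks ?index_enum_uniq // => k.
by rewrite mem_symks mem_index_enum.
Qed.

Lemma forall_symks (P : 'I_K -> Prop) :
  P (symk 0 0) -> P (symk 0 1) -> P (symk 0 2) -> P (symk 1 1) -> P (symk 1 2) ->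
  P (symk 2 2) -> forall k, P k.
Proof.
move=> p0 p1 p2 p3 p4 p5 k; have := mem_symks k; rewrite !inE.
by do 5!(case/orP => [/eqP -> //|]); move/eqP ->.
Qed.

Lemma det_sym3 :
  let x a b : S := 'X_(symk a b) in
  \det (symmetric_varmx 3) = x 0 0 * x 1 1 * x 2 2 - x 0 0 * x 1 2 ^+ 2
    - x 1 1 * x 0 2 ^+ 2 - x 2 2 * x 0 1 ^+ 2 + 2%:R * (x 0 1 * x 0 2 * x 1 2).
Proof.
move=> x; rewrite det_mx33.
have [e00 _] := @sym_entry 0 0 isT; have [e01 e10] := @sym_entry 0 1 isT.
have [e02 e20] := @sym_entry 0 2 isT; have [e11 _] := @sym_entry 1 1 isT.
have [e12 e21] := @sym_entry 1 2 isT; have [e22 _] := @sym_entry 2 2 isT.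
rewrite e00 e01 e10 e02 e20 e11 e12 e21 e22 -!/(x _ _).
by move: (x 0 0) (x 0 1) (x 0 2) (x 1 1) (x 1 2) (x 2 2) => x00 x01 x02 x11 x12 x22; ring.
Qed.

Lemma rmorph_det_sym3 (R : comPzRingType) (h : {rmorphism S -> R}) :
  let x a b := h 'X_(symk a b) in
  h (\det (symmetric_varmx 3)) = x 0 0 * x 1 1 * x 2 2 - x 0 0 * x 1 2 ^+ 2
    - x 1 1 * x 0 2 ^+ 2 - x 2 2 * x 0 1 ^+ 2 + 2%:R * (x 0 1 * x 0 2 * x 1 2).
Proof.
move=> x; rewrite det_sym3 rmorphD !rmorphB [h (2%:R * _)]rmorphM [h 2%:R]rmorph_nat.
by rewrite !(rmorphXn, rmorphM).
Qed.

(** The second elementary symmetric function of adg, -ae^2, -dc^2, -gb^2, the terms of f other than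
    2bce. *)
Definition sym2_defect (R : comPzRingType) (a b c d e g : R) :=
  - (a * d * g * (a * e ^+ 2 + d * c ^+ 2 + g * b ^+ 2))
  + (a * e ^+ 2 * (d * c ^+ 2 + g * b ^+ 2) + d * c ^+ 2 * (g * b ^+ 2)).

Lemma rmorph_sym2_defect (R R' : comPzRingType) (h : {rmorphism R -> R'}) a b c d e g :
  h (sym2_defect a b c d e g) = sym2_defect (h a) (h b) (h c) (h d) (h e) (h g).
Proof. by rewrite /sym2_defect !(rmorphD, rmorphN, rmorphXn, rmorphM). Qed.

Section SymmetricTopMonomial.
Variables (B : comPzRingType) (q : nat) (a b c d e g : B).
Local Notation Q := (2 * q.+1)%N.
Hypotheses (B2 : 2%:R = 0 :> B) (aQ : a ^+ Q = 0) (bQ : b ^+ (2 * Q) = 0) (dQ : d ^+ Q = 0).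
Hypotheses (c5 : c ^+ 5 = 0) (e5 : e ^+ 5 = 0) (g2 : g ^+ 2 = 0).
Let T := (a * b ^+ 2 * d) ^+ (2 * q).
Let Om := sym2_omega a b c d e g.

Let TE : T = a ^+ (2 * q) * b ^+ (2 * (2 * q)) * d ^+ (2 * q).
Proof. by rewrite /T exprMn [(a * _) ^+ _]exprMn -exprM. Qed.

Let Ta : T * a ^+ 2 = 0.
Proof.
rewrite TE; move: (b ^+ _) (d ^+ _) => u v.
have : a ^+ (2 * q) * a ^+ 2 = 0 by rewrite -exprD addnC -mulnS.
by move: (a ^+ _) => x e0; transitivity (x * a ^+ 2 * (u * v)); [ring|rewrite e0 mul0r].
Qed.

Let Td : T * d ^+ 2 = 0.
Proof.
rewrite TE; move: (a ^+ _) (b ^+ _) => u v.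
have : d ^+ (2 * q) * d ^+ 2 = 0 by rewrite -exprD addnC -mulnS.
by move: (d ^+ _) => x e0; transitivity (x * d ^+ 2 * (u * v)); [ring|rewrite e0 mul0r].
Qed.

Let Tb : T * b ^+ 4 = 0.
Proof.
rewrite TE; move: (a ^+ _) (d ^+ _) => u v.
have : b ^+ (2 * (2 * q)) * b ^+ 4 = 0.
  by rewrite -exprD -[RHS]bQ; congr (_ ^+ _); lia.
by move: (b ^+ _) => x e0; transitivity (x * b ^+ 4 * (u * v)); [ring|rewrite e0 mul0r].
Qed.

(** Here weight alone is not enough. T and g^2 = 0 remove a, d, g and higher powers of b; what is
    left has few factors b, and then c and e occur often enough for c^5 or e^5 to appear, with the
    help of Omega when b occurs once. *)
Lemma sym2_weight_kill ma mb mc md me mg :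
  (20 * (ma + mb + md) + mc + me = 22 + 18 * mg)%N ->
  T * Om * (a ^+ ma * b ^+ mb * c ^+ mc * d ^+ md * e ^+ me * g ^+ mg) ^+ 2 = 0.
Proof.
move=> wE; rewrite !exprMn -!exprM.
have nil (x : B) n k : (n <= k)%N -> x ^+ n = 0 -> x ^+ k = 0.
  by move=> /subnKC <- x0; rewrite exprD x0 mul0r.
case: ma wE => [|ma] wE; last first.
  rewrite mulSn exprD; move: (a ^+ (ma * 2)) (b ^+ _) (c ^+ _) (d ^+ _) (e ^+ _) (g ^+ _) => x1
    x2 x3 x4 x5 x6.
  by transitivity (T * a ^+ 2 * (Om * x1 * x2 * x3 * x4 * x5 * x6)); [ring|rewrite Ta mul0r].
case: md wE => [|md] wE; last first.
  rewrite mulSn exprD; move: (a ^+ _) (b ^+ _) (c ^+ _) (e ^+ _) (g ^+ _) => x1 x2 x3 x5 x6.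
  move: (d ^+ (md * 2)) => x4.
  by transitivity (T * d ^+ 2 * (Om * x1 * x2 * x3 * x4 * x5 * x6)); [ring|rewrite Td mul0r].
case: mg wE => [|mg] wE; last first.
  rewrite [X in g ^+ X]mulSn exprD g2 mul0r !mulr0; reflexivity.
case: mb wE => [|[|mb]] wE; last first.
- rewrite [X in b ^+ X](_ : _ = (4 + mb * 2)%N); last by lia.
  rewrite exprD; move: (a ^+ _) (b ^+ (mb * 2)) (c ^+ _) (d ^+ _) (e ^+ _) (g ^+ _) => x1 x2 x3
    x4 x5 x6.
  by transitivity (T * b ^+ 4 * (Om * x1 * x2 * x3 * x4 * x5 * x6)); [ring|rewrite Tb mul0r].
(* One factor b: after squaring, T kills most of Omega b^2, and the rest contains c^2 e^2 (a e^2 + d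
   c^2), which two more factors c or e bring to c^5 or e^5. *)
- have E : T * Om * b ^+ 2 = T * (b ^+ 3 * (c ^+ 2 * e ^+ 2 * (a * e ^+ 2 + d * c ^+ 2))).
    transitivity (T * (b ^+ 3 * (c ^+ 2 * e ^+ 2 * (a * e ^+ 2 + d * c ^+ 2)))
      + T * a ^+ 2 * (b ^+ 3 * g * e ^+ 4) + T * d ^+ 2 * (b ^+ 3 * g * c ^+ 4)
      + 2%:R * (T * b ^+ 3 * g * a * d * e ^+ 2 * c ^+ 2) + T * b ^+ 4 * (b * c ^+ 2 * e ^+ 2 *
        g)).
      by rewrite /Om /sym2_omega; ring.
    by rewrite Ta Td Tb B2 !mul0r !addr0.
  have : [|| (mc == 2) && (me == 0), (mc == 1) && (me == 1) | (mc == 0) && (me == 2)]%N by lia.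
  rewrite !mul0n !expr0 !mul1n !mulr1 !mul1r mulrA; rewrite mulrA E => /or3P[] /andP[/eqP ->
    /eqP ->].
  + transitivity (T * b ^+ 3 * (c ^+ 5 * (c * e ^+ 4 * a + c ^+ 3 * e ^+ 2 * d))); first by ring.
    by rewrite c5 mul0r mulr0.
  + transitivity (T * b ^+ 3 * (c ^+ 5 * (c * e ^+ 4 * d) + e ^+ 5 * (c ^+ 4 * e * a))); first
    by ring.
    by rewrite c5 e5 !mul0r addr0 mulr0.
  + transitivity (T * b ^+ 3 * (e ^+ 5 * (e ^+ 3 * c ^+ 2 * a + e * c ^+ 4 * d))); first by ring.
    by rewrite e5 mul0r mulr0.
(* No factor b: c and e occur 22 times in all, so one of them at least 3 times, and its square has
   exponent above 5. *)
have [c0|e0] : c ^+ (mc * 2) = 0 \/ e ^+ (me * 2) = 0.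
  case: (leqP 3 mc) => h3; [left; apply: nil c5|right; apply: nil e5]; lia.
  by rewrite c0 !(mulr0, mul0r).
by rewrite e0 !(mulr0, mul0r).
Qed.

Lemma sym2_top_vanish h :
  T * sym2_defect a b c d e g * Om =
    (a * d * g - a * e ^+ 2 - d * c ^+ 2 - g * b ^+ 2 + 2%:R * (b * c * e)) * h * Om ->
  a ^+ Q.-1 * b ^+ (2 * Q).-1 * c ^+ 4 * d ^+ Q.-1 * e ^+ 4 * g = 0.
Proof.
have N2 : -1 = 1 :> B by apply/eqP; rewrite -subr_eq0 -opprD oppr_eq0 -[1 + 1]/(2%:R) B2.
have sym (x : B) : - x = x by rewrite -mulN1r N2 mul1r.
rewrite /sym2_defect !sym B2 mul0r addr0 addrA => rel.
have := @sym2_omega_defect B a b c d e g B2 c5 e5 g2 T Ta; rewrite -/Om.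
have := sym2_omega_det a b d B2 c5 e5 g2; rewrite -/Om => Om0.
have -> : forall x, T * Om * x = T * x * Om by move=> x; ring.
rewrite rel.
have -> : (a * d * g + a * e ^+ 2 + d * c ^+ 2 + g * b ^+ 2) * h * Om =
  Om * (a * d * g + a * e ^+ 2 + d * c ^+ 2 + g * b ^+ 2) * h by ring.
rewrite Om0 mul0r => /esym; rewrite TE.
have -> : Q.-1 = (2 * q).+1 by lia.
have -> : (2 * Q).-1 = (2 * (2 * q) + 3)%N by lia.
rewrite exprD !exprS; move: (a ^+ _) (d ^+ (2 * q)) (b ^+ (2 * _)) => x y z <-; ring.
Qed.
End SymmetricTopMonomial.

Section SymmetricCharacteristicTwo.
Let f : S := \det (symmetric_varmx 3).
Let ka := symk 0 0. Let kb := symk 0 1. Let kc := symk 0 2.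
Let kd := symk 1 1. Let ke := symk 1 2. Let kg := symk 2 2.

Definition sym_select (V : Type) (a b c d e g : V) (k : 'I_K) : V :=
  nth a [:: a; b; c; d; e; g] (index k symks).

Lemma sym_selectE (V : Type) (a b c d e g : V) (F := sym_select a b c d e g) :
  [/\ F ka = a, F kb = b & F kc = c] /\ [/\ F kd = d, F ke = e & F kg = g].
Proof.
have h i : (i < 6)%N -> F (nth ka symks i) = nth a [:: a; b; c; d; e; g] i.
  by move=> lt_i; rewrite /F /sym_select index_uniq // uniq_symks.
split; split; [exact: (h 0%N)|exact: (h 1%N)|exact: (h 2)|exact: (h 3)|exact: (h 4)|exact: (h 5)].
Qed.

Let A : {set 'I_K} := [set ka; kd; kg].
(** All terms of f are homogeneous of weight N + 2 whenever a, b, d have weight N, c and e weight 1,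
    and g weight 2 - N. With N = 20 a monomial of that weight contains a, b or d, or else many
    factors c and e. *)
Let w : 'I_K -> int := sym_select 20 20 1 20 1 (- 18%:Z).

Lemma card_symA : #|A| = 3.
Proof.
have ne a b : (a < b < 3)%N -> symk a a != symk b b.
  move=> h; apply/eqP => /symk_inj; rewrite !leqnn => /(_ _ _)/wrap[||[]]; lia.
by rewrite /A -setUA !cardsU1 cards1 !inE negb_or !ne.
Qed.

Lemma wt_sym (m : 'X_{1..K}) : wt w m =
  (m ka)%:Z * 20 + (m kb)%:Z * 20 + (m kc)%:Z + (m kd)%:Z * 20 + (m ke)%:Z - (m kg)%:Z * 18.
Proof.
have [[wa wb wc] [wd we wg]] := sym_selectE (20 : int) 20 1 20 1 (- 18%:Z).
rewrite /wt big_symks !big_cons big_nil -/ka -/kb -/kc -/kd -/ke -/kg /w wa wb wc wd we wg.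
by rewrite /= !mulr1 mulrN addr0 !addrA.
Qed.

Lemma wt_symU : [/\ w ka = 20, w kb = 20 & w kc = 1] /\ [/\ w kd = 20, w ke = 1 & w kg = - 18%:Z].
Proof. exact: sym_selectE. Qed.

Local Notation xa := ('X_ka : S). Local Notation xb := ('X_kb : S).
Local Notation xc := ('X_kc : S). Local Notation xd := ('X_kd : S).
Local Notation xe := ('X_ke : S). Local Notation xg := ('X_kg : S).

Lemma sym_homog (w' : 'I_K -> int) (d : int) :
  w' ka + w' kd + w' kg = d -> w' ka + w' ke *+ 2 = d -> w' kd + w' kc *+ 2 = d ->
  w' kg + w' kb *+ 2 = d -> w' kb + w' kc + w' ke = d ->
  [/\ whomog w' d (xa * xd * xg), whomog w' d (xa * xe ^+ 2), whomog w' d (xd * xc ^+ 2),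
      whomog w' d (xg * xb ^+ 2) & whomog w' d f].
Proof.
move=> h1 h2 h3 h4 h5; have hX k : whomog w' (w' k) 'X_k := @whomogXU _ int w' k.
have g1 : whomog w' d (xa * xd * xg) by rewrite -h1; apply: whomogM => //; apply: whomogM.
have g2 : whomog w' d (xa * xe ^+ 2) by rewrite -h2; apply: whomogM => //; apply: whomogXn.
have g3 : whomog w' d (xd * xc ^+ 2) by rewrite -h3; apply: whomogM => //; apply: whomogXn.
have g4 : whomog w' d (xg * xb ^+ 2) by rewrite -h4; apply: whomogM => //; apply: whomogXn.
split=> //; rewrite /f det_sym3; apply: whomogD.
  apply: whomogD; last exact: whomogN.
  apply: whomogD; last exact: whomogN.
  by apply: whomogD; last exact: whomogN.
rewrite -[d]add0r; apply: whomogM; first exact: whomog_nat.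
by rewrite -h5; apply: whomogM => //; apply: whomogM.
Qed.

Lemma sym_homog1 : whomog (fun=> 1) #|A|%:Z f.
Proof. by rewrite card_symA; have [] := @sym_homog (fun=> 1) 3. Qed.

Lemma sym_diag :
  mmap (@mpolyC K int) (fun k => if k \in A then 'X_k else 0) f = \prod_(k in A) 'X_k.
Proof.
have inA a b : (a <= b < 3)%N -> symk a b \in A = (a == b).
  move=> h; rewrite !inE /ka /kd /kg; apply/idP/eqP => [|e].
    by rewrite -orbA => /or3P[] /eqP/symk_inj => /(_ h isT)[-> ->].
  move: h; rewrite -e leqnn /=; case: a e => [|[|[|]]] // _ _; by rewrite eqxx ?orbT.
rewrite /f rmorph_det_sym3 /= !mmapX !mmap1U !inA //=.
rewrite big_mkcond big_symks !big_cons big_nil !inA //=.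
by move: 'X_ka 'X_kd 'X_kg => x y z; ring.
Qed.

Lemma sym2_no_lift :
  ~ lifts_to [:: f; (2 ^ 2)%N%:R] [:: f; 2%:R] (frob_trace f 2) /\
  ~ lifts_to [:: f] [:: f; 2%:R] (frob_trace f 2).
Proof.
(* Each of adg, ae^2, dc^2, gb^2 contains a, d or b^2. Taking b^2 as a unit doubles the truncation
   exponent of b below. *)
pose t (i : 'I_3) : S := [:: xa; xb ^+ 2; xd]`_i.
pose l (j : 'I_4) : 'I_3 := inord (nth 0%N [:: 0; 0; 2; 1]%N j).
pose v (j : 'I_4) : S := [:: xd * xg; - xe ^+ 2; - xc ^+ 2; - xg]`_j.
pose D : S := sym2_defect xa xb xc xd xe xg.
have [[wa wb wc] [wd we wg]] := wt_symU.
have [h1 h2 h3 h4 hf] : [/\ whomog w 22 (xa * xd * xg), whomog w 22 (xa * xe ^+ 2),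
    whomog w 22 (xd * xc ^+ 2), whomog w 22 (xg * xb ^+ 2) & whomog w 22 f].
  by apply: sym_homog; rewrite ?wa ?wb ?wc ?wd ?we ?wg.
refine (@no_lift_by_weight _ 2 A f isT sym_homog1 sym_diag
          w 22 (22 + 22) _ _ t l v D hf _ _ _).
- apply: whomogD; first by apply/whomogN/(whomogM h1)/whomogD => //; apply: whomogD.
  apply: whomogD (whomogM h3 h4); apply: (whomogM h2); exact: whomogD.
(* The left side is (f - 2bce)^2; the term 2bce contributes only multiples of 4. *)
- have -> : \sum_j (t (l j) * v j) ^+ 2 + 2%:R * D =
      f * f + 4%:R * (xb * xc * xe * (xb * xc * xe - f)).
    rewrite !big_ord_recl big_ord0 /t /v /l /= !inordK //= /f det_sym3 /D /sym2_defect.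
    rewrite -/ka -/kb -/kc -/kd -/ke -/kg.
    by move: 'X_ka 'X_kb 'X_kc 'X_kd 'X_ke 'X_kg => a b c d e g; ring.
  apply: rpredD; apply: gen_idealMr; apply: mem_gen; rewrite !inE ?eqxx ?orbT //.
case=> q [g [a0 [b0 [e [E Pe]]]]].
(* The exponents are those of the monomial that survives in [sym2_top_vanish]. *)
pose Q := (2 * q.+1)%N; pose mf := sym_select Q.-1 (2 * Q).-1 4 Q.-1 4 1.
have [[ma mb mc] [md me mg]] := sym_selectE Q.-1 (2 * Q).-1 4 Q.-1 4 1.
pose mm : 'X_{1..K} := [multinom mf k | k < K].
pose h : {rmorphism S -> _} := qproj (mono_gens 2 mm).
have top := @mono_top_neq0 _ 2 mm isT; have p0 : 2%:R = 0 :> rquot (mono_gens 2 mm).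
  exact: mono_quot_p.
have y0 k : h 'X_k ^+ (mf k).+1 = 0 by have := mono_quot_X 2 mm k; rewrite mnmE.
have [a [ea aQ]] : exists a, h xa = a /\ a ^+ Q = 0.
  by exists (h xa); split=> //; have := y0 ka; rewrite /mf ma.
have [b [eb bQ]] : exists b, h xb = b /\ b ^+ (2 * Q) = 0.
  by exists (h xb); split=> //; have := y0 kb; rewrite /mf mb.
have [c [ec c5]] : exists c, h xc = c /\ c ^+ 5 = 0.
  by exists (h xc); split=> //; have := y0 kc; rewrite /mf mc.
have [d [ed dQ]] : exists d, h xd = d /\ d ^+ Q = 0.
  by exists (h xd); split=> //; have := y0 kd; rewrite /mf md.
have [e' [ee e5]] : exists e', h xe = e' /\ e' ^+ 5 = 0.
  by exists (h xe); split=> //; have := y0 ke; rewrite /mf me.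
have [g' [eg g2]] : exists g', h xg = g' /\ g' ^+ 2 = 0.
  by exists (h xg); split=> //; have := y0 kg; rewrite /mf mg.
apply: top; transitivity (a ^+ Q.-1 * b ^+ (2 * Q).-1 * c ^+ 4 * d ^+ Q.-1 * e' ^+ 4 * g').
  rewrite (eq_bigr (fun k => h 'X_k ^+ mf k)); last by move=> k _; rewrite mnmE.
  rewrite big_symks !big_cons big_nil -/ka -/kb -/kc -/kd -/ke -/kg.
  by rewrite /mf ma mb mc md me mg ea eb ec ed ee eg /= mulr1 expr1 !mulrA.
pose T := (a * b ^+ 2 * d) ^+ (2 * q); pose Om := sym2_omega a b c d e' g'.
have he : T * Om * h e = 0.
  apply: (Pe (fun x => T * Om * h x = 0)).
  - by rewrite rmorph0 mulr0.
  - by move=> x z hx hz; rewrite rmorphD mulrDr hx hz addr0.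
  - by move=> x; rewrite rmorphM rmorph_nat p0 mul0r mulr0.
  move=> z m wm; have {}wm : wt w m = 22 by lia.
  rewrite -mul_mpolyC rmorphM -[X in _ * h X]mpolyXn rmorphXn.
  transitivity (h z%:MP * (T * Om * (a ^+ m ka * b ^+ m kb * c ^+ m kc * d ^+ m kd * e' ^+ m ke
    * g' ^+ m kg) ^+ 2)).
    rewrite mpolyXE_id rmorph_prod big_symks !big_cons big_nil -/ka -/kb -/kc -/kd -/ke -/kg.
    rewrite !rmorphXn ea eb ec ed ee eg /=; rewrite [LHS]mulrCA; congr (_ * (_ * _ ^+ 2)).
    by rewrite mulr1 !mulrA.
  rewrite sym2_weight_kill ?mulr0 //; move: wm; rewrite wt_sym; lia.
have ht j : h (t (l j)) ^+ (2 * q.+1) = 0.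
  rewrite /t; move: (l j) => {}j; case: j => -[|[|[|//]]] /= _.
  - by rewrite ea.
  - by rewrite rmorphXn eb -exprM.
  - by rewrite ed.
have expand (u x y z0 z1 : S) : u ^+ 2 * x = f * y + 2%:R * z0 + z1 ->
    h u ^+ 2 * h x = h f * h y + h z1.
  by move=> /(congr1 h); rewrite !rmorphD !rmorphM rmorph_nat p0 mul0r addr0.
have := expand _ _ _ _ _ E.
have -> : h (\sum_j t (l j) ^+ (2 * q.+1) * g j) = 0.
  by rewrite rmorph_sum big1 // => j _; rewrite rmorphM rmorphXn ht mul0r.
have -> : h (\prod_i t i ^+ q) ^+ 2 = T.
  rewrite rmorph_prod !big_ord_recl big_ord0 !rmorphXn /t /= ea ed eb.
  by rewrite mulr1 /T mulnC exprM; congr (_ ^+ _); rewrite !exprMn; ring.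
rewrite addr0 rmorphB mulrBr => rel.
refine (@sym2_top_vanish _ q a b c d e' g' p0 aQ c5 e5 g2 (h a0) _).
rewrite -/T -/Om; have := congr1 (fun x => x * Om) rel.
rewrite mulrBl [T * h e * Om]mulrAC he subr0 /f rmorph_det_sym3 -/ka -/kb -/kc -/kd -/ke -/kg.
rewrite ea eb ec ed ee eg => <-; congr (_ * _ * _).
by rewrite /D rmorph_sym2_defect ea eb ec ed ee eg.
Qed.
End SymmetricCharacteristicTwo.

(** * The parametrization x_ij = u_i v_j + u_j v_i of the symmetric hypersurface *)

Definition dvr (A : comNzRingType) (h x : A) := exists y, x = h * y.
(** The element c is a nonzerodivisor modulo h. *)
Definition regm (A : comNzRingType) (h c : A) := forall z, dvr h (c * z) -> dvr h z.

Section RegularElements.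
Variable A : comNzRingType.
Implicit Types (h c x y : A).

Lemma dvrD h x y : dvr h x -> dvr h y -> dvr h (x + y).
Proof. by move=> [x' ->] [y' ->]; exists (x' + y'); rewrite mulrDr. Qed.

Lemma dvrB h x y : dvr h x -> dvr h y -> dvr h (x - y).
Proof. by move=> [x' ->] [y' ->]; exists (x' - y'); rewrite mulrBr. Qed.

Lemma dvrMl h x y : dvr h x -> dvr h (y * x).
Proof. by move=> [x' ->]; exists (y * x'); rewrite mulrCA. Qed.

Lemma dvr_mul h x : dvr h (h * x). Proof. by exists x. Qed.

Lemma regm1 h : regm h 1. Proof. by move=> z; rewrite mul1r. Qed.

Lemma regmN h c : regm h c -> regm h (- c).
Proof. by move=> hc z; rewrite mulNr -mulrN => /hc [y e]; exists (- y); rewrite mulrN -e opprK.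
  Qed.

Lemma regmM h c c' : regm h c -> regm h c' -> regm h (c * c').
Proof. by move=> hc hc' z; rewrite -mulrA => /hc/hc'. Qed.

Lemma regm_mod h c x : regm h c -> regm h (h * x + c).
Proof.
move=> hc z hz; apply: hc; rewrite -[c](addKr (h * x)) mulrDl mulNr addrC -mulrA.
by apply: dvrB => //; apply: dvr_mul.
Qed.

End RegularElements.

Section RegularPolynomials.
Variable A : comNzRingType.
Implicit Types (h c x y : A).

Lemma dvr_coef h (q : {poly A}) : dvr h%:P q -> forall i, dvr h q`_i.
Proof. by move=> [y ->] i; exists y`_i; rewrite coefCM. Qed.

(** Induction on the size of z: h divides the product of the leading coefficients, hence that of z,
    and the leading term of z can be split off. *)
Lemma regm_lead h (P : {poly A}) : regm h (lead_coef P) -> regm h%:P P.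
Proof.
move=> hP z; have [n] := ubnP (size z); elim: n z => // n IHn z lt_z dz.
have [z0|z_neq0] := eqVneq z 0; first by exists 0; rewrite z0 mulr0.
have d_lead : dvr h (lead_coef z) by apply: hP; rewrite mul_lead_coef; apply: dvr_coef.
pose m := (lead_coef z)%:P * 'X ^+ (size z).-1.
have d_m : dvr h%:P m.
  by have [y ey] := d_lead; exists (y%:P * 'X ^+ (size z).-1); rewrite /m ey polyCM mulrA.
suff : dvr h%:P ((z - m) + m) by rewrite subrK.
apply: (dvrD _ d_m); apply: IHn; last first.
  by rewrite mulrBr; apply: (dvrB dz); apply: dvrMl.
have sz : (0 < size z)%N by rewrite size_poly_gt0.
apply: (@leq_ltn_trans (size z).-1); last by rewrite prednK.
apply/leq_sizeP => i le_i.
rewrite coefB coefCM coefXn; have [->|ne] := eqVneq i (size z).-1.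
  by rewrite mulr1 subrr.
rewrite mulr0 subr0 nth_default // -[size z]prednK // ltn_neqAle eq_sym ne.
exact: le_i.
Qed.

Lemma regm_polyC h c : regm h c -> regm h%:P c%:P.
Proof. by move=> hc; apply: regm_lead; rewrite lead_coefC. Qed.
End RegularPolynomials.

(** In a domain a regular sequence of length two may be interchanged. *)
Lemma regm_sym (A : idomainType) (h c : A) : h != 0 -> regm h c -> regm c h.
Proof.
move=> h0 hc z [y e]; have [y' ey] : dvr h y by apply: hc; exists z.
by exists y'; apply: (mulfI h0); rewrite e ey mulrCA.
Qed.

Lemma lead_coef_quadratic (A : idomainType) (x y z : A) : x != 0 ->
  lead_coef (x%:P * 'X ^+ 2 + y%:P * 'X + z%:P) = x.
Proof.
move=> x0; rewrite mul_polyC -addrA lead_coefDl.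
  by rewrite lead_coefZ lead_coefXn mulr1.
rewrite size_scale // size_polyXn size_MXaddC; case: ifP => // _.
by rewrite ltnS size_polyC; case: (_ == 0).
Qed.

Lemma lead_coef_linear (A : idomainType) (x y : A) : x != 0 ->
  size (x%:P * 'X + y%:P) = 2 /\ lead_coef (x%:P * 'X + y%:P) = x.
Proof.
move=> x0; have sX : size (x *: 'X : {poly A}) = 2 by rewrite size_scale // size_polyX.
rewrite mul_polyC size_polyDl ?sX ?ltnS ?size_polyC_leq1 // lead_coefDl ?sX ?ltnS
  ?size_polyC_leq1 //.
by rewrite lead_coefZ lead_coefX mulr1.
Qed.

(* Pseudo-division by h X + f leaves a constant, which L sees; h is then
   cancelled because it is regular modulo h X + f. *)
Lemma linear_kernel (A : idomainType) (h f : A) (W : comNzRingType)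
    (L : {rmorphism {poly A} -> W}) (F := h%:P * 'X + f%:P) :
  h != 0 -> regm h f -> L F = 0 -> (forall r : A, L r%:P = 0 -> r = 0) ->
  forall t, L t = 0 -> dvr F t.
Proof.
move=> h0 hf LF Linj t Lt; have [szF lF] := lead_coef_linear f h0.
have [k [t' et]] : exists k, dvr F (h%:P ^+ k * t).
  have := Pdiv.Idomain.divp_eq t F; set k := scalp t F; set q := (t %/ F)%R.
  have : (size (t %% F)%R < size F)%N by rewrite ltn_modp -size_poly_gt0 szF.
  rewrite szF ltnS => /size1_polyC -> e; exists k, q; move: e.
  rewrite lF -mul_polyC polyC_exp => e; rewrite e mulrC.
  suff -> : (t %% F)`_0 = 0 by rewrite addr0.
  apply: Linj; have := congr1 L e; rewrite rmorphM Lt mulr0 rmorphD rmorphM LF mulr0 add0r.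
  by move/esym.
elim: k t' et => [|k IHk] t' et; first by rewrite expr0 mul1r in et; exists t'.
have [t1 e1] : dvr h%:P t'.
  have hF1 : regm h%:P F by apply/regm_mod/regm_polyC.
  by apply: hF1; rewrite -et exprS -mulrA; apply: dvr_mul.
apply: (IHk t1); have h0' : h%:P != 0 :> {poly A} by rewrite polyC_eq0.
by apply: (mulfI h0'); rewrite mulrA -exprS et e1 mulrCA.
Qed.

Section PolynomialEvaluation.
Variables (A : nzRingType) (B : comNzRingType) (phi : {rmorphism A -> B}) (x : B).

Definition pev (r : {poly A}) : B := (map_poly phi r).[x].

Fact pev_zmod : zmod_morphism pev.
Proof. by move=> r s; rewrite /pev rmorphB hornerD hornerN. Qed.
Fact pev_monoid : monoid_morphism pev.
Proof. by split; [rewrite /pev rmorph1 hornerC|move=> r s; rewrite /pev rmorphM hornerM]. Qed.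
HB.instance Definition _ := GRing.isZmodMorphism.Build {poly A} B pev pev_zmod.
HB.instance Definition _ := GRing.isMonoidMorphism.Build {poly A} B pev pev_monoid.

Lemma pevC c : pev c%:P = phi c. Proof. by rewrite /pev map_polyC hornerC. Qed.
Lemma pevX : pev 'X = x. Proof. by rewrite /pev map_polyX hornerX. Qed.
End PolynomialEvaluation.

Lemma size_gt1 (A : nzRingType) (r : {poly A}) : r`_1 != 0 -> (1 < size r)%N.
Proof. by apply: contraNltn => /leq_sizeP/(_ 1%N (leqnn _)) ->. Qed.

Lemma pev_inj (A W : idomainType) (phi : {rmorphism A -> W}) (x : {poly W}) :
  injective phi -> (1 < size x)%N -> injective (pev (@polyC W \o phi) x).
Proof.
move=> phi_inj sx r s.
have e t : pev (@polyC W \o phi) x t = map_poly phi t \Po x.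
  by rewrite /pev /comp_poly; congr (_.[x]); apply/polyP => i; rewrite !coef_map.
rewrite !e => /eqP; rewrite -subr_eq0 -raddfB comp_poly_eq0 // -raddfB.
by move=> /eqP h; apply/eqP; rewrite -subr_eq0; apply/eqP/(map_inj_poly phi_inj (rmorph0 _));
  rewrite h rmorph0.
Qed.

Lemma mpoly_rmorph_ext n (K : nzRingType) (B : comNzRingType)
    (f1 f2 : {rmorphism {mpoly K[n]} -> B}) :
  (forall c, f1 c%:MP = f2 c%:MP) -> (forall i, f1 'X_i = f2 'X_i) -> f1 =1 f2.
Proof.
move=> hC hX s; elim/mpolyind: s => [|c m s _ _ IHs]; first by rewrite !rmorph0.
rewrite !rmorphD IHs -mul_mpolyC !rmorphM hC; congr (_ * _ + _).
rewrite mpolyXE_id !rmorph_prod; apply: eq_bigr => i _.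
by rewrite !rmorphXn hX.
Qed.

Definition det3 (R : comPzRingType) (a b c d e g : R) : R :=
  a * d * g - a * e ^+ 2 - d * c ^+ 2 - g * b ^+ 2 + 2%:R * (b * c * e).

Lemma rmorph_det3 (R R' : comPzRingType) (h : {rmorphism R -> R'}) a b c d e g :
  h (det3 a b c d e g) = det3 (h a) (h b) (h c) (h d) (h e) (h g).
Proof. by rewrite /det3 !(rmorph_nat, rmorphB, rmorphD, rmorphN, rmorphXn, rmorphM). Qed.

Lemma det3_morph (R R' : comPzRingType) (h : {rmorphism R -> R'}) a b c d e g a' b' c' d' e' g' :
  [/\ h a = a', h b = b' & h c = c'] /\ [/\ h d = d', h e = e' & h g = g'] ->
  h (det3 a b c d e g) = det3 a' b' c' d' e' g'.
Proof. by rewrite rmorph_det3 => -[[-> -> ->] [-> -> ->]]. Qed.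

Section PolynomialEvaluationLow.
Variables (A : nzRingType) (B : comNzRingType) (phi : {rmorphism A -> B}) (t : B).

Lemma pev_linear x y : pev phi t (x%:P * 'X + y%:P) = phi x * t + phi y.
Proof. by rewrite rmorphD rmorphM /= !pevC pevX. Qed.

Lemma pev_quadratic x y z :
  pev phi t (x%:P * 'X ^+ 2 + y%:P * 'X + z%:P) = phi x * t ^+ 2 + phi y * t + phi z.
Proof. by rewrite !(rmorphD, rmorphXn, rmorphM) /= !pevC pevX. Qed.
End PolynomialEvaluationLow.

Section DeterminantTower.
Variables (T : idomainType) (a b c : T) (phi : {rmorphism T -> T}).
Hypotheses (a0 : a != 0) (b0 : b != 0) (T2 : 2%:R != 0 :> T) (ab : regm a (b ^+ 2)).
Hypotheses (phi_inj : injective phi) (phi_a : phi a = 2%:R * a) (phi_b : phi b = b) (phi_c : phi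
  c = c).
Local Notation T4 := {poly T}.
Local Notation T5 := {poly {poly T}}.

(** The determinant is linear in g, namely (ad - b^2) g + f with f quadratic in e. Adjoining d, e, g
    one at a time makes these leading coefficients visible. The map [phi] doubles a because x_00 = 2
    u_0 v_0. *)
Definition tower_h : T4 := a%:P * 'X + (- b ^+ 2)%:P.
Definition tower_f : T5 :=
  (- a%:P)%:P * 'X ^+ 2 + (2%:R * b * c)%:P%:P * 'X + (- ((c ^+ 2)%:P * 'X))%:P.

Lemma tower_det : tower_h%:P%:P * 'X + tower_f%:P =
  det3 a%:P%:P%:P b%:P%:P%:P c%:P%:P%:P 'X%:P%:P 'X%:P 'X.
Proof.
rewrite /tower_h /tower_f /det3.
rewrite !(polyC_natr, polyCN, polyC_exp, polyCM, polyCB, polyCD).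
set A := a%:P%:P%:P; set B := b%:P%:P%:P; set C := c%:P%:P%:P; set D := 'X%:P%:P; set E := 'X%:P.
by move: A B C D E ('X : {poly {poly {poly T}}}) => *; ring.
Qed.

Lemma regm_tower_h : regm tower_h a%:P.
Proof.
apply: regm_sym; first by rewrite polyC_eq0.
by apply: regm_mod; apply: regm_polyC; apply: regmN.
Qed.

(** In e the leading coefficient is -a, which is regular modulo ad - b^2 because b^2 is regular
    modulo a. *)
Lemma regm_tower_f : regm tower_h%:P tower_f.
Proof.
apply: regm_lead; rewrite lead_coef_quadratic; first exact/regmN/regm_tower_h.
by rewrite oppr_eq0 polyC_eq0.
Qed.

Lemma tower_h_neq0 : tower_h%:P != 0 :> T5.
Proof.
by rewrite polyC_eq0 -lead_coef_eq0; have [_ ->] := lead_coef_linear (- b ^+ 2) a0.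
Qed.

(* The slice v_1 = 1: with alpha = u_1, u_2 = b - alpha v_2, u_3 = c - alpha v_3
   the entries 2 alpha, b, c, d, e are algebraically independent. *)
Definition slice_d : T4 := (- (2%:R * a))%:P * 'X ^+ 2 + (2%:R * b)%:P * 'X + 0%:P.
Definition slice_e : T5 := ((- (2%:R * a))%:P * 'X + b%:P)%:P * 'X + (c%:P * 'X)%:P.
Definition slice_g : T5 := (- (2%:R * a))%:P%:P * 'X ^+ 2 + (2%:R * c)%:P%:P * 'X.
Definition slice4 : T4 -> T4 := pev (@polyC T \o phi) slice_d.
HB.instance Definition _ := GRing.RMorphism.on slice4.
Definition slice5 : T5 -> T5 := pev (@polyC T4 \o slice4) slice_e.
HB.instance Definition _ := GRing.RMorphism.on slice5.
Definition slice6 : {poly T5} -> T5 := pev slice5 slice_g.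
HB.instance Definition _ := GRing.RMorphism.on slice6.

Definition slice_u (i : nat) : T5 :=
  nth 0 [:: a%:P%:P; (b%:P - a%:P * 'X)%:P; c%:P%:P - a%:P%:P * 'X] i.
Definition slice_v (i : nat) : T5 := nth 0 [:: 1; 'X%:P; 'X] i.

Lemma slice_entries : let x i j := slice_u i * slice_v j + slice_u j * slice_v i in
  [/\ x 0 0 = (2%:R * a)%:P%:P, x 0 1 = b%:P%:P & x 0 2 = c%:P%:P] /\
  [/\ x 1 1 = slice_d%:P, x 1 2 = slice_e & x 2 2 = slice_g].
Proof.
move=> x; rewrite /x /slice_u /slice_v /slice_d /slice_e /slice_g /=.
rewrite !(polyC_natr, polyCN, polyC_exp, polyCM, polyCB, polyCD, polyC0).
by move: (a%:P%:P) (b%:P%:P) (c%:P%:P) ('X%:P : T5) ('X : T5) => *; split; split; ring.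
Qed.

Lemma slice6X :
  [/\ slice6 a%:P%:P%:P = (2%:R * a)%:P%:P, slice6 b%:P%:P%:P = b%:P%:P
     & slice6 c%:P%:P%:P = c%:P%:P] /\
  [/\ slice6 'X%:P%:P = slice_d%:P, slice6 'X%:P = slice_e & slice6 'X = slice_g].
Proof.
have s4C x : slice4 x%:P = (phi x)%:P by apply: pevC.
have s4X : slice4 'X = slice_d by apply: pevX.
have s5C x : slice5 x%:P = (slice4 x)%:P by apply: pevC.
have s5X : slice5 'X = slice_e by apply: pevX.
have s6C x : slice6 x%:P = slice5 x by apply: pevC.
rewrite !s6C !s5C !s4C phi_a phi_b phi_c s5X s4X; split; split=> //; exact: pevX.
Qed.

Lemma slice4_inj : injective slice4.
Proof.
apply: pev_inj => //; apply: size_gt1.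
by rewrite !coefD !coefCM coefXn coefX coefC /= mulr0 add0r addr0 mulr1 mulf_neq0.
Qed.

Lemma slice5_inj : injective slice5.
Proof.
apply: pev_inj; first exact: slice4_inj.
apply: size_gt1; rewrite coefD coefCM coefX coefC /= mulr1 addr0.
have a2 : - (2%:R * a) != 0 by rewrite oppr_eq0 mulf_neq0.
by rewrite -lead_coef_eq0; have [_ ->] := lead_coef_linear b a2.
Qed.

Lemma slice6_tower : slice6 (tower_h%:P%:P * 'X + tower_f%:P) = 0.
Proof.
have s5C x : slice5 x%:P = (slice4 x)%:P by apply: pevC.
rewrite /slice6 pev_linear /= s5C {1}/slice5 pev_quadratic /=.
have -> : slice4 tower_h = (2%:R * a)%:P * slice_d + (- b ^+ 2)%:P.
  by rewrite /slice4 pev_linear /= phi_a rmorphN rmorphXn phi_b.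
have s4C x : slice4 x%:P = (phi x)%:P by apply: pevC.
have s4X : slice4 'X = slice_d by apply: pevX.
have -> : slice4 (- a%:P) = - (2%:R * a)%:P by rewrite rmorphN /= s4C phi_a.
have -> : slice4 (2%:R * b * c)%:P = (2%:R * b * c)%:P.
  by rewrite s4C !rmorphM rmorph_nat phi_b phi_c.
have -> : slice4 (- ((c ^+ 2)%:P * 'X)) = - ((c ^+ 2)%:P * slice_d).
  by rewrite rmorphN rmorphM /= s4C s4X rmorphXn phi_c.
rewrite /slice_d /slice_e /slice_g.
rewrite !(polyC_natr, polyCN, polyC_exp, polyCM, polyCB, polyCD, polyC0).
by move: (a%:P%:P) (b%:P%:P) (c%:P%:P) ('X%:P : T5) ('X : T5) => *; ring.
Qed.

Lemma slice6_kernel t : slice6 t = 0 -> dvr (tower_h%:P%:P * 'X + tower_f%:P) t.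
Proof.
apply: linear_kernel; [exact: tower_h_neq0|exact: regm_tower_f|exact: slice6_tower|].
move=> r e; have h : slice5 r = 0 by rewrite -e; apply/esym/pevC.
by apply: slice5_inj; rewrite h rmorph0.
Qed.
End DeterminantTower.

Lemma mpolyX_neq0 n (K : nzRingType) (m : 'X_{1..n}) : 'X_[m] != 0 :> {mpoly K[n]}.
Proof.
apply/eqP => /(congr1 (mcoeff m)); rewrite mcoeffX eqxx mcoeff0 => /eqP.
by rewrite oner_eq0.
Qed.

Section VariableElimination.
Variables (n : nat) (K : idomainType) (i : 'I_n).
Local Notation S := {mpoly K[n]}.

Definition elim_var : S -> S :=
  mmap (@mpolyC n K) (fun j => if j == i then 0 else 'X_j).
HB.instance Definition _ := GRing.RMorphism.on elim_var.

Lemma elim_varX j : elim_var 'X_j = if j == i then 0 else 'X_j.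
Proof. by rewrite /elim_var mmapX mmap1U. Qed.

Lemma elim_varC c : elim_var c%:MP = c%:MP.
Proof. exact: mmapC. Qed.

Lemma dvr_elim_var (s : S) : dvr 'X_i (s - elim_var s).
Proof.
elim/mpolyind: s => [|c m s _ _ IHs]; first by rewrite rmorph0 subr0; exists 0; rewrite mulr0.
rewrite rmorphD opprD addrACA; apply: dvrD => //.
rewrite -mul_mpolyC rmorphM /= elim_varC -mulrBr; apply: dvrMl.
have e1 : 'X_[m] = 'X_i ^+ m i * \prod_(j | j != i) 'X_j ^+ m j :> S.
  by rewrite mpolyXE_id (bigD1 i).
have e2 : elim_var (\prod_(j | j != i) 'X_j ^+ m j) = \prod_(j | j != i) 'X_j ^+ m j.
  rewrite rmorph_prod; apply: eq_bigr => j /negPf ji.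
  by rewrite rmorphXn /= elim_varX ji.
rewrite e1 rmorphM rmorphXn /= e2 elim_varX eqxx -mulrBl mulrC; apply: dvrMl.
case: (m i) => [|k]; first by rewrite !expr0 subrr; exists 0; rewrite mulr0.
by rewrite expr0n subr0 exprS; apply: dvr_mul.
Qed.

(** Setting X_i to 0 has kernel (X_i) and values in a domain. *)
Lemma regm_var c : elim_var c != 0 -> regm 'X_i c.
Proof.
move=> c0 z [y e]; suff z0 : elim_var z = 0 by have := dvr_elim_var z; rewrite z0 subr0.
have /eqP := congr1 elim_var e.
by rewrite !rmorphM /= elim_varX eqxx mul0r mulf_eq0 (negPf c0) => /eqP.
Qed.
End VariableElimination.

Section DoubleFirstVariable.
Variable K : idomainType.
Hypothesis K2 : 2%:R != 0 :> K.
Local Notation T := {mpoly K[3]}.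

Lemma mpoly_nat2_neq0 n : 2%:R != 0 :> {mpoly K[n]}.
Proof. by rewrite -mpolyC_nat mpolyC_eq0. Qed.

Definition double0 : T -> T := mmap (@mpolyC 3 K)
  (fun i => if i == ord0 then 2%:R * 'X_i else 'X_i).
HB.instance Definition _ := GRing.RMorphism.on double0.

Lemma double0X i : double0 'X_i = if i == ord0 then 2%:R * 'X_i else 'X_i.
Proof. by rewrite /double0 mmapX mmap1U. Qed.

Lemma double0_inj : injective double0.
Proof.
have coefE s m : (double0 s)@_m = 2%:R ^+ m ord0 * s@_m.
  elim/mpolyind: s => [|c m' s _ _ IHs]; first by rewrite rmorph0 mcoeff0 mulr0.
  rewrite rmorphD /= !mcoeffD IHs mulrDr; congr (_ + _).
  rewrite -mul_mpolyC rmorphM /= [double0 c%:MP]mmapC !mcoeffCM mulrCA; congr (_ * _).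
  have -> : double0 'X_[m'] = (2%:R ^+ m' ord0)%:MP * 'X_[m'].
    have e1 : 'X_[m'] = 'X_ord0 ^+ m' ord0 * \prod_(j | j != ord0) 'X_j ^+ m' j :> T.
      by rewrite mpolyXE_id (bigD1 ord0).
    have e2 : double0 (\prod_(j | j != ord0) 'X_j ^+ m' j) = \prod_(j | j != ord0) 'X_j ^+ m' j.
      rewrite rmorph_prod; apply: eq_bigr => k /negPf ji.
      by rewrite rmorphXn /= double0X ji.
    by rewrite e1 rmorphM rmorphXn /= e2 double0X eqxx exprMn [in RHS]rmorphXn /= mpolyC_nat
      mulrA.
  by rewrite mcoeffCM mcoeffX; case: eqP => [->|_]; rewrite ?mulr0.
move=> s t st; apply/mpolyP => m; have := congr1 (mcoeff m) st.
by rewrite !coefE => /mulfI; apply; rewrite expf_neq0.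
Qed.
End DoubleFirstVariable.

Section SymmetricEvaluation.
Variables (K : nzRingType) (B : comNzRingType) (phi : {rmorphism K -> B}).
Variables (a b c d e g : B).
Local Notation S := {mpoly K[#|{: symidx 3}|]}.

Definition symeval : S -> B := mmap phi (sym_select a b c d e g).
HB.instance Definition _ := GRing.RMorphism.on symeval.

Lemma symevalX :
  [/\ symeval 'X_(symk 0 0) = a, symeval 'X_(symk 0 1) = b & symeval 'X_(symk 0 2) = c] /\
  [/\ symeval 'X_(symk 1 1) = d, symeval 'X_(symk 1 2) = e & symeval 'X_(symk 2 2) = g].
Proof.
have [[xa xb xc] [xd xe xg]] := sym_selectE a b c d e g.
by rewrite /symeval; split; split; rewrite mmapX mmap1U.
Qed.

Lemma symevalC x : symeval x%:MP = phi x. Proof. exact: mmapC. Qed.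
End SymmetricEvaluation.

Section SymmetricNullCone.
Variable K : idomainType.
Hypothesis K2 : 2%:R != 0 :> K.
Local Notation S := {mpoly K[#|{: symidx 3}|]}.
Local Notation E := {mpoly K[6]}.

Definition uvar (i : nat) : E := 'X_(inord i).
Definition vvar (i : nat) : E := 'X_(inord (3 + i)).

Definition sympar : S -> E :=
  mmap (@mpolyC 6 K) (fun k : 'I_#|{: symidx 3}| => let ij := val (enum_val k) in
    uvar ij.1 * vvar ij.2 + uvar ij.2 * vvar ij.1).
HB.instance Definition _ := GRing.RMorphism.on sympar.

Lemma symparX a b : (a <= b < 3)%N ->
  sympar 'X_(symk a b) = uvar a * vvar b + uvar b * vvar a.
Proof.
case/andP=> lab lb; rewrite /sympar mmapX mmap1U symkK ?lab //= !inordK //.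
exact: leq_ltn_trans lab lb.
Qed.

Lemma symparC c : sympar c%:MP = c%:MP.
Proof. exact: mmapC. Qed.

Definition sdet : S := det3 'X_(symk 0 0) 'X_(symk 0 1) 'X_(symk 0 2)
  'X_(symk 1 1) 'X_(symk 1 2) 'X_(symk 2 2).

Lemma det3_sympar (R : comPzRingType) (u v : nat -> R) :
  let x i j := u i * v j + u j * v i in
  det3 (x 0 0) (x 0 1) (x 0 2) (x 1 1) (x 1 2) (x 2 2) = 0.
Proof. by move=> x; rewrite /x /det3; ring. Qed.

Lemma sympar_sdet : sympar sdet = 0.
Proof.
rewrite /sdet; apply: etrans (det3_sympar uvar vvar); apply: det3_morph.
by split; split; apply: symparX.
Qed.

Local Notation T := {mpoly K[3]}.
Local Notation T6 := {poly {poly {poly T}}}.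
Let a : T := 'X_ord0. Let b : T := 'X_(inord 1). Let c : T := 'X_(inord 2).

Definition to_tower : S -> T6 :=
  symeval (polyC \o (polyC \o (polyC \o @mpolyC 3 K)))
    a%:P%:P%:P b%:P%:P%:P c%:P%:P%:P 'X%:P%:P 'X%:P 'X.
HB.instance Definition _ := GRing.RMorphism.on to_tower.

Definition of_tower0 : T -> S := mmap (@mpolyC _ K)
  (fun i : 'I_3 => 'X_(symk 0 i)).
HB.instance Definition _ := GRing.RMorphism.on of_tower0.

Definition of_tower : T6 -> S :=
  pev (pev (pev of_tower0 'X_(symk 1 1)) 'X_(symk 1 2)) 'X_(symk 2 2).
HB.instance Definition _ := GRing.RMorphism.on of_tower.

Lemma to_towerX :
  [/\ to_tower 'X_(symk 0 0) = a%:P%:P%:P, to_tower 'X_(symk 0 1) = b%:P%:P%:P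
     & to_tower 'X_(symk 0 2) = c%:P%:P%:P] /\
  [/\ to_tower 'X_(symk 1 1) = 'X%:P%:P, to_tower 'X_(symk 1 2) = 'X%:P
     & to_tower 'X_(symk 2 2) = 'X].
Proof.
exact: symevalX.
Qed.

Lemma of_tower0X i : of_tower0 'X_i = 'X_(symk 0 i).
Proof. by rewrite /of_tower0 mmapX mmap1U. Qed.

Lemma of_towerX :
  [/\ of_tower a%:P%:P%:P = 'X_(symk 0 0), of_tower b%:P%:P%:P = 'X_(symk 0 1)
     & of_tower c%:P%:P%:P = 'X_(symk 0 2)] /\
  [/\ of_tower 'X%:P%:P = 'X_(symk 1 1), of_tower 'X%:P = 'X_(symk 1 2)
     & of_tower 'X = 'X_(symk 2 2)].
Proof.
have C1 x : of_tower x%:P = pev (pev of_tower0 'X_(symk 1 1)) 'X_(symk 1 2) x by apply: pevC.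
have C2 x : of_tower x%:P%:P = pev of_tower0 'X_(symk 1 1) x.
  by apply: etrans (C1 _) _; apply: pevC.
have C3 x : of_tower x%:P%:P%:P = of_tower0 x by apply: etrans (C2 _) _; apply: pevC.
have X0 i : (i < 3)%N -> of_tower0 'X_(inord i) = 'X_(symk 0 i).
  by move=> lt_i; rewrite of_tower0X inordK.
split; split.
- by apply: etrans (C3 _) _; apply: of_tower0X.
- by apply: etrans (C3 _) _; apply: X0.
- by apply: etrans (C3 _) _; apply: X0.
- by apply: etrans (C2 _) _; apply: pevX.
- by apply: etrans (C1 _) _; apply: pevX.
- exact: pevX.
Qed.

Lemma of_towerC x : of_tower x%:MP%:P%:P%:P = x%:MP.
Proof.
apply: etrans (pevC _ _ _) _; apply: etrans (pevC _ _ _) _; apply: etrans (pevC _ _ _) _.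
exact: mmapC.
Qed.

Lemma to_towerK : cancel to_tower of_tower.
Proof.
apply: (@mpoly_rmorph_ext _ _ _ (of_tower \o to_tower) idfun) => [x|] /=.
  by rewrite [to_tower _]symevalC; apply: of_towerC.
have [[xa xb xc] [xd xe xg]] := to_towerX.
have [[ya yb yc] [yd ye yg]] := of_towerX.
apply: forall_symks; [exact: etrans (congr1 of_tower xa) ya
 |exact: etrans (congr1 of_tower xb) yb|exact: etrans (congr1 of_tower xc) yc
 |exact: etrans (congr1 of_tower xd) yd|exact: etrans (congr1 of_tower xe) ye
 |exact: etrans (congr1 of_tower xg) yg].
Qed.

Lemma of_tower_det :
  of_tower ((tower_h a b)%:P%:P * 'X + (tower_f a b c)%:P) = sdet.
Proof.
by rewrite tower_det /sdet; apply: det3_morph; apply: of_towerX.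
Qed.

Definition slice_point : 'I_6 -> {poly {poly T}} := fun i =>
  if (i < 3)%N then slice_u a b c i else slice_v T (i - 3).

Definition slice_eval : E -> {poly {poly T}} :=
  mmap (polyC \o (polyC \o @mpolyC 3 K)) slice_point.
HB.instance Definition _ := GRing.RMorphism.on slice_eval.

Lemma slice_evalX i : slice_eval 'X_i = slice_point i.
Proof. by rewrite /slice_eval mmapX mmap1U. Qed.

Lemma slice_eval_uv i : (i < 3)%N ->
  slice_eval (uvar i) = slice_u a b c i /\ slice_eval (vvar i) = slice_v T i.
Proof.
move=> lt_i; rewrite !slice_evalX /slice_point !inordK ?lt_i; try by lia.
by rewrite addKn.
Qed.

(** Restricted to the slice v_0 = 1, the parametrization becomes [slice6]; this is checked on the
    six variables. *)
Lemma slice_sympar s :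
  slice6 a b c (double0 (K := K)) (to_tower s) = slice_eval (sympar s).
Proof.
have [[xa xb xc] [xd xe xg]] := to_towerX.
have R i j : (i <= j < 3)%N -> slice_eval (sympar 'X_(symk i j)) =
    slice_u a b c i * slice_v T j + slice_u a b c j * slice_v T i.
  move=> hij; have [lij lj] := andP hij.
  have [ui vi] := slice_eval_uv (leq_ltn_trans lij lj); have [uj vj] := slice_eval_uv lj.
  by rewrite symparX // rmorphD !rmorphM /= ui vi uj vj.
have da : double0 a = 2%:R * a by rewrite double0X eqxx.
have db : double0 b = b by rewrite double0X -val_eqE /= inordK.
have dc : double0 c = c by rewrite double0X -val_eqE /= inordK.
have [[La Lb Lc] [Ld Le Lg]] := @slice6X T a b c (double0 (K := K)) da db dc.
have [[Ra Rb Rc] [Rd Re Rg]] := slice_entries a b c.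
move: s; pose L := @slice6 T a b c (double0 (K := K)).
have LC x : L x%:P%:P%:P = (double0 x)%:P%:P.
  by apply: etrans (pevC _ _ _) _; apply: etrans (pevC _ _ _) _; congr (_%:P); apply: pevC.
apply: (@mpoly_rmorph_ext _ _ _ (L \o to_tower) (slice_eval \o sympar)) => [x|].
  rewrite /= [to_tower _]symevalC symparC [slice_eval _]mmapC; apply: etrans (LC _) _.
  by congr (_%:P%:P); apply: mmapC.
have go i j t z : (i <= j < 3)%N -> to_tower 'X_(symk i j) = t -> L t = z ->
    slice_u a b c i * slice_v T j + slice_u a b c j * slice_v T i = z ->
    (L \o to_tower) 'X_(symk i j) = (slice_eval \o sympar) 'X_(symk i j).
  by move=> hij e1 e2 e3; apply: etrans (congr1 L e1) _; rewrite e2 /= R.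
apply: forall_symks; [exact: go xa La Ra|exact: go xb Lb Rb|exact: go xc Lc Rc
  |exact: go xd Ld Rd|exact: go xe Le Re|exact: go xg Lg Rg].
Qed.

(** The slice loses nothing: vanishing on it already implies divisibility by the determinant in the
    tower. *)
Lemma sympar_kernel s : sympar s = 0 -> dvr sdet s.
Proof.
move=> s0; have a0 : a != 0 by rewrite mpolyX_neq0.
have b0 : b != 0 by rewrite mpolyX_neq0.
have ab : regm a (b ^+ 2).
  have ne : (inord 1 == ord0 :> 'I_3) = false by rewrite -val_eqE /= inordK.
  apply: regm_var; rewrite rmorphXn /= elim_varX ne.
  by rewrite expf_neq0 // mpolyX_neq0.
have da : double0 a = 2%:R * a by rewrite double0X eqxx.
have db : double0 b = b by rewrite double0X -val_eqE /= inordK.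
have dc : double0 c = c by rewrite double0X -val_eqE /= inordK.
have := @slice6_kernel T a b c (double0 (K := K)) a0 b0 (mpoly_nat2_neq0 K2 3) ab (double0_inj
  K2) da db dc.
move=> /(_ (to_tower s)); rewrite slice_sympar s0 rmorph0 => /(_ erefl)[t et].
exists (of_tower t); rewrite -of_tower_det -[LHS]to_towerK et; exact: rmorphM.
Qed.
End SymmetricNullCone.

(** * The action of O_2 on E: grading and swap *)

Section HomogeneousProjection.
Variables (n : nat) (R : comNzRingType) (w : 'I_n -> int).
Local Notation S := {mpoly R[n]}.

Definition hproj (d : int) : S -> S := mlin (fun m => if wt w m == d then 'X_[m] else 0).
HB.instance Definition _ d := GRing.Linear.on (hproj d).

Lemma hprojX d m : hproj d 'X_[m] = if wt w m == d then 'X_[m] else 0.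
Proof. exact: mlinX. Qed.

Lemma mcoeff_hproj d s m : (hproj d s)@_m = if wt w m == d then s@_m else 0.
Proof.
elim/mpolyind: s => [|c m' s _ _ IHs]; first by rewrite linear0 mcoeff0 if_same.
rewrite linearD linearZ /= !mcoeffD !mcoeffZ IHs hprojX.
have -> : (if wt w m' == d then 'X_[m'] else 0 : S)@_m = if wt w m == d then ('X_[m'] : S)@_m
  else 0.
  rewrite [in RHS]mcoeffX; have [->|ne] := eqVneq m' m.
    by case: ifP; rewrite ?mcoeffX ?eqxx ?mcoeff0.
  by rewrite if_same; case: ifP => _; rewrite ?mcoeff0 // mcoeffX (negPf ne).
by case: ifP; rewrite ?mulr0 ?addr0.
Qed.

Lemma hproj_homog d s : whomog w d (hproj d s).
Proof.
by move=> m; rewrite mcoeff_msupp mcoeff_hproj; case: ifP => [/eqP //|_]; rewrite eqxx.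
Qed.

Lemma hproj_id d s : whomog w d s -> hproj d s = s.
Proof.
move=> hs; apply/mpolyP => m; rewrite mcoeff_hproj; case: eqP => // ne.
by apply/esym/memN_msupp_eq0/negP => /hs.
Qed.

Lemma hprojMl d j (h s : S) : whomog w j h -> hproj (j + d) (h * s) = h * hproj d s.
Proof.
move=> hh; have X m t : hproj (wt w m + d) ('X_[m] * t) = 'X_[m] * hproj d t.
  elim/mpolyind: t => [|c m' t _ _ IHt]; first by rewrite mulr0 !linear0 mulr0.
  rewrite mulrDr !linearD /= IHt mulrDr -scalerAr !linearZ /= -scalerAr; congr (_ *: _ + _).
  rewrite -mpolyXD !hprojX wtD (inj_eq (addrI _)); case: eqP => _; rewrite ?mulr0 //.
  by rewrite mpolyXD.
transitivity (\sum_(m <- msupp h) hproj (j + d) (h@_m *: 'X_[m] * s)).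
  by rewrite -linear_sum -mulr_suml -mpolyE.
rewrite [in RHS](mpolyE h) mulr_suml !big_seq; apply: eq_bigr => m mh.
by rewrite -!scalerAl linearZ /= -(hh m mh) X.
Qed.
End HomogeneousProjection.

Lemma whomog_mmap n k (R : comNzRingType) (w : 'I_n -> int) (w' : 'I_k -> int)
    (g : 'I_k -> {mpoly R[n]}) d s :
  (forall i, whomog w (w' i) (g i)) -> whomog w' d s -> whomog w d (mmap (@mpolyC n R) g s).
Proof.
move=> hg hs; rewrite /mmap big_seq; apply: whomog_sum => m /hs <-.
rewrite -[wt _ _]add0r; apply: whomogM; first exact: whomogC.
rewrite /mmap1; apply: whomog_prod => i _; rewrite mulrC.
by have := whomogXn (n := m i) (hg i); rewrite -mulr_natr natz.
Qed.

Arguments uvar {K} i.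
Arguments vvar {K} i.

Section SymmetricParametrization.
Variable K : idomainType.
Local Notation S := {mpoly K[#|{: symidx 3}|]}.
Local Notation E := {mpoly K[6]}.

(** Weights of the torus SO_2 acting by u -> t u and v -> v / t, which fixes every x_ij; [uvswap]
    represents the other component of O_2. *)
Definition uvdeg (i : 'I_6) : int := if (i < 3)%N then 1 else -1.

Lemma whomog_uvar i : (i < 3)%N -> whomog uvdeg 1 (uvar i : E).
Proof.
move=> lt_i; have := @whomogXU _ K uvdeg (inord i).
by rewrite /uvdeg inordK ?lt_i //; lia.
Qed.

Lemma whomog_vvar i : (i < 3)%N -> whomog uvdeg (-1) (vvar i : E).
Proof.
move=> lt_i; have := @whomogXU _ K uvdeg (inord (3 + i)).
by rewrite /uvdeg inordK; last lia.
Qed.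

Lemma whomog_uv i j : (i < 3)%N -> (j < 3)%N -> whomog uvdeg 0 (uvar i * vvar j : E).
Proof. by move=> hi hj; apply: whomogM (whomog_uvar hi) (whomog_vvar hj). Qed.

Lemma whomog_sympar (s : S) : whomog uvdeg 0 (sympar s).
Proof.
apply: (@whomog_mmap _ _ _ _ (fun=> 0)) => [k|m _].
  by apply: whomogD; apply: whomog_uv.
by rewrite /wt big1 // => i _; rewrite mulr0.
Qed.

Definition uvswap : E -> E := mmap (@mpolyC 6 K)
  (fun i => if (i < 3)%N then vvar i else uvar (i - 3)).
HB.instance Definition _ := GRing.RMorphism.on uvswap.

Lemma uvswapC c : uvswap c%:MP = c%:MP. Proof. exact: mmapC. Qed.

Lemma uvswap_u i : (i < 3)%N -> uvswap (uvar i) = vvar i.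
Proof.
by move=> lt_i; rewrite /uvswap /uvar mmapX mmap1U inordK ?lt_i //; lia.
Qed.

Lemma uvswap_v i : (i < 3)%N -> uvswap (vvar i) = uvar i.
Proof.
move=> lt_i; rewrite /uvswap /vvar mmapX mmap1U inordK; last by lia.
by rewrite addKn.
Qed.

Lemma uvswap_sympar (s : S) : uvswap (sympar s) = sympar s.
Proof.
apply: (@mpoly_rmorph_ext _ _ _ (uvswap \o @sympar K) (@sympar K)) => [c|k] /=.
  by rewrite symparC uvswapC.
have [a [b [hab ->]]] := symk_surj k; have [lab lb] := andP hab.
have la := leq_ltn_trans lab lb.
rewrite symparX // rmorphD !rmorphM /= (uvswap_u la) (uvswap_u lb) (uvswap_v la) (uvswap_v lb).
by rewrite addrC mulrC [X in _ + X]mulrC.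
Qed.

Definition wminor (i j : nat) : E := uvar i * vvar j - uvar j * vvar i.
(** The minors 01, 02, 12 for k = 0, 1, 2. *)
Definition wvar (k : 'I_3) : E := wminor (k == 2 :> nat) (if k == 0 :> nat then 1 else 2).

Lemma uvswap_wminor i j : (i < 3)%N -> (j < 3)%N -> uvswap (wminor i j) = - wminor i j.
Proof.
move=> hi hj; rewrite /wminor rmorphB !rmorphM /=.
by rewrite (uvswap_u hi) (uvswap_u hj) (uvswap_v hi) (uvswap_v hj); ring.
Qed.

Lemma wvar_lt1 (k : 'I_3) : ((k == 2 :> nat) < 3)%N. Proof. by case: (_ == _). Qed.
Lemma wvar_lt2 (k : 'I_3) : ((if k == 0 :> nat then 1 else 2) < 3)%N. Proof. by case: ifP. Qed.

Lemma uvswap_wvar k : uvswap (wvar k) = - wvar k.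
Proof.
apply: uvswap_wminor; [exact: wvar_lt1|exact: wvar_lt2].
Qed.

Lemma whomog_wvar k : whomog uvdeg 0 (wvar k).
Proof.
rewrite /wvar /wminor; apply: whomogD; last apply: whomogN; apply: whomog_uv;
  by [apply: wvar_lt1|apply: wvar_lt2].
Qed.

Lemma sympar_entry i j : (i < 3)%N -> (j < 3)%N ->
  exists s : S, sympar s = uvar i * vvar j + uvar j * vvar i.
Proof.
move=> hi hj; case: (leqP i j) => [le_ij|/ltnW le_ji].
  by exists 'X_(symk i j); rewrite symparX // le_ij.
by exists 'X_(symk j i); rewrite symparX ?le_ji // addrC.
Qed.

(** Minors are odd under the swap, so their products are even; explicitly w_ij w_kl = x_il x_jk -
    x_ik x_jl. *)
Lemma wminor_mul i j k l : (i < 3)%N -> (j < 3)%N -> (k < 3)%N -> (l < 3)%N ->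
  exists s : S, sympar s = wminor i j * wminor k l.
Proof.
move=> hi hj hk hl; have [a ea] := sympar_entry hi hl; have [b eb] := sympar_entry hj hk.
have [c ec] := sympar_entry hi hk; have [d ed] := sympar_entry hj hl.
by exists (a * b - c * d); rewrite rmorphB !rmorphM /= ea eb ec ed /wminor; ring.
Qed.

Lemma wvar_mul k l : exists s : S, sympar s = wvar k * wvar l.
Proof. by apply: wminor_mul; by [apply: wvar_lt1|apply: wvar_lt2]. Qed.

Lemma wminorE i j : (i < 3)%N -> (j < 3)%N ->
  exists c : 'I_3 -> S, wminor i j = \sum_k sympar (c k) * wvar k.
Proof.
move=> hi hj; have W0 : wvar ord0 = wminor 0 1 by [].
have W1 : wvar (lift ord0 ord0) = wminor 0 2 by [].
have W2 : wvar (lift ord0 (lift ord0 ord0)) = wminor 1 2 by [].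
have gen (x y z : S) (M : E) : M = sympar x * wminor 0 1 + sympar y * wminor 0 2 + sympar z *
  wminor 1 2 ->
    exists c : 'I_3 -> S, M = \sum_k sympar (c k) * wvar k.
  move=> e; exists (fun k => [:: x; y; z]`_k).
  by rewrite !big_ord_recl big_ord0 addr0 addrA W0 W1 W2.
have opp a b : wminor a b = - wminor b a by rewrite /wminor; ring.
have ww a : wminor a a = 0 by rewrite /wminor; ring.
case: i hi => [|[|[|//]]] _; case: j hj => [|[|[|//]]] _.
- by apply: (gen 0 0 0); rewrite rmorph0 ww; ring.
- by apply: (gen 1 0 0); rewrite rmorph0 rmorph1; ring.
- by apply: (gen 0 1 0); rewrite rmorph0 rmorph1; ring.
- by apply: (gen (-1) 0 0); rewrite rmorphN rmorph0 rmorph1 [LHS]opp; ring.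
- by apply: (gen 0 0 0); rewrite rmorph0 ww; ring.
- by apply: (gen 0 0 1); rewrite rmorph0 rmorph1; ring.
- by apply: (gen 0 (-1) 0); rewrite rmorphN rmorph0 rmorph1 [LHS]opp; ring.
- by apply: (gen 0 0 (-1)); rewrite rmorphN rmorph0 rmorph1 [LHS]opp; ring.
- by apply: (gen 0 0 0); rewrite rmorph0 ww; ring.
Qed.

(** After inverting 2, the torus invariants split into the image of S and an odd part spanned over
    it by the three minors. *)
Definition so2 (e : E) : Prop := exists (k : nat) (r : S) (t : 'I_3 -> S),
  2%:R ^+ k * e = sympar r + \sum_l sympar (t l) * wvar l.

Lemma so2_sympar r : so2 (sympar r).
Proof.
exists 0%N, r, (fun=> 0); rewrite expr0 mul1r big1 ?addr0 // => l _.
by rewrite rmorph0 mul0r.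
Qed.

Lemma so2D x y : so2 x -> so2 y -> so2 (x + y).
Proof.
move=> [k [r [t e]]] [k' [r' [t' e']]]; exists (k + k')%N.
exists (2%:R ^+ k' * r + 2%:R ^+ k * r'), (fun l => 2%:R ^+ k' * t l + 2%:R ^+ k * t' l).
transitivity (2%:R ^+ k' * (2%:R ^+ k * x) + 2%:R ^+ k * (2%:R ^+ k' * y)).
  by rewrite exprD; ring.
have s2 j (z : S) : sympar (2%:R ^+ j * z) = 2%:R ^+ j * sympar z.
  by rewrite rmorphM rmorphXn rmorph_nat.
rewrite e e' [sympar (_ + _)]rmorphD /= !s2 !mulrDr addrACA; congr (_ + _).
rewrite !mulr_sumr -big_split; apply: eq_bigr => l _.
by rewrite [sympar (_ + _)]rmorphD /= !s2 mulrDl !mulrA.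
Qed.

Lemma so2M x y : so2 x -> so2 y -> so2 (x * y).
Proof.
move=> [k [r [t e]]] [k' [r' [t' e']]].
have [P hP] : exists P : 'I_3 -> 'I_3 -> S, forall i j, sympar (P i j) = wvar i * wvar j.
  have /boolp.choice[P hP] : forall i : 'I_3, exists Pi : 'I_3 -> S,
      forall j, sympar (Pi j) = wvar i * wvar j.
    by move=> i; have /boolp.choice[Pi hPi] := wvar_mul i; exists Pi.
  by exists P.
exists (k + k')%N, (r * r' + \sum_i \sum_j t i * t' j * P i j), (fun l => r * t' l + r' * t l).
rewrite exprD mulrACA e e' mulrDl !mulrDr rmorphD rmorphM /= -!addrA; congr (_ + _).
have -> : (\sum_l sympar (t l) * wvar l) * (\sum_l sympar (t' l) * wvar l) =
    sympar (\sum_i \sum_j t i * t' j * P i j).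
  rewrite rmorph_sum mulr_suml; apply: eq_bigr => i _.
  rewrite rmorph_sum mulr_sumr; apply: eq_bigr => j _ /=.
  by rewrite !rmorphM /= hP mulrACA.
rewrite addrCA addrA addrC; congr (_ + _).
transitivity (\sum_l (sympar (t l) * wvar l * sympar r' + sympar r * (sympar (t' l) * wvar l))).
  by rewrite big_split mulr_suml mulr_sumr.
apply: eq_bigr => l _.
by rewrite rmorphD !rmorphM /=; ring.
Qed.

Lemma so2_uv i j : (i < 3)%N -> (j < 3)%N -> so2 (uvar i * vvar j).
Proof.
move=> hi hj; have [s es] := sympar_entry hi hj; have [c ec] := wminorE hi hj.
exists 1%N, s, c; rewrite -ec es /wminor expr1; ring.
Qed.

Lemma so2_sum (I : eqType) (r : seq I) (F : I -> E) :
  (forall i, i \in r -> so2 (F i)) -> so2 (\sum_(i <- r) F i).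
Proof.
move=> hF; rewrite big_seq; elim/big_ind: _ => //; last exact: so2D.
by rewrite -(rmorph0 (@sympar K)); apply: so2_sympar.
Qed.

Lemma wt_uvdeg (m : 'X_{1..6}) : wt uvdeg m =
  (\sum_(i < 6 | (i < 3)%N) m i)%N%:Z - (\sum_(i < 6 | ~~ (i < 3)%N) m i)%N%:Z.
Proof.
rewrite /wt (bigID (fun i : 'I_6 => i < 3)%N) /= !(big_morph Posz PoszD (erefl 0%:Z)) -sumrN.
by congr (_ + _); apply: eq_bigr => i; rewrite /uvdeg; case: ifP => // _ _; rewrite ?mulr1
  ?mulrN1.
Qed.

(** A nonconstant monomial of degree 0 has a factor u_i v_j, and 2 u_i v_j = x_ij + w_ij. *)
Lemma so2_deg0 (e : E) : whomog uvdeg 0 e -> so2 e.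
Proof.
move=> he; rewrite (mpolyE e); apply: so2_sum => m /he; move: (e@_m) => {e he} c wm.
rewrite -mul_mpolyC; apply: so2M; first by rewrite -symparC; apply: so2_sympar.
have [n] := ubnP (mdeg m); elim: n m wm => // n IHn m wm lt_m.
have [m0|] := eqVneq m 0%MM.
  by rewrite m0 mpolyX0 -(rmorph1 (@sympar K)); apply: so2_sympar.
move=> m_neq0; move: wm; rewrite wt_uvdeg => /eqP; rewrite subr_eq0 => /eqP[] wm.
have [[i [hi mi]] [j [hj mj]]] :
    (exists i, (i < 3)%N /\ (0 < m (inord i))%N) /\ (exists j, (j < 3)%N /\ (0 < m (inord (3 +
      j)))%N).
  have : [exists i, (0 < m i)%N].
    apply/contraT; rewrite negb_exists => /forallP m0; case/eqP: m_neq0.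
    by apply/mnmP => i; rewrite mnm0E; apply/eqP; rewrite -leqn0 leqNgt.
  case/existsP => i mi; case: (ltnP i 3) => hi.
    split; first by exists i; rewrite inord_val.
    have : (0 < \sum_(i < 6 | ~~ (i < 3)%N) m i)%N.
      by rewrite -wm (bigD1 i) //= ltn_addr.
    rewrite lt0n sum_nat_eq0 negb_forall => /existsP[j]; rewrite negb_imply -leqNgt.
    case/andP=> hj mj; exists (j - 3)%N; rewrite subnKC // inord_val lt0n; split=> //.
    by have := ltn_ord j; lia.
  split; last first.
    exists (i - 3)%N; rewrite subnKC // inord_val; split=> //; have := ltn_ord i; lia.
  have : (0 < \sum_(i < 6 | (i < 3)%N) m i)%N.
    by rewrite wm (bigD1 i) -?leqNgt //= ltn_addr.
  rewrite lt0n sum_nat_eq0 negb_forall => /existsP[j]; rewrite negb_imply.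
  by case/andP=> hj mj; exists j; rewrite inord_val lt0n.
pose ui : 'I_6 := inord i; pose vj : 'I_6 := inord (3 + j).
have ne : ui != vj by rewrite -val_eqE /= !inordK; lia.
have em : m = (U_(ui) + U_(vj) + (m - U_(ui) - U_(vj)))%MM.
  move: (mi : (0 < m ui)%N) (mj : (0 < m vj)%N) ne; move: ui vj => k1 k2 m1 m2 ne.
  apply/mnmP => l; rewrite !(mnmDE, mnmBE, mnm1E).
  case: (eqVneq k1 l) => [<-|_]; first by rewrite [k2 == k1]eq_sym (negPf ne); lia.
  by case: (eqVneq k2 l) => [<-|_]; lia.
rewrite em !mpolyXD; apply: so2M; first exact: so2_uv.
apply: IHn; last first.
  by move: lt_m; rewrite {1}em !mdegD !mdeg1; lia.
have : wt uvdeg m = 0 by rewrite wt_uvdeg wm subrr.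
rewrite {1}em !wtD; have wU l : wt uvdeg U_(l) = uvdeg l.
  have := @whomogXU _ K uvdeg l U_(l)%MM; apply.
  by rewrite msuppX inE.
by rewrite !wU /uvdeg !inordK ?hi; try lia; rewrite subrr add0r.
Qed.

End SymmetricParametrization.

(** * Extending operators along the parametrization *)

Section FrobeniusGraph.
Variables (p m : nat) (A : comNzRingType) (B : idomainType) (I : finType).
Variables (j : {rmorphism A -> B}) (W : I -> B) (swap : {rmorphism B -> B}).
Hypotheses (p_pr : prime p) (p_odd : (2 < p)%N) (pB : p \in [pchar B]).
Hypotheses (swap_j : forall s, swap (j s) = j s) (swap_W : forall k, swap (W k) = - W k).
Hypotheses (W_neq0 : forall k, W k != 0).
Hypothesis W_mul : forall k l, exists s, j s = W k * W l.
Local Notation q := (p ^ m)%N.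
Variable delta : A -> B.
Hypothesis deltaD : {morph delta : x y / x + y}.
Hypothesis deltaM : forall x s, delta (x ^+ q * s) = j x ^+ q * delta s.
Hypothesis delta0 : forall s, j s = 0 -> delta s = 0.
Implicit Types (x y : B) (s : A).

Let q_odd : odd q.
Proof.
rewrite oddX orbC; have := even_prime p_pr; case: (odd p) => //= -[e|//].
by move: p_odd; rewrite e.
Qed.

Let delta_0 : delta 0 = 0. Proof. by apply: delta0; rewrite rmorph0. Qed.

Let deltaN s : delta (- s) = - delta s.
Proof. by apply/eqP; rewrite -addr_eq0 -deltaD addNr delta_0. Qed.

Let delta_sum (I0 : Type) (r : seq I0) (P : pred I0) (F : I0 -> A) :
  delta (\sum_(i <- r | P i) F i) = \sum_(i <- r | P i) delta (F i).
Proof. exact: (big_morph delta deltaD delta_0). Qed.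

(* The graph of the q-linear extension of delta to the span of sympar S over
   q-th powers of degree-0 elements. *)
Definition frob_graph x y : Prop := exists (s0 : A) (t : I -> A),
  x = j s0 + \sum_k W k ^+ q * j (t k) /\
  y = delta s0 + \sum_k W k ^+ q * delta (t k).
Local Notation G := frob_graph.

Lemma frob_graph_base s : G (j s) (delta s).
Proof.
exists s, (fun=> 0); split; rewrite big1 ?addr0 // => k _.
  by rewrite rmorph0 mulr0.
by rewrite delta_0 mulr0.
Qed.

Lemma frob_graphD x y x' y' : G x y -> G x' y' -> G (x + x') (y + y').
Proof.
move=> [s [t [-> ->]]] [s' [t' [-> ->]]]; exists (s + s'), (fun k => t k + t' k).
rewrite deltaD rmorphD; split; rewrite addrACA; congr (_ + _).
  by rewrite -big_split; apply: eq_bigr => k _; rewrite rmorphD mulrDr.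
by rewrite -big_split; apply: eq_bigr => k _; rewrite deltaD mulrDr.
Qed.

Lemma frob_graphN x y : G x y -> G (- x) (- y).
Proof.
move=> [s [t [-> ->]]]; exists (- s), (fun k => - t k).
rewrite deltaN rmorphN !opprD -!sumrN; split; congr (_ + _); apply: eq_bigr => k _.
  by rewrite rmorphN mulrN.
by rewrite deltaN mulrN.
Qed.

Lemma frob_graph0 : G 0 0.
Proof. by have := frob_graph_base 0; rewrite rmorph0 delta_0. Qed.

Lemma frob_graph_sum (I0 : Type) (r : seq I0) (P : pred I0) (F H : I0 -> B) :
  (forall i, P i -> G (F i) (H i)) ->
  G (\sum_(i <- r | P i) F i) (\sum_(i <- r | P i) H i).
Proof.
move=> h; elim/big_rec2: _ => [|i y1 y2 Pi hy]; first exact: frob_graph0.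
by apply: frob_graphD => //; apply: h.
Qed.

(** The graph is additive, and p./2.+1 copies of 2 z add up to z because (p + 1) z = z modulo p. *)
Lemma frob_graph_half k x y : G (2%:R ^+ k * x) (2%:R ^+ k * y) -> G x y.
Proof.
elim: k => [|k IHk]; first by rewrite !expr0 !mul1r.
move=> h; apply: IHk; move: h; rewrite !exprS -!mulrA.
move: (2%:R ^+ k * x) (2%:R ^+ k * y) => {}x {}y h.
have e z : z = \sum_(i < p./2.+1) (2%:R * z : B).
  rewrite sumr_const card_ord -[RHS]mulr_natl mulrA -natrM.
  have -> : (p./2.+1 * 2 = p + 1)%N by have := even_prime p_pr; lia.
  by rewrite natrD (pcharf0 pB) add0r mul1r.
by rewrite (e x) (e y); apply: frob_graph_sum.
Qed.

(* Splitting into even and odd parts for the swap u <-> v; the odd part becomes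
   even after multiplication by w^q. *)
Lemma frob_graph_fun (k0 : I) y : G 0 y -> y = 0.
Proof.
move=> [s [t [e0 ->]]]; set o := \sum_k _ in e0.
have eo : swap o = - o.
  rewrite rmorph_sum -sumrN; apply: eq_bigr => k _.
  rewrite rmorphM rmorphXn swap_W swap_j exprNn -signr_odd q_odd.
  by rewrite expr1 mulN1r mulNr.
have es : j s = 0.
  have := congr1 swap e0; rewrite rmorph0 rmorphD swap_j eo => e1.
  have : (p./2.+1 * 2)%N%:R * j s = 0.
    transitivity ((p./2.+1)%:R * (j s + o + (j s - o))); first by rewrite natrM; ring.
    by rewrite -e0 -e1 addr0 mulr0.
  have -> : (p./2.+1 * 2 = p + 1)%N by have := even_prime p_pr; lia.
  by rewrite natrD (pcharf0 pB) add0r mul1r.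
rewrite (delta0 es) add0r; move: e0; rewrite es add0r => /esym o0.
have /boolp.choice[P hP] := W_mul k0.
have w0 : W k0 ^+ q != 0 by rewrite expf_neq0.
apply: (mulfI w0); rewrite mulr0.
have : delta (\sum_k P k ^+ q * t k) = 0.
  apply: delta0; transitivity (W k0 ^+ q * o); last by rewrite o0 mulr0.
  rewrite rmorph_sum mulr_sumr.
  by apply: eq_bigr => k _; rewrite rmorphM rmorphXn hP exprMn mulrA.
rewrite delta_sum => e; rewrite -[RHS]e mulr_sumr; apply: eq_bigr => k _.
by rewrite deltaM hP exprMn mulrA.
Qed.

Lemma frob_graphM_sympar r x y : G x y -> G (j r ^+ q * x) (j r ^+ q * y).
Proof.
move=> [s [t [-> ->]]]; exists (r ^+ q * s), (fun k => r ^+ q * t k).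
rewrite deltaM rmorphM rmorphXn; split; rewrite mulrDr mulr_sumr; congr (_ + _).
  by apply: eq_bigr => k _; rewrite rmorphM rmorphXn; ring.
by apply: eq_bigr => k _; rewrite deltaM; ring.
Qed.

(** Multiplication by W_l^q exchanges the two parts of a representation, since W_l^q W_k^q is the
    q-th power of an element of the image of j. *)
Lemma frob_graphM_wvar l x y : G x y -> G (W l ^+ q * x) (W l ^+ q * y).
Proof.
move=> [s [t [-> ->]]]; have /boolp.choice[P hP] := W_mul l.
exists (\sum_k P k ^+ q * t k), (fun k => if k == l then s else 0).
have sel (F : A -> B) : F 0 = 0 ->
    \sum_k W k ^+ q * F (if k == l then s else 0) = W l ^+ q * F s.
  move=> F0; rewrite (bigD1 l) //= eqxx big1 ?addr0 // => k /negPf ->.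
  by rewrite F0 mulr0.
rewrite !sel ?rmorph0 // rmorph_sum delta_sum; split; rewrite mulrDr addrC mulr_sumr; congr (_ +
  _).
  by apply: eq_bigr => k _; rewrite rmorphM rmorphXn hP exprMn mulrA.
by apply: eq_bigr => k _; rewrite deltaM hP exprMn mulrA.
Qed.

Lemma exprq_sum (I0 : Type) (r : seq I0) (F : I0 -> B) :
  (\sum_(i <- r) F i) ^+ q = \sum_(i <- r) F i ^+ q.
Proof.
apply: (big_morph (fun z : B => z ^+ q)) => [x y|]; first by rewrite exprDn_pchar // pnatX
  (pnatE _ p_pr) pB.
by rewrite expr0n -leqn0 leqNgt expn_gt0 prime_gt0.
Qed.

(** The abstract form of [so2], read modulo p. *)
Definition even_odd_span c := exists k (r : A) (t : I -> A),
  2%:R ^+ k * c = j r + \sum_l j (t l) * W l.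

Lemma frob_graphMq c x y : even_odd_span c -> G x y -> G (c ^+ q * x) (c ^+ q * y).
Proof.
move=> [k [r [t h]]] hG; apply: (@frob_graph_half (k * q)).
rewrite exprM !mulrA -!exprMn h exprDn_pchar ?pnatX ?(pnatE _ p_pr) ?pB // exprq_sum !mulrDl
  !mulr_suml.
apply: frob_graphD; first exact: frob_graphM_sympar.
apply: frob_graph_sum => l _; rewrite exprMn -!mulrA.
by apply/frob_graphM_sympar/frob_graphM_wvar.
Qed.

Lemma frob_graph_dom c l : even_odd_span c -> exists y, G (W l ^+ q * c) y.
Proof.
move=> [k [r [t h]]].
suff [y hy] : exists y, G (2%:R ^+ k * (W l ^+ q * c)) y.
  have [z ez] : exists z, y = 2%:R ^+ k * z.
    exists ((p./2.+1)%:R ^+ k * y); rewrite mulrA -exprMn -natrM.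
    have -> : (2 * p./2.+1 = p + 1)%N by have := even_prime p_pr; lia.
    by rewrite natrD (pcharf0 pB) add0r expr1n mul1r.
  by exists z; apply: (@frob_graph_half k); rewrite -ez.
rewrite mulrCA h mulrDr mulr_sumr.
have domD x x' : (exists y, G x y) -> (exists y, G x' y) -> exists y, G (x + x') y.
  by move=> [y hy] [y' hy']; exists (y + y'); apply: frob_graphD.
apply: (domD).
  by exists (W l ^+ q * delta r); apply/frob_graphM_wvar/frob_graph_base.
elim/big_ind: _; [by exists 0; apply: frob_graph0|exact: domD|].
move=> i _; have [P hP] := W_mul l l; have [P' hP'] := W_mul l i.
(* As q is odd, W_l^q W_i = (W_l W_l)^(q./2) (W_l W_i), a product of elements in the image of j. *)
exists (delta (P ^+ q./2 * P' * t i)).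
have -> : W l ^+ q * (j (t i) * W i) = j (P ^+ q./2 * P' * t i).
  rewrite !rmorphM rmorphXn hP hP' -[in LHS](odd_double_half q) q_odd -mul2n.
  by rewrite exprD expr1 exprM expr2; ring.
exact: frob_graph_base.
Qed.
End FrobeniusGraph.

Section ParametrizationModP.
Variables (p : nat) (K : fieldType).
Hypotheses (p_pr : prime p) (p_odd : (2 < p)%N) (pK : p \in [pchar K]).
Hypothesis K_int : forall c : K, exists z : int, z%:~R = c.
Local Notation S := {mpoly int[#|{: symidx 3}|]}.
Local Notation E := {mpoly int[6]}.
Local Notation Ep := {mpoly K[6]}.
Let f : S := \det (symmetric_varmx 3).

(** The hypothesis [K_int] makes K the prime field. *)
Lemma red_surj k (t : {mpoly K[k]}) : exists s : {mpoly int[k]}, red K s = t.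
Proof.
elim/mpolyind: t => [|c m t _ _ [s es]]; first by exists 0; rewrite rmorph0.
have [z ez] := K_int c; exists (z *: 'X_[m] + s).
by rewrite redD es redZ redX ez.
Qed.

Lemma pchar2_neq0 : 2%:R != 0 :> K.
Proof. by rewrite -(dvdn_pcharf pK) gtnNdvd. Qed.

Definition sympar_p (s : S) : Ep := red K (sympar s).
HB.instance Definition _ := GRing.RMorphism.copy sympar_p (@red K _ \o @sympar int).

Lemma red_uvar i : red K (uvar i) = uvar i. Proof. exact: redX. Qed.
Lemma red_vvar i : red K (vvar i) = vvar i. Proof. exact: redX. Qed.
Lemma redC k c : red K (c%:MP : {mpoly int[k]}) = (c%:~R)%:MP.
Proof. exact: map_mpolyC. Qed.

Lemma sympar_pE s : sympar_p s = sympar (red K s).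
Proof.
apply: (@mpoly_rmorph_ext _ _ _ sympar_p (@sympar K \o @red K _)) => [c|k] /=.
  by rewrite /sympar_p symparC !redC symparC.
have [a [b [hab ->]]] := symk_surj k; rewrite redX symparX // /sympar_p symparX //.
by rewrite redD !redM !red_uvar.
Qed.

Lemma red_uvswap (e : E) : red K (uvswap e) = uvswap (red K e).
Proof.
apply: (@mpoly_rmorph_ext _ _ _ (@red K _ \o @uvswap int) (@uvswap K \o @red K _)) => [c|k] /=.
  by rewrite uvswapC !redC uvswapC.
rewrite redX /uvswap !mmapX !mmap1U; case: ifP => _; [exact: red_vvar|exact: red_uvar].
Qed.

(** So R/pR embeds into the polynomial ring [Ep]; p odd enters through 2 being nonzero in K. *)
Lemma sympar_p_kernel s : sympar_p s = 0 <-> s \in gen_ideal [:: f; p%:R].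
Proof.
have fE : f = @sdet int by apply: det_sym3.
split=> [|/mem_gen_ideal2 [u [v ->]]].
  rewrite sympar_pE => /(sympar_kernel pchar2_neq0) [t]; have [t' <-] := red_surj t.
  have -> : @sdet K = red K (@sdet int).
    by rewrite /sdet rmorph_det3 /= !redX.
  rewrite -redM => /(red_eq pK) [u ->]; apply/mem_gen_ideal2.
  by exists t', u; rewrite fE.
rewrite rmorphD !rmorphM rmorph_nat /= {1}/sympar_p fE sympar_sdet.
by rewrite rmorph0 mul0r add0r -[p%:R]mpolyC_nat (pcharf0 pK) mpolyC0 mul0r.
Qed.

Definition wvar_p (k : 'I_3) : Ep := red K (wvar int k).

Lemma wvar_p_mul k l : exists s : S, sympar_p s = wvar_p k * wvar_p l.
Proof. by have [s es] := wvar_mul int k l; exists s; rewrite /sympar_p es redM. Qed.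

Lemma uvswap_sympar_p s : uvswap (sympar_p s) = sympar_p s.
Proof. by rewrite /sympar_p -red_uvswap uvswap_sympar. Qed.

Lemma uvswap_wvar_p k : uvswap (wvar_p k) = - wvar_p k.
Proof. by rewrite /wvar_p -red_uvswap uvswap_wvar rmorphN. Qed.

Lemma wminor_p_neq0 i j : (i < 3)%N -> (j < 3)%N -> i != j -> red K (wminor int i j) != 0.
Proof.
move=> hi hj ij; rewrite /wminor rmorphB /= !redM !red_uvar.
apply/eqP => /(congr1 (@elim_var 6 _ (inord i))); rewrite rmorphB !rmorphM /= /uvar /vvar
  !elim_varX.
rewrite eqxx mul0r sub0r rmorph0 => /eqP; rewrite oppr_eq0.
have -> : (inord j == inord i :> 'I_6) = false by rewrite -val_eqE /= !inordK; move: hi hj ij;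
  clear; lia.
have -> : (inord (3 + i) == inord i :> 'I_6) = false by rewrite -val_eqE /= !inordK; move: hi hj
  ij; clear; lia.
by rewrite mulf_eq0 !(negPf (mpolyX_neq0 _ _)).
Qed.

Lemma wvar_p_neq0 k : wvar_p k != 0.
Proof.
apply: wminor_p_neq0; [exact: wvar_lt1|exact: wvar_lt2|].
by case: k => -[|[|[|]]].
Qed.

Lemma mpoly_char_p : p%:R = 0 :> Ep.
Proof. by rewrite -mpolyC_nat (pcharf0 pK) mpolyC0. Qed.

Lemma pchar_Ep : p \in [pchar Ep].
Proof. by rewrite inE p_pr mpoly_char_p eqxx. Qed.

Lemma red_so2 (e : E) : whomog uvdeg 0 e ->
  even_odd_span sympar_p wvar_p (red K e).
Proof.
move=> /so2_deg0 [k [r [t h]]]; exists k, r, t.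
have := congr1 (@red K 6) h; rewrite redM redXn rmorph_nat redD => ->; congr (_ + _).
rewrite rmorph_sum; apply: eq_bigr => l _; exact: redM.
Qed.
End ParametrizationModP.

(** * Coprimality of the minors 01 and 02 and of their monomial multiples *)

Lemma regm_mulL (A : idomainType) (x y c : A) : x != 0 ->
  regm x c -> regm y c -> regm (x * y) c.
Proof.
move=> x0 hx hy z [t e]; have [z' ez] : dvr x z.
  by apply: hx; exists (y * t); rewrite e mulrA.
have [z'' ez'] : dvr y z'.
  apply: hy; exists t; apply: (mulfI x0); transitivity (c * z); first by rewrite ez; ring.
  by rewrite e mulrA.
by exists z''; rewrite ez ez' mulrA.
Qed.

Lemma regm_expL (A : idomainType) (x c : A) n : x != 0 -> regm x c -> regm (x ^+ n) c.
Proof.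
move=> x0 hx; elim: n => [|n IHn]; last by rewrite exprS; apply: regm_mulL.
by move=> z _; exists z; rewrite expr0 mul1r.
Qed.

Lemma regm_expR (A : comNzRingType) (x c : A) n : regm x c -> regm x (c ^+ n).
Proof.
by move=> hx; elim: n => [|n IHn]; [apply: regm1|rewrite exprS; apply: regmM].
Qed.

Section LinearInOneVariable.
Variables (n : nat) (K : idomainType) (i : 'I_n).
Local Notation S := {mpoly K[n]}.

Lemma mcoeff_elim_var (s : S) m : (elim_var i s)@_m = if m i == 0%N then s@_m else 0.
Proof.
elim/mpolyind: s => [|c m' s _ _ IHs]; first by rewrite rmorph0 mcoeff0 if_same.
rewrite rmorphD /= -mul_mpolyC rmorphM /= elim_varC !mcoeffD !mcoeffCM IHs.
have -> : elim_var i 'X_[m'] = if m' i == 0%N then 'X_[m'] else 0 :> S.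
  have e1 : 'X_[m'] = 'X_i ^+ m' i * \prod_(j | j != i) 'X_j ^+ m' j :> S.
    by rewrite mpolyXE_id (bigD1 i).
  have e2 : elim_var i (\prod_(j | j != i) 'X_j ^+ m' j) = \prod_(j | j != i) 'X_j ^+ m' j :> S.
    rewrite rmorph_prod; apply: eq_bigr => j /negPf ji.
    by rewrite rmorphXn /= elim_varX ji.
  rewrite e1 rmorphM rmorphXn /= e2 elim_varX eqxx.
  by case: (m' i) => [|k]; rewrite ?expr0 // expr0n mul0r.
have -> : (if m' i == 0%N then 'X_[m'] else 0 : S)@_m = if m i == 0%N then ('X_[m'] : S)@_m else
  0.
  rewrite [in RHS]mcoeffX; have [->|ne] := eqVneq m' m.
    by case: ifP; rewrite ?mcoeffX ?eqxx ?mcoeff0.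
  by rewrite if_same; case: ifP => _; rewrite ?mcoeff0 // mcoeffX (negPf ne).
by case: ifP; rewrite ?mulr0 ?addr0.
Qed.

(** Induction on a bound for the degree of z in X_i: at X_i = 0 only b is left, so h divides the
    constant part of z; the rest is divisible by X_i, which is regular modulo h. *)
Lemma regm_linear (h a b : S) : elim_var i h = h -> elim_var i a = a -> elim_var i b = b ->
  regm h b -> regm h 'X_i -> regm h (a * 'X_i + b).
Proof.
move=> eh ea eb hb hX z; have [k zk] : exists k, forall m, m \in msupp z -> (m i < k)%N.
  exists (\max_(m <- msupp z) m i).+1 => m mz; rewrite ltnS.
  by rewrite (bigD1_seq m mz (msupp_uniq _)) leq_maxl.
elim: k z zk => [|k IHk] z zk [t e].
  exists 0; rewrite mulr0; apply/eqP; rewrite -msupp_eq0; apply/eqP.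
  by case: (msupp z) zk => // m s /(_ m (mem_head _ _)).
have dz0 : dvr h (elim_var i z).
  apply: hb; exists (elim_var i t); have := congr1 (@elim_var n K i) e.
  by rewrite !rmorphM rmorphD rmorphM /= eh ea eb elim_varX eqxx mulr0 add0r.
have [z1 ez] := dvr_elim_var i z.
have dz1 : dvr h z1.
  apply: IHk => [m mz1|].
    have : ('X_i * z1)@_(m + U_(i)) != 0.
      by rewrite mulrC addmC mcoeffMX -mcoeff_msupp.
    rewrite -ez mcoeffB mcoeff_elim_var mnmDE mnm1E eqxx addn1 /= subr0.
    by rewrite -mcoeff_msupp => /zk; rewrite mnmDE mnm1E eqxx addn1.
  apply: hX; have -> : 'X_i * ((a * 'X_i + b) * z1) = (a * 'X_i + b) * z - (a * 'X_i + b) *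
    elim_var i z.
    by rewrite -mulrBr ez; ring.
  by apply: dvrB; [exists t|apply: dvrMl].
by rewrite -(subrK (elim_var i z) z) ez; apply: dvrD => //; apply: dvrMl.
Qed.
End LinearInOneVariable.

Section CoprimeMinors.
Variable K : fieldType.
Local Notation Ep := {mpoly K[6]}.
Local Notation x a := ('X_(inord a) : Ep).

Lemma elim_x a b : (a < 6)%N -> (b < 6)%N ->
  elim_var (inord a) (x b) = if b == a then 0 else x b.
Proof. by move=> ha hb; rewrite elim_varX -val_eqE /= !inordK. Qed.

Definition minor01 : Ep := x 0 * x 4 - x 1 * x 3.
Definition minor02 : Ep := x 0 * x 5 - x 2 * x 3.

Lemma elim_minor a i j k l : (a < 6)%N -> (i < 6)%N -> (j < 6)%N -> (k < 6)%N -> (l < 6)%N ->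
  elim_var (inord a) (x i * x j - x k * x l) =
  (if i == a then 0 else x i) * (if j == a then 0 else x j)
  - (if k == a then 0 else x k) * (if l == a then 0 else x l).
Proof. by move=> ha hi hj hk hl; rewrite rmorphB !rmorphM /= !elim_x. Qed.

Lemma regm_x a b : (a < 6)%N -> (b < 6)%N -> a != b -> regm (x a) (x b).
Proof.
move=> ha hb ab; apply: regm_var; rewrite elim_x // [b == a]eq_sym (negPf ab).
exact: mpolyX_neq0.
Qed.

Let xx a b : x a * x b != 0. Proof. by rewrite mulf_neq0 // mpolyX_neq0. Qed.

Lemma minor01_neq0 : minor01 != 0.
Proof.
apply/eqP => /(congr1 (elim_var (inord 1))); rewrite rmorph0 elim_minor //= mul0r subr0.
by move/eqP; rewrite (negPf (xx _ _)).
Qed.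

Lemma regm_x_minor01 a : (a < 6)%N -> regm (x a) minor01.
Proof.
move=> ha; apply: regm_var; rewrite elim_minor //.
case: a ha => [|[|[|[|[|[|//]]]]]] _ /=; rewrite ?mul0r ?mulr0 ?subr0 ?sub0r ?oppr_eq0 ?xx //.
all: exact: minor01_neq0.
Qed.

Lemma regm_x_minor02 a : (a < 4)%N -> a != 1%N -> regm (x a) minor02.
Proof.
move=> ha a1; apply: regm_var; rewrite elim_minor //; last by lia.
by case: a ha a1 => [|[|[|[|//]]]] //= _ _; rewrite ?mul0r ?mulr0 ?subr0 ?sub0r ?oppr_eq0 ?xx.
Qed.

(** The second minor is linear in x_5, a variable that does not occur in the first. *)
Lemma regm_minors : regm minor01 minor02.
Proof.
have R a : (a < 6)%N -> regm minor01 (x a).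
  by move=> ha; apply: regm_sym; [apply: mpolyX_neq0|apply: regm_x_minor01].
have -> : minor02 = x 0 * x 5 + - (x 2 * x 3) by [].
apply: regm_linear; last exact: R.
- by rewrite elim_minor.
- by rewrite elim_x.
- by rewrite rmorphN rmorphM /= !elim_x.
- by apply/regmN/regmM; apply: R.
Qed.

(** The monomials on the two sides involve disjoint variables, x_0, x_3 and x_1, x_4, and none of
    these divides the opposite minor. *)
Lemma regm_cleared k N q : regm ((minor01 * (x 0 ^+ k * x 3 ^+ N)) ^+ q)
  ((minor02 * (x 1 ^+ k * x 4 ^+ N)) ^+ q).
Proof.
have x0 a : x a != 0 by apply: mpolyX_neq0.
have R a : (a < 6)%N -> regm minor01 (x a).
  by move=> ha; apply: regm_sym; [apply: x0|apply: regm_x_minor01].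
apply: regm_expR; apply: regm_expL.
  by rewrite !mulf_neq0 ?expf_neq0 ?minor01_neq0.
have C (z : Ep) : regm z minor02 -> regm z (x 1) -> regm z (x 4) ->
    regm z (minor02 * (x 1 ^+ k * x 4 ^+ N)).
  by move=> h1 h2 h3; apply: regmM => //; apply: regmM; apply: regm_expR.
apply: regm_mulL; first exact: minor01_neq0.
  by apply: C; [apply: regm_minors|apply: R|apply: R].
apply: regm_mulL; rewrite ?expf_neq0 //; apply: regm_expL => //; apply: C.
all: by [apply: regm_x_minor02|apply: regm_x].
Qed.
End CoprimeMinors.

Lemma cross_mul (B : comPzRingType) q (y z1 z2 x : B) :
  (y * z2) ^+ q * (z1 ^+ q * x) = (y * z1) ^+ q * (z2 ^+ q * x).
Proof. by rewrite !exprMn; ring. Qed.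

Lemma regroup_pow (B : comPzRingType) q (c z x w t : B) : c * z = x * w ->
  c ^+ q * (z ^+ q * t) = w ^+ q * (x ^+ q * t).
Proof. by move=> e; rewrite mulrA -exprMn e exprMn; ring. Qed.

(** The two multiplied pairs have the same first component, so uniqueness gives z2^q a1 = z1^q a2
    after cancelling y^q; then z1^q divides a1 by coprimality. *)
Lemma divisible_value (B : idomainType) (Gr : B -> B -> Prop) q (y z1 z2 x a1 a2 : B) :
  (forall x y y', Gr x y -> Gr x y' -> y = y') -> y != 0 ->
  Gr ((y * z2) ^+ q * (z1 ^+ q * x)) ((y * z2) ^+ q * a1) ->
  Gr ((y * z1) ^+ q * (z2 ^+ q * x)) ((y * z1) ^+ q * a2) ->
  regm (z1 ^+ q) (z2 ^+ q) -> Gr (z1 ^+ q * x) a1 ->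
  exists g, Gr (z1 ^+ q * x) (z1 ^+ q * g).
Proof.
move=> Gfun y0; rewrite cross_mul => B1 B2 reg h1; have := Gfun _ _ _ B1 B2.
rewrite !exprMn -!mulrA => /(mulfI (expf_neq0 q y0)) e.
by have [g eg] := reg _ (ex_intro _ _ e); exists g; rewrite -eg.
Qed.

Section FrobeniusLift.
Variables (p : nat) (K : fieldType).
Hypotheses (p_pr : prime p) (p_odd : (2 < p)%N) (pK : p \in [pchar K]).
Hypothesis K_int : forall c : K, exists z : int, z%:~R = c.
Local Notation S := {mpoly int[#|{: symidx 3}|]}.
Local Notation E := {mpoly int[6]}.
Local Notation Ep := {mpoly K[6]}.
Variables (n : nat) (delta : S -> Ep).
Local Notation q := (p ^ n)%N.
Hypothesis deltaD : {morph delta : x y / x + y}.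
Hypothesis deltaM : forall x s, delta (x ^+ q * s) = sympar_p K x ^+ q * delta s.
Hypothesis delta0 : forall s, sympar_p K s = 0 -> delta s = 0.
Definition sgraph (x y : Ep) : Prop :=
  @frob_graph p n _ _ _ (sympar_p K) (wvar_p K) delta x y.
Local Notation G := sgraph.
Local Notation rd := (@red K 6).

Lemma graph_base s : G (sympar_p K s) (delta s).
Proof. exact: frob_graph_base. Qed.

Lemma graphD x y x' y' : G x y -> G x' y' -> G (x + x') (y + y').
Proof. exact: frob_graphD. Qed.

Lemma graphN x y : G x y -> G (- x) (- y).
Proof. exact: frob_graphN. Qed.

Lemma graphMq (c : E) x y : whomog uvdeg 0 c -> G x y -> G (rd c ^+ q * x) (rd c ^+ q * y).
Proof.
move=> hc; apply: frob_graphMq => //; first exact: (pchar_Ep p_pr).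
  exact: wvar_p_mul.
exact: red_so2.
Qed.

Lemma graph_dom (e : E) l : whomog uvdeg 0 e -> exists y, G (wvar_p K l ^+ q * rd e) y.
Proof.
move=> he; apply: frob_graph_dom => //; first exact: (pchar_Ep p_pr).
  exact: wvar_p_mul.
exact: red_so2.
Qed.

Lemma graph_fun x y y' : G x y -> G x y' -> y = y'.
Proof.
move=> h h'; apply/eqP; rewrite -subr_eq0; apply/eqP.
apply: (@frob_graph_fun p n _ _ _ (sympar_p K) (wvar_p K) (@uvswap K) p_pr p_odd
  (pchar_Ep p_pr pK) _ _ _ _ delta deltaD deltaM delta0 ord0).
- exact: uvswap_sympar_p.
- exact: uvswap_wvar_p.
- exact: wvar_p_neq0.
- exact: wvar_p_mul.
by rewrite -(subrr x); apply: graphD => //; apply: graphN.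
Qed.

Lemma wvar_p0 : wvar_p K ord0 = minor01 K.
Proof. by rewrite /wvar_p /wvar /wminor rmorphB /= !redM !redX. Qed.

Lemma wvar_p1 : wvar_p K (lift ord0 ord0) = minor02 K.
Proof. by rewrite /wvar_p /wvar /wminor rmorphB /= !redM !redX. Qed.

Local Notation u i := (uvar i : E).
Local Notation v i := (vvar i : E).

Lemma whomog_uv_exp i (j k : nat) : (i < 3)%N ->
  whomog uvdeg (j%:Z - k%:Z) (u i ^+ j * v i ^+ k).
Proof.
move=> hi; have := whomogM (whomogXn (n := j) (@whomog_uvar int i hi))
  (whomogXn (n := k) (@whomog_vvar int i hi)).
by rewrite mulNrn !natz.
Qed.

Lemma rd_uv i (j k : nat) :
  rd (u i ^+ j * v i ^+ k) = 'X_(inord i) ^+ j * 'X_(inord (3 + i)) ^+ k.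
Proof. by rewrite redM !redXn !redX. Qed.

(* For x of degree q k, the elements w01^q t^q x and w02^q t'^q x have degree 0
   and lie in the domain of the graph; as w01 t and w02 t' are coprime, the value at
   the first one is divisible by (w01 t)^q. *)
Lemma graph_divisible (k : int) (N : nat) (x : E) : (`|k| <= N)%N ->
  whomog uvdeg (k *+ q) x ->
  exists g, G ((wvar_p K ord0 * rd (u 0 ^+ `|N%:Z - k|%N * v 0 ^+ N)) ^+ q * rd x)
              ((wvar_p K ord0 * rd (u 0 ^+ `|N%:Z - k|%N * v 0 ^+ N)) ^+ q * g).
Proof.
(* Since al = N - k, both t1 and t2 have degree -k, and y has degree k. Hence t1^q x, t2^q x and the
   multipliers y w t1, y w t2 all have degree 0. *)
move=> le_kN hx; set al := `|N%:Z - k|%N; set t1 := u 0 ^+ al * v 0 ^+ N.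
pose t2 := u 1 ^+ al * v 1 ^+ N; pose y := u 0 ^+ `|(N%:Z + k)%R|%N * v 0 ^+ N.
have ht i : (i < 3)%N -> whomog uvdeg (- k) (u i ^+ al * v i ^+ N).
  have -> : - k = al%:Z - N%:Z by rewrite /al; lia.
  exact: whomog_uv_exp.
have ht1 : whomog uvdeg (- k) t1 by apply: ht.
have ht2 : whomog uvdeg (- k) t2 by apply: ht.
have hy : whomog uvdeg k y.
  have {1}-> : k = `|(N%:Z + k)%R|%N%:Z - N%:Z by lia.
  exact: whomog_uv_exp.
have dom l t : whomog uvdeg (- k) t -> exists A, G ((wvar_p K l * rd t) ^+ q * rd x) A.
  move=> h; have h0 : whomog uvdeg 0 (t ^+ q * x).
    by have := whomogM (whomogXn (n := q) h) hx; rewrite mulNrn addNr.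
  have [A hA] := graph_dom l h0; exists A; move: hA.
  by rewrite redM redXn mulrA -exprMn.
have [A1 hA1] := dom ord0 t1 ht1; have [A2 hA2] := dom (lift ord0 ord0) t2 ht2.
have hc l t : whomog uvdeg (- k) t -> whomog uvdeg 0 (y * (wvar int l * t)).
  move=> h; have := whomogM hy (whomogM (@whomog_wvar int l) h).
  by rewrite add0r subrr.
have B1 := graphMq (hc (lift ord0 ord0) t2 ht2) hA1.
have B2 := graphMq (hc ord0 t1 ht1) hA2.
have rdc l t : rd (y * (wvar int l * t)) = rd y * (wvar_p K l * rd t).
  by apply: etrans (redM _ _ _) _; congr (_ * _); apply: redM.
rewrite rdc in B1; rewrite rdc in B2.
have y0 : rd y != 0 by rewrite rd_uv mulf_neq0 ?expf_neq0 // mpolyX_neq0.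
have r1 : wvar_p K ord0 * rd t1 = minor01 K * ('X_(inord 0) ^+ al * 'X_(inord 3) ^+ N).
  by congr (_ * _); [exact: wvar_p0|exact: rd_uv].
have r2 : wvar_p K (lift ord0 ord0) * rd t2 = minor02 K * ('X_(inord 1) ^+ al * 'X_(inord 4) ^+
  N).
  by congr (_ * _); [exact: wvar_p1|exact: rd_uv].
have reg : regm ((wvar_p K ord0 * rd t1) ^+ q) ((wvar_p K (lift ord0 ord0) * rd t2) ^+ q).
  by rewrite r1 r2; exact: regm_cleared.
exact: (divisible_value graph_fun y0 B1 B2 reg hA1).
Qed.

Local Notation dqK := (@dq p K 6 n).
Local Notation J := {ffun 'I_6 -> 'I_q}.

Let q_gt0 : (0 < q)%N. Proof. by rewrite expn_gt0 prime_gt0. Qed.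

Definition low_mnm (b : J) : 'X_{1..6} := [multinom (b i : nat) | i < 6].
Definition colow_mnm (b : J) : 'X_{1..6} := [multinom (q.-1 - b i)%N | i < 6].

(** The monomials with exponents below q form a basis over the q-th powers; multiplication by the
    complementary monomial followed by [dq] is the dual basis. *)
Lemma dq_low (b b' : J) (mu : 'X_{1..6}) :
  dqK ('X_[colow_mnm b'] * 'X_[mu *+ q + low_mnm b]) = (b == b')%:R *: 'X_[mu *+ q].
Proof.
rewrite mpolyXD mulrCA dqMXq -mpolyXD dqX.
have lt_b i := ltn_ord (b i); have lt_b' i := ltn_ord (b' i).
have -> : [forall i : 'I_6, ((colow_mnm b' + low_mnm b)%MM i %% q)%N == q.-1] = (b == b').
  apply/forallP/eqP => [h|-> i].
    apply/ffunP => i; apply: val_inj; have := h i; rewrite mnmDE !mnmE.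
    move: (lt_b i) (lt_b' i) => /=; move: (b i : nat) (b' i : nat) => x y lx ly.
    case: (ltnP (q.-1 - y + x) q) => [lt|ge]; first by rewrite modn_small //; lia.
    by rewrite -(subnK ge) modnDr modn_small; lia.
  by rewrite mnmDE !mnmE subnK ?modn_small //; have := lt_b' i; lia.
case: eqP => [->|_]; last by rewrite !scale0r mulr0.
rewrite !scale1r (_ : (_ - _)%MM = 0%MM) ?mpolyX0 ?mulr1 //.
by apply/mnmP => i; rewrite mnmBE mnmDE !mnmE subnK ?subnn // -ltnS prednK.
Qed.

(** There are six exponents, each below q, with weights 1 and -1. This is the origin of the exponent
    6 used for clearing. *)
Lemma low_wt_bound (b : J) (k : int) : wt uvdeg (low_mnm b) = k *+ q -> (`|k| <= 6)%N.
Proof.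
move=> e; have : (`|wt uvdeg (low_mnm b)| <= 6 * q)%N.
  have h (r : seq 'I_6) : (`|(\sum_(i <- r) (low_mnm b i)%:Z * uvdeg i)%R| <= size r * q)%N.
    elim: r => [|i r IHr]; first by rewrite big_nil.
    rewrite big_cons /= mulSn; have := ltn_ord (b i); rewrite mnmE /uvdeg.
    move: (\sum_(j <- r) _) IHr => z; case: ifP => _; lia.
  by have := h (enum 'I_6); rewrite big_enum size_enum_ord.
rewrite e -mulr_natr natz abszM /= leq_pmul2r //.
Qed.

Local Notation clearer k N := (u 0 ^+ `|N%:Z - k|%N * v 0 ^+ N).

(** If the weight is not a multiple of q, the monomial never occurs as the low part of a degree-0
    monomial and 0 will do. Quantifying over k inside gives one g for each b, as the later choice
    requires. *)
Lemma lift_low_value (b : J) : exists g : E, forall k, wt uvdeg (low_mnm b) = k *+ q ->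
  G ((wvar_p K ord0 * rd (clearer k 6%N)) ^+ q * rd 'X_[low_mnm b])
    ((wvar_p K ord0 * rd (clearer k 6%N)) ^+ q * rd g).
Proof.
have [[k ek]|nk] := pselect (exists k, wt uvdeg (low_mnm b) = k *+ q); last first.
  by exists 0 => k ek; case: nk; exists k.
have hX : whomog uvdeg (k *+ q) ('X_[low_mnm b] : E) by rewrite -ek; apply: whomogX.
have [g hg] := graph_divisible (low_wt_bound ek) hX; have [g' eg'] := red_surj K_int g.
exists g' => k' ek'; suff -> : k' = k by rewrite eg'.
apply: (@mulIf int q%:R); first by rewrite natz eqz_nat -lt0n.
by rewrite !mulr_natr -ek -ek'.
Qed.

(** By [dq_low] this induces modulo p the q-linear map with value g b at the low monomial b, and
    over the integers it is a differential operator. *)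
Definition low_sum (g : J -> E) (e : E) : E :=
  \sum_b g b * dpart q.-1 ('X_[colow_mnm b] * e).

Lemma low_sumD g x y : low_sum g (x + y) = low_sum g x + low_sum g y.
Proof. by rewrite -big_split; apply: eq_bigr => b _; rewrite !mulrDr dpartD mulrDr. Qed.

Lemma red_low_sum g e : rd (low_sum g e) = \sum_b rd (g b) * dqK ('X_[colow_mnm b] * rd e).
Proof.
rewrite /low_sum raddf_sum; apply: eq_bigr => b _; apply: etrans (redM _ _ _) _.
have -> : rd (dpart q.-1 ('X_[colow_mnm b] * e)) = dqK (rd ('X_[colow_mnm b] * e)).
  exact: red_dpart.
by congr (_ * dqK _); apply: etrans (redM _ _ _) _; rewrite redX.
Qed.

Lemma red_low_sumX g (b : J) mu :
  rd (low_sum g 'X_[mu *+ q + low_mnm b]) = 'X_[mu *+ q] * rd (g b).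
Proof.
rewrite red_low_sum (bigD1 b) //= big1 => [|b' /negPf ne]; rewrite redX dq_low.
  by rewrite eqxx scale1r addr0 mulrC.
by rewrite eq_sym ne scale0r mulr0.
Qed.

Definition low_part (m : 'X_{1..6}) : J := [ffun i => Ordinal (ltn_pmod (m i) q_gt0)].

Lemma low_partE (m : 'X_{1..6}) : m = ([multinom (m i %/ q)%N | i < 6] *+ q + low_mnm (low_part
  m))%MM.
Proof. by apply/mnmP => i; rewrite mnmDE mulmnE !mnmE ffunE /= -divn_eq. Qed.

(** The exponent 12 is (6 - k) + (6 + k): the multiplier needed for a low monomial is completed to
    one that does not depend on the monomial. *)
Definition clearing : Ep := wvar_p K ord0 * rd (u 0 ^+ 12 * v 0 ^+ 12).

Lemma clearing_neq0 : clearing != 0.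
Proof.
apply: mulf_neq0; first exact: wvar_p_neq0.
by rewrite rd_uv mulf_neq0 ?expf_neq0 // mpolyX_neq0.
Qed.

Lemma low_sum_graph : exists g : J -> E, forall e, whomog uvdeg 0 e ->
  G (clearing ^+ q * rd e) (clearing ^+ q * rd (low_sum g e)).
Proof.
have [g hg] := choice lift_low_value; exists g => e he.
have hX m : wt uvdeg m = 0 ->
    G (clearing ^+ q * rd 'X_[m]) (clearing ^+ q * rd (low_sum g 'X_[m])).
  set mu := [multinom (m i %/ q)%N | i < 6]; set b := low_part m; set k := wt uvdeg mu.
  have em : m = (mu *+ q + low_mnm b)%MM by apply: low_partE.
  move=> wt0; have eb : wt uvdeg (low_mnm b) = (- k) *+ q.
    move: wt0; rewrite em wtD; have -> : wt uvdeg (mu *+ q)%MM = k *+ q.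
      by rewrite /k /wt -sumrMnl; apply: eq_bigr => i _; rewrite mulmnE PoszM; ring.
    by move/eqP; rewrite addrC addr_eq0 mulNrn => /eqP.
  have le_k := low_wt_bound eb; set y := u 0 ^+ `|(6%:Z - k)%R|%N * v 0 ^+ 6.
  have hc : whomog uvdeg 0 ('X_[mu] * y).
    have := whomogM (@whomogX _ int uvdeg mu) (@whomog_uv_exp 0 `|(6%:Z - k)%R|%N 6 isT).
    by rewrite -/k; have -> : k + (`|(6%:Z - k)%R|%N%:Z - 6%:Z) = 0 by lia.
  have ec : rd ('X_[mu] * y) * (wvar_p K ord0 * rd (clearer (- k) 6%N)) = 'X_[mu] * clearing.
    have -> : rd ('X_[mu] * y) = 'X_[mu] * rd y by apply: etrans (redM _ _ _) _; rewrite redX.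
    rewrite -mulrA; congr (_ * _); rewrite mulrCA; congr (_ * _).
    apply: etrans (esym (redM _ _ _)) _; congr (rd _).
    by rewrite /y mulrACA -!exprD; congr (_ ^+ _ * _); lia.
  have := graphMq hc (hg b _ eb); rewrite !(regroup_pow _ _ ec).
  have -> : rd 'X_[m] = 'X_[mu] ^+ q * rd 'X_[low_mnm b].
    by rewrite [LHS]redX redX mpolyXn -mpolyXD -em.
  have -> : rd (low_sum g 'X_[m]) = 'X_[mu] ^+ q * rd (g b); last by apply.
  by apply: etrans (congr1 (fun m => rd (low_sum g 'X_[m])) em) _; rewrite red_low_sumX mpolyXn.
pose P x := G (clearing ^+ q * rd x) (clearing ^+ q * rd (low_sum g x)).
have low_sum0 : low_sum g 0 = 0 by apply: (addrI (low_sum g 0)); rewrite -low_sumD !addr0.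
have P0 : P 0 by rewrite /P low_sum0 !rmorph0 !mulr0; apply: frob_graph0.
have PD x y : P x -> P y -> P (x + y).
  by move=> hx hy; rewrite /P low_sumD !redD !mulrDr; apply: graphD.
have PN x : P x -> P (- x).
  have -> : P (- x) = G (- (clearing ^+ q * rd x)) (- (clearing ^+ q * rd (low_sum g x))).
    rewrite /P; have -> : low_sum g (- x) = - low_sum g x.
      by apply/eqP; rewrite -addr_eq0 -low_sumD addNr low_sum0.
    by rewrite !rmorphN !mulrN.
  exact: graphN.
have PMn x i : P x -> P (x *+ i).
  move=> hx; elim: i => [|i IHi]; first by rewrite mulr0n.
  by rewrite mulrS; exact: PD hx IHi.
rewrite -/(P e) (mpolyE e).
have {he} : {subset msupp e <= [pred m | wt uvdeg m == 0]} by move=> m /he /= /eqP.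
elim: (msupp e : seq _) => [_|m r IHr hr]; first by rewrite big_nil.
rewrite big_cons; apply: PD; last by apply: IHr => m' h; apply: hr; rewrite inE h orbT.
rewrite -[e@_m]intz scaler_int; have Pm : P 'X_[m] by apply/hX/eqP/hr/mem_head.
by case: (e@_m) => i; rewrite ?NegzE ?mulrNz; [|apply: PN]; apply: PMn.
Qed.

(** Both sides, multiplied by the q-th power of [clearing], are values of the graph at the same
    point, and the graph is single-valued. *)
Lemma exists_lift : exists g : J -> E, forall s, rd (low_sum g (sympar s)) = delta s.
Proof.
have [g hg] := low_sum_graph; exists g => s.
have h1 := hg _ (@whomog_sympar int s).
have h2 : G (clearing ^+ q * sympar_p K s) (clearing ^+ q * delta s).
  have hc := whomogM (@whomog_wvar int ord0) (@whomog_uv_exp 0 12 12 isT).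
  have := graphMq hc (graph_base s).
  by have -> : rd (wvar int ord0 * (u 0 ^+ 12 * v 0 ^+ 12)) = clearing by exact: redM.
have := graph_fun h1 h2; apply: mulfI; rewrite expf_neq0 //; exact: clearing_neq0.
Qed.
End FrobeniusLift.

(** * Operators on the symmetric hypersurface *)

Section RelativeOperators.
Variables (S E : comNzRingType) (phi : {rmorphism S -> E}).

(** Differential operators from S to E, viewed as an S-module through phi. They are needed because
    the lift takes values in E before its power of 2 is cleared. *)
Fixpoint dop (n : nat) (D : S -> E) : Prop :=
  match n with
  | 0%N => forall s, D s = phi s * D 1
  | n'.+1 => {morph D : x y / x + y} /\
             forall r, dop n' (fun s => phi r * D s - D (r * s))
  end.

Lemma eq_dop n (D D' : S -> E) : D =1 D' -> dop n D -> dop n D'.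
Proof. by move=> /funext ->. Qed.

Lemma dop0 n : dop n (fun=> 0).
Proof.
elim: n => [s|n IHn]; first by rewrite mulr0.
by split=> [x y|r]; [rewrite addr0|apply: eq_dop IHn => s; rewrite mulr0 subr0].
Qed.

Lemma dopD n D D' : dop n D -> dop n D' -> dop n (fun s => D s + D' s).
Proof.
elim: n D D' => [|n IHn] D D'; first by move=> h h' s; rewrite mulrDr h h'.
move=> [hD h] [hD' h']; split=> [x y|r]; first by rewrite hD hD' addrACA.
by apply: eq_dop (IHn _ _ (h r) (h' r)) => s; rewrite mulrDr opprD addrACA.
Qed.

Lemma dop_sum n (I : Type) (r : seq I) (D : I -> S -> E) :
  (forall i, dop n (D i)) -> dop n (fun s => \sum_(i <- r) D i s).
Proof.
move=> h; elim: r => [|i r IHr].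
  by apply: eq_dop (dop0 n) => s; rewrite big_nil.
by apply: eq_dop (dopD (h i) IHr) => s; rewrite big_cons.
Qed.

Lemma dop_comp n D (T : E -> E) : {morph T : x y / x + y} ->
  (forall r x, T (phi r * x) = phi r * T x) -> dop n D -> dop n (T \o D).
Proof.
move=> TD Tphi; have T0 : T 0 = 0 by apply: (addrI (T 0)); rewrite -TD !addr0.
have TN x : T (- x) = - T x by apply/eqP; rewrite -addr_eq0 -TD addNr T0.
elim: n D => [|n IHn] D; first by move=> h s; rewrite /= h Tphi.
move=> [hD h]; split=> [x y|r]; first by rewrite /= hD TD.
by apply: eq_dop (IHn _ (h r)) => s; rewrite /= TD TN Tphi.
Qed.

Lemma dopMl n D g : dop n D -> dop n (fun s => g * D s).
Proof. by apply: (dop_comp (T := *%R g)) => [x y|r x]; [rewrite mulrDr|rewrite mulrCA]. Qed.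

Lemma dopN n D : dop n D -> dop n (fun s => - D s).
Proof. by apply: (dop_comp (T := -%R)) => [x y|r x]; [rewrite opprD|rewrite mulrN]. Qed.

Lemma dopMr n D g : dop n D -> dop n (fun s => D (g * s)).
Proof.
elim: n D => [|n IHn] D; first by move=> h s; rewrite h [D (g * 1)]h !rmorphM rmorph1 /=; ring.
move=> [hD h]; split=> [x y|r]; first by rewrite mulrDr hD.
by apply: eq_dop (IHn _ (h r)) => s; rewrite mulrCA.
Qed.
End RelativeOperators.

Lemma dop_restrict (S E : comNzRingType) (phi : {rmorphism S -> E}) n (D : E -> E) :
  dop (idfun : {rmorphism E -> E}) n D -> dop phi n (D \o phi).
Proof.
elim: n D => [|n IHn] D; first by move=> h s; rewrite /= h rmorph1.
move=> [hD h]; split=> [x y|r]; first by rewrite /= rmorphD hD.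
by apply: eq_dop (IHn _ (h (phi r))) => s; rewrite /= rmorphM.
Qed.

(** In the application j is [phi \o repr], not given as a morphism; its additivity and
    multiplicativity are recovered through the surjection pi. *)
Lemma diffop_le_dop (S E : comNzRingType) (phi : {rmorphism S -> E}) (A : comPzRingType)
    (pi : S -> A) (j : A -> E) n (dt : A -> A) (D : S -> E) :
  (forall x, exists s, x = pi s) -> pi 1 = 1 ->
  {morph pi : x y / x + y} -> {morph pi : x y / x * y} ->
  injective j -> (forall s, j (pi s) = phi s) ->
  dop phi n D -> (forall s, j (dt (pi s)) = D s) -> diffop_le n dt.
Proof.
move=> pi_surj pi1 piD piM j_inj jpi.
have jD : {morph j : x y / x + y}.
  by move=> x y; have [[s ->] [t ->]] := (pi_surj x, pi_surj y); rewrite -piD !jpi rmorphD.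
have jM : {morph j : x y / x * y}.
  by move=> x y; have [[s ->] [t ->]] := (pi_surj x, pi_surj y); rewrite -piM !jpi rmorphM.
have j0 : j 0 = 0 by apply: (addrI (j 0)); rewrite -jD !addr0.
have jN x : j (- x) = - j x by apply/eqP; rewrite -addr_eq0 -jD addNr j0.
elim: n dt D => [|n IHn] dt D.
  move=> h e; exists (dt 1) => x; have [s ->] := pi_surj x.
  by apply: j_inj; rewrite jM e -pi1 e jpi mulrC h.
move=> [hD h] e; split=> [x y|x].
  have [[s ->] [t ->]] := (pi_surj x, pi_surj y).
  by apply: j_inj; rewrite -piD jD !e hD.
have [r ->] := pi_surj x; apply: (IHn _ _ (h r)) => s.
by rewrite jD jN jM -piM !e jpi.
Qed.

Lemma mpoly_int_ind k (P : {mpoly int[k]} -> Prop) : P 1 ->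
  (forall x y, P x -> P y -> P (x + y)) -> (forall x, P x -> P (- x)) ->
  (forall i x, P x -> P ('X_i * x)) -> forall s, P s.
Proof.
move=> P1 PD PN PX; have P0 : P 0 by rewrite -(subrr 1); apply: PD => //; apply: PN.
have PXm m : P 'X_[m].
  rewrite mpolyXE_id; elim/big_rec: _ => // i x _ hx.
  elim: (m i) => [|e IHe]; first by rewrite expr0 mul1r.
  by rewrite exprS -mulrA; apply: PX.
have Pn n x : P x -> P (x *+ n).
  move=> hx; elim: n => [|n IHn]; first by rewrite mulr0n.
  by rewrite mulrS; apply: PD.
apply: mpolyind => // c m s _ _ hs; apply: PD => //.
rewrite -[c]intz scaler_int; case: c => n; first exact: Pn.
by rewrite NegzE mulrNz; apply/PN/Pn.
Qed.

(** * Divided derivatives are differential operators over the integers *)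

Section DividedDerivatives.
Variables (k : nat) (R : comNzRingType).
Local Notation S := {mpoly R[k]}.
Implicit Types (al m : 'X_{1..k}) (s : S).

Definition pdiff al : S -> S :=
  mlin (fun m => (\prod_(i < k) 'C(m i, al i))%:R *: 'X_[(m - al)%MM]).
HB.instance Definition _ al := GRing.Linear.on (pdiff al).

Lemma pdiffX al m : pdiff al 'X_[m] = (\prod_(i < k) 'C(m i, al i))%:R *: 'X_[(m - al)%MM].
Proof. exact: mlinX. Qed.

Lemma pdiff0 s : pdiff 0%MM s = s.
Proof.
apply: (eq_mlin (L' := idfun)) => m; rewrite /= pdiffX subm0 big1 ?scale1r // => i _.
by rewrite mnm0E bin0.
Qed.

(** Pascal's rule in the variable i. *)
Lemma pdiff_commX i al m : 'X_i * pdiff al 'X_[m] - pdiff al ('X_i * 'X_[m]) =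
  if al i == 0%N then 0 else - pdiff (al - U_(i))%MM 'X_[m].
Proof.
rewrite -mpolyXD !pdiffX -scalerAr -mpolyXD.
rewrite !(bigD1 (P := predT) i) //= !natrM mnmDE mnm1E eqxx add1n.
have -> : \prod_(j < k | j != i) 'C((U_(i) + m)%MM j, al j) = \prod_(j < k | j != i) 'C(m j, al
  j).
  by apply: eq_bigr => j /negPf ne; rewrite mnmDE mnm1E eq_sym ne.
have -> : \prod_(j < k | j != i) 'C(m j, (al - U_(i))%MM j) = \prod_(j < k | j != i) 'C(m j, al
  j).
  by apply: eq_bigr => j /negPf ne; rewrite mnmBE mnm1E eq_sym ne subn0.
move: (\prod_(j < k | _) _)%N => Q; rewrite mnmBE mnm1E eqxx subn1.
(* Truncated subtraction is exact only under this condition; in the remaining case the binomial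
   coefficient is 0. *)
have eU : (al i <= m i)%N || (al i == 0%N) -> (U_(i) + (m - al) = U_(i) + m - al)%MM.
  move=> h; apply/mnmP => j; rewrite mnmDE !mnmBE mnmDE mnm1E.
  by case: eqP => [<-|]; rewrite ?add0n // addnBA //; case/orP: h => // /eqP ->.
case e : (al i) eU => [|a] /= eU; first by rewrite eU ?orbT // !bin0 subrr.
rewrite binS natrD mulrDl scalerDl opprD addrA.
have -> : (m - (al - U_(i)) = U_(i) + m - al)%MM.
  apply/mnmP => j; rewrite !mnmBE mnmDE mnm1E.
  by case: eqP => [<-|_]; rewrite ?e ?subn0 //; lia.
case: (leqP a.+1 (m i)) eU => [le ->//|lt _]; first by rewrite subrr add0r.
by rewrite bin_small // mul0r !scale0r subrr add0r.
Qed.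

Lemma pdiff_comm i al s : 'X_i * pdiff al s - pdiff al ('X_i * s) =
  if al i == 0%N then 0 else - pdiff (al - U_(i))%MM s.
Proof.
elim/mpolyind: s => [|c m s _ _ IHs].
  rewrite mulr0 linear0 mulr0 subrr.
  by case: ifP; rewrite ?linear0 ?oppr0.
have dX be : pdiff be (c *: 'X_[m] + s) = c *: pdiff be 'X_[m] + pdiff be s.
  by rewrite linearD linearZ.
rewrite dX mulrDr -scalerAr mulrDr -scalerAr linearD linearZ /= opprD addrACA IHs -scalerBr.
rewrite pdiff_commX dX; case: ifP => _; first by rewrite scaler0 addr0.
by rewrite scalerN opprD.
Qed.
End DividedDerivatives.

(** The r whose commutator with D has order n form a subring, by [X_i x, D] = X_i [x, D] + [X_i, D]
    x. *)
Lemma dop_gens k n (D : {mpoly int[k]} -> {mpoly int[k]}) :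
  {morph D : x y / x + y} ->
  (forall i, dop idfun n (fun s => 'X_i * D s - D ('X_i * s))) -> dop idfun n.+1 D.
Proof.
move=> DD hX; split=> //; have D0 : D 0 = 0 by apply: (addrI (D 0)); rewrite -DD !addr0.
have DN x : D (- x) = - D x by apply/eqP; rewrite -addr_eq0 -DD addNr D0.
apply: mpoly_int_ind => [|x y hx hy|x hx|i x hx] /=.
- by apply: eq_dop (dop0 idfun n) => s /=; rewrite !mul1r subrr.
- by apply: eq_dop (dopD hx hy) => s /=; rewrite !mulrDl DD opprD addrACA.
- by apply: eq_dop (dopN hx) => s /=; rewrite !mulNr DN opprD.
- apply: eq_dop (dopD (dopMl 'X_i hx) (dopMr x (hX i))) => s /=.
  by rewrite mulrBr !mulrA addrA subrK.
Qed.

Lemma dop_pdiff k (al : 'X_{1..k}) : dop idfun (mdeg al) (@pdiff k int al).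
Proof.
have [n] := ubnP (mdeg al); elim: n al => // n IHn al; rewrite ltnS => le_n.
case e : (mdeg al) => [|d].
  have -> : al = 0%MM by apply/eqP; rewrite -mdeg_eq0 e.
  by move=> s /=; rewrite !pdiff0 mulr1.
apply: dop_gens => [x y|i]; first exact: linearD.
have [al0|al0] := eqVneq (al i) 0%N.
  by apply: eq_dop (dop0 idfun d) => s; rewrite pdiff_comm al0.
have ed : mdeg (al - U_(i))%MM = d.
  have le : (U_(i) <= al)%MM by rewrite lep1mP.
  by move: e; rewrite -[in mdeg al](submK le) mdegD mdeg1 addn1 => -[].
rewrite -ed; apply: eq_dop (dopN (IHn _ _)) => [s|]; last by rewrite ed -e.
by rewrite pdiff_comm (negPf al0).
Qed.

Lemma dop_dpart k a : exists n, dop idfun n (@dpart k a).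
Proof.
exists (mdeg [multinom a | i < k]); apply: eq_dop (dop_pdiff _) => s.
rewrite dpart_mlin; apply: eq_bigr => m _; congr (_ *: (_%:R *: _)).
by apply: eq_bigr => i _; rewrite mnmE.
Qed.

(** * Uniform denominators for operators of finite order *)

Section UniformDenominator.
Variables (k : nat) (E : comNzRingType) (phi : {rmorphism {mpoly int[k]} -> E}) (N : nat).
Local Notation S := {mpoly int[k]}.
Definition cleared j e := exists r, N%:R ^+ j * e = phi r.

Lemma clearedD j x y : cleared j x -> cleared j y -> cleared j (x + y).
Proof. by move=> [r er] [t et]; exists (r + t); rewrite mulrDr er et rmorphD. Qed.

Lemma clearedN j x : cleared j x -> cleared j (- x).
Proof. by move=> [r er]; exists (- r); rewrite mulrN er rmorphN. Qed.

Lemma clearedM j x s : cleared j x -> cleared j (phi s * x).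
Proof. by move=> [r er]; exists (s * r); rewrite mulrCA er rmorphM. Qed.

Lemma cleared_le i j x : (i <= j)%N -> cleared i x -> cleared j x.
Proof.
move=> le_ij [r er]; exists (N%:R ^+ (j - i) * r).
by rewrite -(subnK le_ij) exprD -mulrA er rmorphM rmorphXn rmorph_nat addnK.
Qed.

(** Induction on the order: D is determined by D 1 and its commutators with the finitely many
    variables, and these have uniform denominators. *)
Lemma cleared_uniform n D : dop phi n D -> (forall s, exists j, cleared j (D s)) ->
  exists j, forall s, cleared j (D s).
Proof.
elim: n D => [|n IHn] D.
  move=> h h1; have [j hj] := h1 1; exists j => s; rewrite h; exact: clearedM.
move=> [DD h] h1; have D0 : D 0 = 0 by apply: (addrI (D 0)); rewrite -DD !addr0.
have DN x : D (- x) = - D x by apply/eqP; rewrite -addr_eq0 -DD addNr D0.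
have [i hi] : exists i : 'I_k -> nat, forall l s, cleared (i l) (phi 'X_l * D s - D ('X_l * s)).
  suff /choice [i hi] : forall l, exists j, forall s, cleared j (phi 'X_l * D s - D ('X_l * s)).
    by exists i.
  move=> l; apply: IHn (h _) _ => s; have [[a ha] [b hb]] := (h1 s, h1 ('X_l * s)).
  exists (a + b)%N; apply: clearedD.
    by apply/clearedM/(cleared_le _ ha)/leq_addr.
  by apply/clearedN/(cleared_le _ hb)/leq_addl.
have [j0 hj0] := h1 1; exists (j0 + \sum_l i l)%N; set j := (_ + _)%N.
have hj l s : cleared j (phi 'X_l * D s - D ('X_l * s)).
  apply: cleared_le (hi l s); rewrite /j (bigD1 l) //=; lia.
apply: mpoly_int_ind => [|x y hx hy|x hx|l x hx].
- by apply: cleared_le hj0; apply: leq_addr.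
- by rewrite DD; apply: clearedD.
- by rewrite DN; apply: clearedN.
- rewrite -[D _](subKr (phi 'X_l * D x)); apply: clearedD; first exact: clearedM.
  exact/clearedN/hj.
Qed.
End UniformDenominator.

Section SymmetricLift.
Variables (p : nat) (K : fieldType).
Hypotheses (p_pr : prime p) (p_odd : (2 < p)%N) (pK : p \in [pchar K]).
Hypothesis K_int : forall c : K, exists z : int, z%:~R = c.
Local Notation S := {mpoly int[#|{: symidx 3}|]}.
Local Notation E := {mpoly int[6]}.
Local Notation Ep := {mpoly K[6]}.
Variables (n : nat) (delta : S -> Ep).
Local Notation q := (p ^ n)%N.
Hypothesis deltaD : {morph delta : x y / x + y}.
Hypothesis deltaM : forall x s, delta (x ^+ q * s) = sympar_p K x ^+ q * delta s.
Hypothesis delta0 : forall s, sympar_p K s = 0 -> delta s = 0.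
Local Notation phi := (@sympar int).

(** Twice the average over O_2: the degree-0 part averages over the torus, and the swap over the two
    components. The factor 2 avoids a division. *)
Definition sym_part (e : E) : E := hproj uvdeg 0 e + uvswap (hproj uvdeg 0 e).

Lemma sym_partD : {morph sym_part : x y / x + y}.
Proof. by move=> x y; rewrite /sym_part linearD rmorphD addrACA. Qed.

Lemma sym_part_natM k e : sym_part (k%:R * e) = k%:R * sym_part e.
Proof. exact: morphD_natM sym_partD. Qed.

Lemma sym_partM s e : sym_part (phi s * e) = phi s * sym_part e.
Proof.
have := hprojMl 0 e (@whomog_sympar int s); rewrite addr0 => h.
by rewrite /sym_part h rmorphM /= uvswap_sympar mulrDr.
Qed.

Lemma sym_part_sympar s : sym_part (phi s) = 2%:R * phi s.
Proof.
rewrite /sym_part (hproj_id (@whomog_sympar int s)) uvswap_sympar.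
by rewrite mulr_natl mulr2n.
Qed.

Lemma sym_part_cleared e : exists j, cleared phi 2 j (sym_part e).
Proof.
have [j [r [t h]]] := so2_deg0 (@hproj_homog _ int uvdeg 0 e).
exists j, (2%:R * r); rewrite rmorphM rmorph_nat /= mulrDr.
have -> : 2%:R ^+ j * uvswap (hproj uvdeg 0 e) = uvswap (2%:R ^+ j * hproj uvdeg 0 e).
  by rewrite rmorphM rmorphXn rmorph_nat.
have -> : uvswap (2%:R ^+ j * hproj uvdeg 0 e) = sympar r - \sum_l sympar (t l) * wvar int l.
  rewrite h rmorphD /= uvswap_sympar rmorph_sum /= -sumrN; congr (_ + _).
  by apply: eq_bigr => l _; rewrite rmorphM /= uvswap_sympar uvswap_wvar mulrN.
by rewrite h addrACA subrr addr0 mulr_natl mulr2n.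
Qed.

Lemma dop_lift : exists T : E -> E,
  [/\ exists k, dop phi k (T \o phi),
      forall s, exists j, cleared phi 2 j (T (phi s)) &
      forall s t, delta s = sympar_p K t -> exists y, T (phi s) = 2%:R * phi t + p%:R * y].
Proof.
have [g hg] := exists_lift p_pr p_odd pK K_int deltaD deltaM delta0.
exists (sym_part \o low_sum g); split.
- have [k hk] := dop_dpart 6 q.-1; exists k.
  have h : dop idfun k (low_sum g).
    by apply: dop_sum => b; apply/dopMl/(dopMr (phi := idfun)).
  apply: (eq_dop (D := sym_part \o (low_sum g \o phi))) => //.
  by apply: dop_comp; [exact: sym_partD|exact: sym_partM|exact: dop_restrict].
- by move=> s; apply: sym_part_cleared.
- move=> s t; rewrite -hg => /(red_eq pK) [y ey]; exists (sym_part y).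
  by rewrite /= ey sym_partD sym_part_sympar sym_part_natM.
Qed.
End SymmetricLift.

Lemma sympar_eq0 s : sympar s = 0 :> {mpoly int[6]} <->
  s \in gen_ideal [:: \det (symmetric_varmx 3)].
Proof.
have -> : \det (symmetric_varmx 3) = @sdet int by apply: det_sym3.
split=> [s0|/asboolP [c ->]].
  have two : 2%:R != 0 :> int by [].
  by have [t ->] := sympar_kernel two s0; apply/gen_idealMr/mem_gen; rewrite inE.
by rewrite big_ord1 rmorphM /= sympar_sdet mulr0.
Qed.

Lemma qproj_kernel (A B : comNzRingType) (gs : seq A) (h : {rmorphism A -> B}) :
  (forall s, h s = 0 <-> s \in gen_ideal gs) ->
  forall s t, qproj gs s = qproj gs t <-> h s = h t.
Proof.
move=> hK s t; rewrite qproj_eq -hK rmorphB; split=> [/eqP|->]; last exact: subrr.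
by rewrite subr_eq0 => /eqP.
Qed.

Lemma exp2_pred_pchar (K : idomainType) p : p \in [pchar K] -> 2%:R != 0 :> K ->
  2%:R ^+ p.-1 = 1 :> K.
Proof.
move=> pK n2; apply: (mulIf n2); rewrite mul1r -exprSr prednK ?prime_gt0 ?(pcharf_prime pK) //.
by rewrite -(pFrobenius_autE pK) pFrobenius_aut_nat.
Qed.

Section LiftToQuotient.
Variables (p : nat) (K : fieldType).
Hypotheses (p_pr : prime p) (p_odd : (2 < p)%N) (pK : p \in [pchar K]).
Hypothesis K_int : forall c : K, exists z : int, z%:~R = c.

(** The factor 2 inherited from [sym_part] raises the exponent to e + 1, a multiple of p - 1, so
    Fermat's theorem applies. *)
Lemma red_double_exp k e (x y : {mpoly int[k]}) : (p.-1 %| e.+1)%N ->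
  red K (2%:R ^+ e * (2%:R * x + p%:R * y)) = red K x.
Proof.
case/dvdnP => c ec; have two : (2%:R : K) ^+ e.+1 = 1.
  by rewrite ec mulnC exprM (exp2_pred_pchar pK (pchar2_neq0 p_odd pK)) expr1n.
have -> : 2%:R ^+ e * (2%:R * x + p%:R * y) = 2%:R ^+ e.+1 * x + p%:R * (2%:R ^+ e * y).
  by rewrite mulrDr exprSr !mulrA [p%:R * _]mulrC.
apply: etrans (redD _ _ _) _; rewrite redM [red K (p%:R * _)]redM (red_p _ pK) mul0r addr0.
have -> : red K (2%:R ^+ e.+1 : {mpoly int[k]}) = 1; last by rewrite mul1r.
rewrite redXn; apply: etrans (congr1 (fun z => z ^+ _) (rmorph_nat (@red K k) 2)) _.
by rewrite -mpolyC_nat -rmorphXn two.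
Qed.

Local Notation S := {mpoly int[#|{: symidx 3}|]}.
Let f : S := \det (symmetric_varmx 3).
Local Notation phi := (@sympar int).
Local Notation spp := (sympar_p K).

Lemma symmetric_lift_gen (d : rquot [:: f; p%:R] -> rquot [:: f; p%:R]) :
  diffop d -> lifts_to [:: f] [:: f; p%:R] d.
Proof.
move=> [m dP]; have [d' [n [d'E d'D d'0 d'M]]] :
  exists (d' : S -> rquot [:: f; p%:R]) (n : nat),
  [/\ forall s, d' s = d (qproj _ s), {morph d' : x y / x + y},
      forall x, qproj [:: f; p%:R] x = 0 -> d' x = 0 &
      forall x s, d' (x ^+ (p ^ n) * s) = qproj _ x ^+ (p ^ n) * d' s].
  have [d' [n [h1 h2 h3 h4]]] := diffop_descent dP (mem_head _ _) (fun x => @mem_gen _ _ x).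
  by exists d', n; split=> // s; rewrite h1 qproj_repr.
(* The operator followed by the embedding of R/pR into [Ep]; the choice of representative is
   harmless by [spp_eq]. *)
pose delta s := spp (repr (d' s)).
have sppK s : spp s = 0 <-> s \in gen_ideal [:: f; p%:R] by apply: sympar_p_kernel.
have spp_eq := qproj_kernel (h := spp) sppK.
have deltaE s t : d' s = qproj _ t -> delta s = spp t.
  by move=> e; apply/spp_eq; rewrite qproj_repr.
have deltaD : {morph delta : x y / x + y}.
  move=> x y; rewrite /delta -rmorphD; apply: deltaE.
  by rewrite d'D qprojD !qproj_repr.
have deltaM x s : delta (x ^+ (p ^ n) * s) = spp x ^+ (p ^ n) * delta s.
  rewrite /delta -rmorphXn -rmorphM; apply: deltaE.
  by rewrite d'M qprojM qprojXn qproj_repr.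
have delta0 s : spp s = 0 -> delta s = 0.
  move=> e; rewrite -(rmorph0 spp); apply: deltaE.
  by rewrite rmorph0; apply: d'0; apply/qproj_eq0/sppK.
have [T [[k hk] hT hdelta]] := dop_lift p_pr p_odd pK K_int deltaD deltaM delta0.
have [j hj] := cleared_uniform hk hT.
(* Then e + 1 = (j + 1) (p - 1) is a multiple of p - 1, and e is at least j, so 2^e still clears all
   denominators. *)
pose e := ((j.+1 * p.-1).-1)%N.
have le_je : (j <= e)%N by rewrite /e; move: p_odd; case: (p) => [|[|[|p']]]; clear; nia.
have phi_eq := qproj_kernel (h := phi) sympar_eq0.
have [dt hdt] : exists dt : rquot [:: f] -> rquot [:: f],
    forall x, phi (repr (dt x)) = 2%:R ^+ e * T (phi (repr x)).
  suff /choice [dt hdt] : forall x : rquot [:: f], exists y : rquot [:: f],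
      phi (repr y) = 2%:R ^+ e * T (phi (repr x)) by exists dt.
  move=> x; have [r er] := cleared_le le_je (hj (repr x)).
  by exists (qproj _ r); apply: etrans (esym er); apply/phi_eq; rewrite qproj_repr.
exists dt; split.
  exists k; apply: (@diffop_le_dop _ _ phi _ (qproj [:: f]) (phi \o repr) k dt
    (fun s => 2%:R ^+ e * T (phi s))).
  - exact: qproj_surj.
  - exact: rmorph1.
  - exact: qprojD.
  - exact: qprojM.
  - by move=> x y /phi_eq; rewrite !qproj_repr.
  - by move=> s /=; apply/phi_eq; rewrite qproj_repr.
  - exact: dopMl hk.
  - move=> s; apply: etrans (hdt _) _; congr (_ * T _); apply/phi_eq; exact: qproj_repr.
move=> s; rewrite -d'E -[d' s]qproj_repr; apply/spp_eq.
have [y ey] := hdelta s (repr (d' s)) erefl.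
have e1 : phi (repr (dt (qproj [:: f] s))) = 2%:R ^+ e * (2%:R * phi (repr (d' s)) + p%:R * y).
  rewrite -ey; apply: etrans (hdt _) _; congr (_ * T _); apply/phi_eq; exact: qproj_repr.
apply: etrans (congr1 (@red K 6) e1) _; apply: red_double_exp.
by rewrite /e prednK ?dvdn_mull // muln_gt0 /= -subn1 subn_gt0 prime_gt1.
Qed.
End LiftToQuotient.

Lemma symmetric_lift p (d : rquot [:: \det (symmetric_varmx 3); p%:R] -> _) :
  prime p -> (2 < p)%N -> diffop d -> lifts_to [:: \det (symmetric_varmx 3)] [:: \det
    (symmetric_varmx 3); p%:R] d.
Proof.
move=> p_pr p_odd; apply: (symmetric_lift_gen (K := 'F_p)) => //; first exact: pchar_Fp.
by move=> c; exists (c : nat)%:Z; rewrite -pmulrn natr_Zp.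
Qed.

Theorem theorem1p2 :
  (* (a) generic determinantal hypersurface, n >= 3 *)
  (forall (n p : nat), (3 <= n)%N -> prime p ->
     let f := \det (generic_varmx n) in
     ~ lifts_to [:: f; (p ^ 2)%N%:R] [:: f; p%:R] (frob_trace f p) /\
     ~ lifts_to [:: f] [:: f; p%:R] (frob_trace f p)) /\
  (* (b) Pfaffian hypersurface, n >= 4 even *)
  (forall (n p : nat), (4 <= n)%N -> ~~ odd n -> prime p ->
     let f := pfaffian (alternating_varmx n) in
     ~ lifts_to [:: f; (p ^ 2)%N%:R] [:: f; p%:R] (frob_trace f p) /\
     ~ lifts_to [:: f] [:: f; p%:R] (frob_trace f p)) /\
  (* (c) 3 x 3 symmetric determinantal hypersurface *)
  (forall p : nat, prime p -> (2 < p)%N ->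
     let f := \det (symmetric_varmx 3) in
     forall d : rquot [:: f; p%:R] -> rquot [:: f; p%:R],
       diffop d -> lifts_to [:: f] [:: f; p%:R] d) /\
  (let f := \det (symmetric_varmx 3) in
   ~ lifts_to [:: f; (2 ^ 2)%N%:R] [:: f; 2%:R] (frob_trace f 2) /\
   ~ lifts_to [:: f] [:: f; 2%:R] (frob_trace f 2)).
Proof.
split; [|split; [|split]].
- move=> n p; case: n => [|[|[|m]]] // _ p_pr; exact: (@generic_det_no_lift m p p_pr).
- move=> n p; case: n => [|[|[|[|m]]]] // _ n_even p_pr.
  by apply: pfaffian_no_lift p_pr; move: n_even; rewrite /= !negbK.
- by move=> p p_pr p_odd f d; apply: symmetric_lift.
- exact: sym2_no_lift.
Qed.
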